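(* Assume the Regularity Conditions. Define $$Q_T(h,g)=-\frac{2}{T}\int_0^T h(t)g(t)\,dN(t)+\frac1T\int_0^T\big(h(t)g(t)\big)^2dt$$ and let $(\tilde h,\tilde g)\in\arg\inf_{h\in\mathcal{H},\,g\in\mathcal{G}}Q_T(h,g)$. Then, as $T\to\infty$, $$\frac1T\int_0^T\big(h_0(t)g_0(t)-\tilde h(t)\tilde g(t)\big)^2dt=O_P\left(B\sqrt{\frac{\ln(1+K)}{T}}\right).$$
   Context: Setting. $\mathbb{M}$ is the space of Radon measures on $\mathbb{R}$. $N$ is a point process on $\mathbb{R}$, viewed as a random element of $\mathbb{M}$ with $N(C)=\int_C dN(t)$, adapted to a filtration $\mathcal{F}=(\mathcal{F}_t)$, with $\mathcal{F}_t$-intensity $\lambda_0$, i.e. the process $M$ with $dM(t)=dN(t)-\lambda_0(t)dt$ is an $\mathcal{F}_t$-martingale. $N$ is the stationary ergodic point process with the dynamics below. $S_t$ is the shift $S_t\nu(\cdot)=\nu(t+\cdot)$ on $\mathbb{M}$. A map $f:\mathbb{M}\to\mathbb{R}$ is causal if $f(\nu)=f(\tilde\nu)$ whenever $\nu=\tilde\nu$ on $(-\infty,0)$; it is nondecreasing if $f(\tilde\nu)\ge f(\nu)$ whenever $\tilde\nu(C)\ge\nu(C)$ for all $C\subset\mathbb{R}$. Regularity Conditions: (i) (Weak exogeneity) There are a positive integer $l$, a strictly positive $f_0:\mathbb{R}^l\times\mathbb{M}\to\mathbb{R}$ with $f_0(x,\cdot)$ nondecreasing and causal for each $x\in\mathbb{R}^l$,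 and a predictable stationary ergodic $\mathbb{R}^l$-valued process $W$ with $W(t)$ independent of $N(t+C)$ for every $C\subseteq(-\infty,0)$, such that $g_0(t)=f_0(W(t),S_tN)$. (ii) (True model) The intensity is not identically zero and equals $\lambda_0(t)=h_0(t)g_0(t)$ with $h_0(t)=c_0+\int_{(-\infty,t)}\sum_{l=1}^Ld_{0,l}e^{-a_{0,l}(t-s)}dN(s)$ and $g_0(t)=X(t)'b_0$, where $X$ is a predictable left-continuous process with values in $[0,1]^K$, $b_0\in[0,\infty)^K$, $|b_0|_1\le B$ ($|\cdot|_1$ the $\ell_1$ norm), $B\sum_{l=1}^L\frac{d_{0,l}}{a_{0,l}}<1$ and $d_{0,1}=1$. (iii) $\mathcal{G}=\{g=X'b:\ b\in\mathbb{R}^K,\ |b|_1\le B,\ b_k\ge0,\ k=1,\dots,K\}$, and $g_0\in\mathcal{G}$. (iv) $\mathcal{H}=\{h_\psi:\psi\in\Psi\}$ with $h_\psi(t)=c+\int_{(-\infty,t)}\sum_{l=1}^Ld_le^{-a_l(t-s)}dN(s)$, $\psi=(c,d,a)$, $\Psi=\mathcal{C}\times\mathcal{D}\times\mathcal{A}$, where $\mathcal{C}\subset(0,\infty)$, $\mathcal{D}\subset[0,\infty)^L$, $\mathcal{A}\subset(0,\infty)^L$ are compact and contain $c_0$, $d_0=(d_{0,1},\dots,d_{0,L})$ and $a_0=(a_{0,1},\dots,a_{0,L})$ respectively. The data are observed on $[0,T]$; $L$ is fixed, and the number of covariates $K$ may be large and depend on $T$. *)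

(* Defs.v *)
From HB Require Import structures.
From mathcomp Require Import all_boot all_order all_algebra.
From mathcomp Require Import all_classical all_reals all_analysis.
From mathcomp Require Import measurable_realfun.

Set Implicit Arguments.
Unset Strict Implicit.
Unset Printing Implicit Defensive.

Import Order.TTheory GRing.Theory Num.Theory.
Import numFieldNormedType.Exports.

Local Open Scope classical_set_scope.
Local Open Scope ring_scope.

Section sigma_algebras.
Context {d : measure_display} {E : measurableType d} {S I : Type}.

(* The sigma-algebra on S generated by the maps f i, for i in D. *)
Definition sigma_gen (D : set I) (f : I -> S -> E) : set (set S) :=
  <<s [set A | exists i B, [/\ D i, measurable B & A = f i @^-1` B]] >>.

(* For sigma-algebras that are not the canonical one of the type S. *)
Definition measurable_wrt (G : set (set S)) (f : S -> E) : Prop :=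
  forall B, measurable B -> G (f @^-1` B).

End sigma_algebras.

Definition rV_borel (R : realType) (l : nat) : set (set 'rV[R]_l) :=
  sigma_gen (E := R) setT (fun (j : 'I_l) (w : 'rV[R]_l) => w 0 j).

(* The product sigma-algebra on the paths of an R^l-valued process. *)
Definition path_sigma (R : realType) (l : nat) : set (set (R -> 'rV[R]_l)) :=
  sigma_gen (E := R) setT
    (fun (tj : R * 'I_l) (w : R -> 'rV[R]_l) => w tj.1 0 tj.2).

Definition path_shift (R : realType) (V : Type) (t : R) (w : R -> V) : R -> V :=
  fun s => w (t + s).

Section radon.
Context (R : realType).

(* On the real line a Borel measure that is finite on compact sets is
   automatically regular. *)
Record radon := Radon {
  radon_measure :> {measure set (measurableTypeR R) -> \bar R};
  radon_compact : forall C : set R, compact C -> (radon_measure C < +oo)%E }.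

(* Generated by the evaluations nu |-> nu C; this is the Borel sigma-algebra of
   the vague topology. *)
Definition radon_sigma : set (set radon) :=
  sigma_gen (E := \bar R) [set C : set (measurableTypeR R) | measurable C]
    (fun C (nu : radon) => nu C).

Definition translate (t : R) : measurableTypeR R -> measurableTypeR R :=
  fun s => s - t.

Lemma measurable_translate t : measurable_fun setT (translate t).
Proof.
have h : measurable_fun setT (fun s : R => s - t).
  by apply: measurable_funB; [exact: measurable_id|exact: measurable_cst].
exact: h.
Qed.

(* The set of s with s - t in C is t + C, so this is C |-> nu (t + C). *)
Definition shift_measure (t : R) (nu : radon) :
    {measure set (measurableTypeR R) -> \bar R} :=
  measure_function_pushforward__canonical__measure_function_Measure nu
    (measurable_translate t).

Lemma shift_measure_compact t nu (C : set R) : compact C ->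
  (shift_measure t nu C < +oo)%E.
Proof.
move=> cC; rewrite /shift_measure/= /pushforward.
have -> : translate t @^-1` C = (fun s : R => s + t) @` C.
  apply/seteqP; split=> [s /= Cs|_ [s Cs <-]].
    by exists (s - t) => //; rewrite subrK.
  by rewrite /= /translate addrK.
apply: radon_compact; apply: continuous_compact => //.
by apply: continuous_subspaceT => s; apply: cvgD; [exact: cvg_id|exact: cvg_cst].
Qed.

Definition radon_shift (t : R) (nu : radon) : radon :=
  Radon (@shift_measure_compact t nu).

Definition causal (f : radon -> R) : Prop :=
  forall nu nu' : radon,
    (forall C : set (measurableTypeR R), measurable C -> C `<=` `]-oo, 0[ ->
      nu C = nu' C) ->
    f nu = f nu'.

Definition nondecreasing_radon (f : radon -> R) : Prop :=
  forall nu nu' : radon,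
    (forall C : set (measurableTypeR R), measurable C -> (nu C <= nu' C)%E) ->
    f nu <= f nu'.

End radon.

Section processes.
Context {R : realType} {d : measure_display} {Omega : measurableType d}.
Context (P : probability Omega R).

(* Y is a random element of the measurable space (S, G), and theta t is the
   shift by t on S. *)
Definition stationary_ergodic (S : Type) (G : set (set S)) (theta : R -> S -> S)
    (Y : Omega -> S) : Prop :=
  [/\ forall A, G A -> measurable (Y @^-1` A),
      forall t A, G A -> P (Y @^-1` (theta t @^-1` A)) = P (Y @^-1` A) &
      forall A, G A -> (forall t, theta t @^-1` A = A) ->
        P (Y @^-1` A) = 0%E \/ P (Y @^-1` A) = 1%E].

Definition filtration (F : R -> set (set Omega)) : Prop :=
  [/\ forall t, sigma_algebra setT (F t),
      forall t, F t `<=` measurable &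
      forall s t, s <= t -> F s `<=` F t].

Definition predictable_sigma (F : R -> set (set Omega)) :
    set (set (R * Omega)) :=
  <<s [set E | exists s t A, F s A /\ E = `]s, t] `*` A] >>.

Definition predictable (F : R -> set (set Omega)) (l : nat)
    (Y : R -> Omega -> 'rV[R]_l) : Prop :=
  forall j : 'I_l, measurable_wrt (E := R) (predictable_sigma F)
    (fun p : R * Omega => Y p.1 p.2 0 j).

(* M t, t >= r, is an F-martingale; M t = E[M t' | F t] is expressed by the
   defining integrals over the events of F t. *)
Definition martingale_from (F : R -> set (set Omega)) (r : R)
    (M : R -> Omega -> R) : Prop :=
  [/\ forall t, r <= t -> measurable_wrt (E := R) (F t) (M t),
      forall t, r <= t -> P.-integrable setT (EFin \o M t) &
      forall t t' A, r <= t -> t <= t' -> F t A ->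
        \int[P]_(omega in A) M t' omega = \int[P]_(omega in A) M t omega].

(* Values in {0, 1, 2, ...} or +oo, without multiple points: jumps of a process
   with an intensity have size one. *)
Definition point_process (N : Omega -> radon R) : Prop :=
  [/\ forall A, radon_sigma A -> measurable (N @^-1` A),
      forall omega (C : set (measurableTypeR R)), measurable C ->
        N omega C = +oo%E \/ exists n : nat, N omega C = (n%:R)%:E &
      forall omega t, (N omega [set t] <= 1)%E].

Definition adapted (F : R -> set (set Omega)) (N : Omega -> radon R) : Prop :=
  forall t (C : set (measurableTypeR R)), measurable C -> C `<=` `]-oo, t] ->
    measurable_wrt (E := \bar R) (F t) (fun omega => N omega C).

(* The time set is the whole line, so dM = dN - lambda dt determines the
   increments of M only: for every origin r, the increment over ]r, t] is a
   martingale in t. *)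
Definition intensity (F : R -> set (set Omega)) (N : Omega -> radon R)
    (lambda : R -> Omega -> R) : Prop :=
  forall r, martingale_from F r (fun t omega =>
    fine (N omega `]r, t]%classic) - \int[lebesgue_measure]_(s in `]r, t]) lambda s omega).

Definition independent_of_past (l : nat) (W : R -> Omega -> 'rV[R]_l)
    (N : Omega -> radon R) : Prop :=
  forall t (C : set (measurableTypeR R)), measurable C -> C `<=` `]-oo, 0[ ->
  let NtC := fun omega => N omega [set t + s | s in (C : set R)] in
  forall A (B : set (\bar R)), rV_borel A -> measurable B ->
    P ((W t @^-1` A) `&` (NtC @^-1` B)) =
      (P (W t @^-1` A) * P (NtC @^-1` B))%E.

Definition weak_exogeneity (F : R -> set (set Omega)) (N : Omega -> radon R)
    (g0 : R -> Omega -> R) : Prop :=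
  exists (l : nat) (f0 : 'rV[R]_l -> radon R -> R) (W : R -> Omega -> 'rV[R]_l),
    [/\ (0 < l)%N,
        (forall x nu, 0 < f0 x nu),
        (forall x, nondecreasing_radon (f0 x) /\ causal (f0 x)),
        [/\ predictable F W,
            stationary_ergodic (@path_sigma R l) (@path_shift R 'rV[R]_l)
              (fun omega t => W t omega) &
            independent_of_past W N] &
        forall t omega, g0 t omega = f0 (W t omega) (radon_shift t (N omega))].

(* Rintegral is 0 where the integral is infinite; for the stationary processes
   considered here this occurs only on a null set. *)
Definition hawkes (N : Omega -> radon R) (L : nat) (c : R) (dd a : 'rV[R]_L) :
    R -> Omega -> R :=
  fun t omega => c + \int[N omega]_(s in `]-oo, t[)
    (\sum_(l < L) dd 0 l * expR (- a 0 l * (t - s))).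

Definition linear_covariates (K : nat) (X : R -> Omega -> 'rV[R]_K)
    (b : 'rV[R]_K) : R -> Omega -> R :=
  fun t omega => \sum_(k < K) X t omega 0 k * b 0 k.

Definition l1norm (K : nat) (b : 'rV[R]_K) : R := \sum_(k < K) `|b 0 k|.

Definition covariates (F : R -> set (set Omega)) (K : nat)
    (X : R -> Omega -> 'rV[R]_K) : Prop :=
  [/\ predictable F X,
      forall t omega, X s omega @[s --> t^'-] --> X t omega &
      forall t omega k, 0 <= X t omega 0 k <= 1].

Definition class_G (K : nat) (X : R -> Omega -> 'rV[R]_K) (B : R) :
    set (R -> Omega -> R) :=
  [set g | exists b, [/\ l1norm b <= B, forall k, 0 <= b 0 k &
                         g = linear_covariates X b]].

Definition class_H (N : Omega -> radon R) (L : nat) (C : set R)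
    (D A : set 'rV[R]_L) : set (R -> Omega -> R) :=
  [set h | exists c dd a, [/\ C c, D dd, A a & h = hawkes N c dd a]].

Definition parameter_space (L : nat) (C : set R) (D A : set 'rV[R]_L) : Prop :=
  [/\ compact C /\ (forall c, C c -> 0 < c),
      compact D /\ (forall dd, D dd -> forall l, 0 <= dd 0 l) &
      compact A /\ (forall a, A a -> forall l, 0 < a 0 l)].

Definition contrast (N : Omega -> radon R) (T : R) (h g : R -> Omega -> R)
    (omega : Omega) : R :=
  - (2 / T) * \int[N omega]_(t in `[0, T]) (h t omega * g t omega) +
  T^-1 * \int[lebesgue_measure]_(t in `[0, T]) (h t omega * g t omega) ^+ 2.

Definition argmin2 (U V : Type) (SU : set U) (SV : set V) (q : U -> V -> R)
    (u : U) (v : V) : Prop :=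
  [/\ SU u, SV v & forall u' v', SU u' -> SV v' -> q u v <= q u' v'].

(* Stated with a measurable event covering the exceptional set, because a
   selection of minimizers need not be measurable; for random variables Z T
   this is the usual notion. *)
Definition bounded_in_proba (Z : R -> Omega -> R) (r : R -> R) : Prop :=
  forall e : R, 0 < e -> exists M : R, 0 < M /\
    \forall T \near +oo, exists E : set Omega,
      [/\ measurable E, (P E <= e%:E)%E &
          [set omega | M * r T < `|Z T omega|] `<=` E].

End processes.

(* Main.v *)
Require Import Defs.
From HB Require Import structures.
From mathcomp Require Import all_boot all_order all_algebra.
From mathcomp Require Import all_classical all_reals all_analysis.
From mathcomp Require Import measurable_realfun ring lra.

Set Implicit Arguments.
Unset Strict Implicit.
Unset Printing Implicit Defensive.

Import Order.TTheory GRing.Theory Num.Theory.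
Import numFieldNormedType.Exports.

Local Open Scope classical_set_scope.
Local Open Scope ring_scope.

(* The minimising property of (htilde, gtilde) bounds the quadratic loss by 2/T
   times the integral of htilde gtilde - h0 g0 against dM = dN - lambda0 dt, hence
   by the supremum of such integrals over the whole class.  Expanding e^{-a u} in
   powers of u around the largest admissible rate has nonnegative coefficients and
   writes every h_psi g as a nonnegative combination, with summable majorants, of
   countably many predictable regressors u_j X_k, all dominated by one slow
   exponential kernel.  For fixed j, a softmax (log-sum-exp) supermartingale
   argument bounds the mean of max_k |int u_j X_k dM| by a multiple of
   sqrt (T ln (2 K)).

   The increments are controlled by V = sum_i w_i conv (decay a_i), a weighted sum
   of exponential convolutions.  As B sum_i w_i < 1, V^4 has a negative drift, which
   bounds its moments from time -1 on, on events {V(-1) <= M} of the past.  That V(-1)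
   is finite almost surely follows by Borel-Cantelli from the tail of N on a
   unit interval, obtained from the same moments and stationarity. *)

(** * Predictable processes *)

(** The class is infinite in the rates, so no union bound over it is available. Once expanded, the
    only supremum left for each j is a maximum over covariates, and the geometric decay of the
    coefficients, uniform over the compact parameter set, sums over j. The increments of the noise
    are unbounded: on a unit interval they are of order (1 + V)^2, a regressor times a number of
    points, and the softmax argument squares them, whence the fourth power of V. No moment of the
    stationary law is known in advance, hence the use of past events, of probability close to one
    once V is known to be finite. Using the moments for that looks circular, as they start from a
    finite V. Finiteness is therefore obtained twice. For the rates of the true intensity, an
    infinite past makes the real-valued Hawkes integral collapse to 0 and bounds the intensity,
    which up to a null event excludes an infinite past. The moments and stationarity then give a
    count tail that serves every positive rate, including the slow one that dominates the regressors
    but is absent from the intensity. *)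

Section nonneg_induction.
Local Open Scope ereal_scope.
Context d (T : measurableType d) (R : realType).

Import HBNNSimple.

(** This is the standard machine: a nonnegative measurable function is the increasing limit of
    simple functions, each a finite combination of indicators of its level sets. *)
Lemma ge0_measurable_ind (Q : (T -> \bar R) -> Prop) :
  (forall A, measurable A -> Q (fun x => (\1_A x)%:E)) ->
  (forall f g, (forall x, 0 <= f x) -> (forall x, 0 <= g x) ->
     measurable_fun setT f -> measurable_fun setT g ->
     Q f -> Q g -> Q (fun x => f x + g x)) ->
  (forall (k : R) f, (0 <= k)%R -> (forall x, 0 <= f x) ->
     measurable_fun setT f -> Q f -> Q (fun x => k%:E * f x)) ->
  (forall f_ : (T -> \bar R)^nat, (forall n x, 0 <= f_ n x) ->
     (forall n, measurable_fun setT (f_ n)) ->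
     (forall x, nondecreasing_seq (f_ ^~ x)) -> (forall n, Q (f_ n)) ->
     Q (fun x => limn (f_ ^~ x))) ->
  forall f, (forall x, 0 <= f x) -> measurable_fun setT f -> Q f.
Proof.
move=> Qi QD QZ Ql f f0 mf.
pose f_ := nnsfun_approx measurableT mf.
have Qf n : Q (fun x => (f_ n x)%:E).
  (* Restricting to [0 <= y] changes nothing, negative levels having empty preimages, and lets
     closure under nonnegative scaling apply to each term. *)
  have -> : (fun x => (f_ n x)%:E) = fun x =>
      \sum_(y <- finmap.enum_fset (fset_set (range (f_ n))) | (0 <= y)%R)
        (y%:E * (\1_(f_ n @^-1` [set y]) x)%:E).
    apply/funext => x; rewrite fimfunE fsbig_finite//= -sumEFin.
    rewrite big_mkcond [RHS]big_mkcond/=; apply: eq_bigr => y _.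
    by case: ifPn => // y0; rewrite preimage_nnfun0 ?indic0 ?mulr0// ltNge.
  elim: (finmap.enum_fset _) => [|y s IHs].
    rewrite (_ : (fun _ => _) = fun x => 0%:E * (\1_set0 x)%:E).
      apply: (QZ _ _ (lexx _)); [by move=> x; rewrite lee_fin| |exact: Qi].
      exact/measurable_EFinP/measurable_indic.
    by apply/funext => x; rewrite big_nil indic0 mule0.
  have [y0|y0] := boolP (0 <= y)%R; last first.
    rewrite (_ : (fun _ => _) = fun x =>
      \sum_(y <- s | (0 <= y)%R) (y%:E * (\1_(f_ n @^-1` [set y]) x)%:E)) //.
    by apply/funext => x; rewrite big_cons (negbTE y0).
  have mz z : measurable_fun setT (fun x : T => z%:E * (\1_(f_ n @^-1` [set z]) x)%:E : \bar R).
    apply: measurable_funeM; apply/measurable_EFinP; exact: measurable_indic.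
  rewrite (_ : (fun _ => _) = fun x => y%:E * (\1_(f_ n @^-1` [set y]) x)%:E +
      \sum_(y <- s | (0 <= y)%R) (y%:E * (\1_(f_ n @^-1` [set y]) x)%:E)).
    apply: QD => //.
    - by move=> x; rewrite mule_ge0 ?lee_fin.
    - by move=> x; apply: sume_ge0 => z z0; rewrite mule_ge0 ?lee_fin.
    - under eq_fun do rewrite big_mkcond/=.
      apply: (@emeasurable_sum _ _ R _ _ s (fun z x =>
        if (0 <= z)%R then z%:E * (\1_(f_ n @^-1` [set z]) x)%:E else 0)) => z.
      by case: (0 <= z)%R => //; exact: measurable_cst.
    - apply: (QZ _ _ y0); [by move=> x; rewrite lee_fin| |exact: Qi].
      exact/measurable_EFinP/measurable_indic.
  by apply/funext => x; rewrite big_cons y0.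
have -> : f = fun x => limn (fun n => (f_ n x)%:E).
  apply/funext => x; apply/esym/cvg_lim => //.
  exact: (cvg_nnsfun_approx measurableT mf (fun x _ => f0 x)).
apply: Ql => //.
- by move=> n x; rewrite lee_fin.
- by move=> n; exact/measurable_EFinP.
- by move=> x m n mn; rewrite lee_fin; exact/lefP/nd_nnsfun_approx.
Qed.

End nonneg_induction.

Section locally_finite_kernel.
Local Open Scope ereal_scope.
Context d d' (X : measurableType d) (Y : measurableType d') (R : realType).

(** Meant for measures that are only finite on [D], as random Radon measures are on bounded sets.
    Indicators are handled by a Dynkin argument, in which the finiteness of [k x D] allows
    complements to be taken by subtraction. *)
Lemma measurable_integral_kernel (k : X -> {measure set Y -> \bar R})
    (D : set Y) (f : X * Y -> \bar R) :
  measurable D -> (forall x, k x D < +oo) ->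
  (forall C, measurable C -> C `<=` D -> measurable_fun setT (fun x => k x C)) ->
  (forall z, 0 <= f z) -> measurable_fun setT f ->
  measurable_fun setT (fun x => \int[k x]_(s in D) f (x, s)).
Proof.
move=> mD kD mk f0 mf.
have mx g x : measurable_fun setT (g : X * Y -> \bar R) ->
    measurable_fun D (fun s => g (x, s)).
  move=> mg; apply: measurable_funTS.
  exact: (measurableT_comp mg (measurable_pair1 x)).
pose Q (f : X * Y -> \bar R) :=
  measurable_fun setT (fun x => \int[k x]_(s in D) f (x, s)).
apply: (@ge0_measurable_ind _ _ R Q) f0 mf; rewrite /Q => {Q f}.
- have xT x : xsection [set: X * Y] x = setT.
    by apply/seteqP; split=> // y _; rewrite /xsection/= in_setT.
  pose C := [set A `*` B | A in @measurable _ X & B in @measurable _ Y].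
  have iE A x : measurable A -> \int[k x]_(s in D) (\1_A (x, s))%:E =
      k x (xsection A x `&` D).
    move=> mA; have mxA := measurable_xsection x mA.
    rewrite -(integral_indic (k x) mD mxA).
    by apply: eq_integral => s _; rewrite !indicE mem_xsection.
  have fk x A : measurable A -> k x (xsection A x `&` D) < +oo.
    move=> mA; apply: le_lt_trans (kD x); apply: le_measure; rewrite ?inE//.
    by apply: measurableI => //; exact: measurable_xsection.
  move=> A mA; under eq_fun => x do rewrite (iE _ _ mA).
  suff H : forall A, <<s C >> A ->
      measurable_fun setT (fun x => k x (xsection A x `&` D)).
    by apply: H; rewrite -measurable_prod_measurableType.
  apply: (dynkin_induction (@measurable_prod_measurableType _ _ X Y)
    (P := fun A => measurable_fun setT (fun x => k x (xsection A x `&` D)))).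
  + move=> _ _ [X1 mX1 [X2 mX2 <-]] [Y1 mY1 [Y2 mY2 <-]].
    exists (X1 `&` Y1); first exact: measurableI.
    by exists (X2 `&` Y2); [exact: measurableI|rewrite setXI].
  + by under eq_fun do rewrite xT setTI; exact: mk.
  + move=> _ [A1 mA1 [A2 mA2 <-]].
    rewrite (_ : (fun x => _) = fun x => (\1_A1 x)%:E * k x (A2 `&` D)).
      apply: emeasurable_funM.
        by apply/measurable_EFinP; exact: measurable_indic.
      by apply: mk; [exact: measurableI|exact: subIsetr].
    apply/funext => x; rewrite indicE; have [xA|xA] := boolP (x \in A1).
      by rewrite mul1e in_xsectionX.
    by rewrite mul0e notin_xsectionX// set0I measure0.
  + move=> S mS mkS.
    rewrite (_ : (fun x => _) = fun x => k x D - k x (xsection S x `&` D)).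
      by apply: emeasurable_funB => //; exact: mk.
    apply/funext => x.
    have mSx := measurable_xsection x mS.
    rewrite [xsection S x `&` D]setIC -measureD//; last exact: kD.
    by congr (k x _); rewrite -setTD xsectionD xT setTD setDE setIC.
  + move=> S mS tS mkS.
    rewrite (_ : (fun x => _) = fun x =>
        \sum_(0 <= n <oo) k x (xsection (S n) x `&` D)).
      by apply: ge0_emeasurable_sum.
    apply/funext => x; rewrite xsection_bigcup setI_bigcupl.
    rewrite measure_bigcup//.
    * by apply: eq_eseriesl => n; rewrite in_setT.
    * by move=> n _; apply: measurableI => //; exact: measurable_xsection.
    * exact/trivIset_setIr/trivIset_xsection.
- move=> f g f0 g0 mf mg If Ig.
  rewrite (_ : (fun x => _) = (fun x => \int[k x]_(s in D) f (x, s)) \+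
      (fun x => \int[k x]_(s in D) g (x, s))); first exact: emeasurable_funD.
  by apply/funext => x; rewrite ge0_integralD//; exact: mx.
- move=> r f r0 f0 mf If.
  rewrite (_ : (fun x => _) = (fun x => r%:E * \int[k x]_(s in D) f (x, s))).
    exact: measurable_funeM.
  by apply/funext => x; rewrite ge0_integralZl_EFin//; exact: mx.
- move=> f_ f0 mf ndf If.
  rewrite (_ : (fun x => _) =
      (fun x => limn (fun n => \int[k x]_(s in D) f_ n (x, s)))); last first.
    apply/funext => x; rewrite monotone_convergence//.
    by move=> n; exact: mx.
  apply: (emeasurable_fun_cvg (fun n x => \int[k x]_(s in D) f_ n (x, s))) => // x _.
  apply: ereal_nondecreasing_is_cvgn => m n mn; apply: ge0_le_integral => //.
  - exact: mx.
  - exact: mx.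
  - by move=> s _; exact: ndf.
Qed.

End locally_finite_kernel.

Lemma ge0_integral_mrestr d (T : measurableType d) (R : realType)
    (mu : {measure set T -> \bar R}) (A D : set T) (mA : measurable A)
    (mD : measurable D) (f : T -> \bar R) :
  (forall x, 0 <= f x)%E -> measurable_fun setT f ->
  (\int[mrestr mu mA]_(x in D) f x = \int[mu]_(x in D `&` A) f x)%E.
Proof.
have mDA : measurable (D `&` A) by exact: measurableI.
move: f; apply: ge0_measurable_ind.
- by move=> E mE; rewrite !integral_indic//= /mrestr/= setIA.
- move=> f g f0 g0 mf mg If Ig.
  by rewrite !ge0_integralD ?If ?Ig//; exact: measurable_funTS.
- move=> k f k0 f0 mf If.
  by rewrite !ge0_integralZl_EFin ?If//; exact: measurable_funTS.
- move=> f_ f0 mf ndf If; rewrite !monotone_convergence//.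
  + by congr (limn _); apply/funext => n; exact: If.
  + by move=> n; exact: measurable_funTS.
  + by move=> n; exact: measurable_funTS.
Qed.

Section filtered.
Context (R : realType) (disp : measure_display) (Omega : measurableType disp).
Variables (F : R -> set (set Omega)) (HF : filtration F).

(** [Omega] with [F t] as its own sigma-algebra: measurability with respect to the past becomes
    ordinary measurability from this type, so that the general closure lemmas apply. *)
Definition past (t : R) := g_sigma_algebraType (F t).

Definition predictable_space := g_sigma_algebraType
  [set E : set (R * Omega) | exists s t A, F s A /\ E = `]s, t] `*` A].

Let sF t : sigma_algebra setT (F t). Proof. by have [+ _ _] := HF; exact. Qed.

Lemma measurable_past t (A : set (past t)) : measurable A <-> F t A.
Proof. by rewrite -[X in X <-> _]/(<<s F t >> A) sigma_algebra_id. Qed.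

Lemma measurable_wrt_past t d (E : measurableType d) (f : Omega -> E) :
  measurable_wrt (F t) f <-> measurable_fun setT (f : past t -> E).
Proof.
split=> [mf _ A mA|mf A mA].
  by rewrite setTI; apply/measurable_past; exact: mf.
by have := mf measurableT A mA; rewrite setTI => /measurable_past.
Qed.

Lemma measurable_wrt_predictable d (E : measurableType d) (f : R * Omega -> E) :
  measurable_wrt (predictable_sigma F) f <->
  measurable_fun setT (f : predictable_space -> E).
Proof.
split=> [mf _ A mA|mf A mA]; first by rewrite setTI; exact: mf.
by have := mf measurableT A mA; rewrite setTI.
Qed.

Lemma past_le s t d (E : measurableType d) (f : Omega -> E) : s <= t ->
  measurable_fun setT (f : past s -> E) -> measurable_fun setT (f : past t -> E).
Proof.
move=> st /measurable_wrt_past mf; apply/measurable_wrt_past => A mA.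
by have [_ _ Fst] := HF; apply: Fst st _ _; exact: mf.
Qed.

Lemma past_measurable t d (E : measurableType d) (f : Omega -> E) :
  measurable_fun setT (f : past t -> E) -> measurable_fun setT f.
Proof.
move=> /measurable_wrt_past mf _ A mA; rewrite setTI.
by have [_ Fm _] := HF; apply: (Fm t); exact: mf.
Qed.

Lemma past_set_measurable t (A : set Omega) : F t A -> measurable A.
Proof. by have [_ Fm _] := HF; exact: Fm. Qed.

Lemma predictable_gen s t A : F s A ->
  measurable (`]s, t] `*` A : set predictable_space).
Proof. by move=> FA; apply: sub_sigma_algebra; exists s, t, A. Qed.

Lemma FT t : F t setT.
Proof. by apply/measurable_past; exact: measurableT. Qed.

Lemma predictable_fst :
  measurable_fun setT (fst : predictable_space -> R).
Proof.
apply: (measurability _ (erefl : @measurable _ (measurableTypeR R) = _)).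
move=> _ [_ [[s t] _ <-] <-]; rewrite setTI.
rewrite (_ : _ @^-1` _ = `]s, t] `*` setT); first exact: (predictable_gen t (FT s)).
by apply/seteqP; split=> [[u w]//= |[u w] []].
Qed.

(** The times after [q] form a union of left-open intervals, so a variable known at [q] and held
    from then on is predictable. Past counts and softmax weights enter integrands in this way. *)
Lemma predictable_step q d (E : measurableType d) (f : Omega -> E) (e : E) :
  measurable_fun setT (f : past q -> E) ->
  measurable_fun setT (fun p : predictable_space => if q < p.1 then f p.2 else e).
Proof.
move=> mf; have mq : measurable [set p : predictable_space | q < p.1].
  rewrite (_ : mkset _ = \bigcup_n (`]q, q + n%:R] `*` setT)).
    by apply: bigcupT_measurable => n; exact: (predictable_gen (q + n%:R) (FT q)).
  apply/seteqP; split=> [[u w]/= qu|[u w] [n _ [/=]]].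
    exists (Num.truncn (u - q)).+1 => //; split=> //=.
    rewrite in_itv/= qu/= -lerBlDl; apply/ltW.
    by have /truncn_itv/andP[] : 0 <= u - q by rewrite subr_ge0 ltW.
  by rewrite in_itv/= => /andP[].
move=> _ A mA; rewrite setTI.
have mf' : measurable [set p : predictable_space | q < p.1 /\ A (f p.2)].
  rewrite (_ : mkset _ = \bigcup_n (`]q, q + n%:R] `*` (f @^-1` A))).
    apply: bigcupT_measurable => n; apply: predictable_gen.
    by apply: (measurable_wrt_past q f).2.
  apply/seteqP; split=> [[u w]/= [qu Af]|[u w] [n _ [/=]]].
    exists (Num.truncn (u - q)).+1 => //; split=> //=.
    rewrite in_itv/= qu/= -lerBlDl; apply/ltW.
    by have /truncn_itv/andP[] : 0 <= u - q by rewrite subr_ge0 ltW.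
  by rewrite in_itv/= => /andP[].
have [Ae|nAe] := pselect (A e).
  rewrite (_ : _ @^-1` _ = [set p | q < p.1 /\ A (f p.2)] `|` ~` [set p | q < p.1]).
    by apply: measurableU => //; exact: measurableC.
  apply/seteqP; split=> [[u w]/=|[u w]/=].
    by case: (boolP (q < u)) => qu Af; [left|right; exact/negP].
  by case=> [[-> //]|/negP/negbTE ->].
rewrite (_ : _ @^-1` _ = [set p | q < p.1 /\ A (f p.2)])//.
apply/seteqP; split=> [[u w]/=|[u w]/= [-> //]].
by case: ifP.
Qed.

Lemma predictable_section (w : Omega) :
  measurable_fun setT (fun s : R => (s, w) : predictable_space).
Proof.
apply: (measurability _ (erefl : @measurable _ predictable_space = _)).
move=> _ [_ [s [t [A [FA ->]]]] <-]; rewrite setTI.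
have [Aw|Aw] := pselect (A w).
  rewrite (_ : _ @^-1` _ = `]s, t]%classic)//.
  by apply/seteqP; split=> [u [] //|u su]; split.
rewrite (_ : _ @^-1` _ = set0)//.
by apply/seteqP; split=> u //= [].
Qed.

Lemma predictable_path d (E : measurableType d) (f : predictable_space -> E)
    (w : Omega) :
  measurable_fun setT f -> measurable_fun setT (fun s : R => f (s, w)).
Proof. by move=> mf; apply: (measurableT_comp mf); exact: predictable_section. Qed.

(* Stopping the time at t is what makes past integrals measurable for F t. *)
Lemma predictable_stop (t : R) :
  measurable_fun setT (fun p : past t * R => (Num.min p.2 t, p.1) : predictable_space).
Proof.
apply: (measurability _ (erefl : @measurable _ predictable_space = _)).
move=> _ [_ [s [u [A [FA ->]]]] <-]; rewrite setTI.
have [st|ts] := ltP s t; last first.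
  rewrite (_ : _ @^-1` _ = set0)//.
  apply/seteqP; split=> -[w v] //= [/= + _]; rewrite in_itv/= lt_min => /andP[/andP[_]].
  by rewrite ltNge ts.
rewrite (_ : _ @^-1` _ = (A : set (past t)) `*` ((fun v => Num.min v t) @^-1` `]s, u])).
  apply: measurableX.
    by apply/measurable_past; have [_ _ Fst] := HF; apply: (Fst s) FA; exact: ltW.
  rewrite -[X in measurable X]setTI.
  have mm : measurable_fun setT ((@idfun R) \min cst t)
    by apply: measurable_minr; [exact: measurable_id|exact: measurable_cst].
  exact: mm.
by apply/seteqP; split=> -[w v] [].
Qed.

Lemma past_integral (r t : R) (kappa : Omega -> {measure set (measurableTypeR R) -> \bar R})
    (H : predictable_space -> \bar R) :
  (forall w, kappa w `]r, t]%classic < +oo)%E ->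
  (forall C : set R, measurable C -> C `<=` `]r, t] ->
    measurable_fun setT (fun w : past t => kappa w C)) ->
  (forall p, 0 <= H p)%E -> measurable_fun setT H ->
  measurable_fun setT (fun w : past t => \int[kappa w]_(s in `]r, t]) H (s, w))%E.
Proof.
move=> kf mk H0 mH.
rewrite (_ : (fun _ => _) = fun w => \int[kappa w]_(s in `]r, t]) H (Num.min s t, w))%E.
  apply: (@measurable_integral_kernel _ _ (past t) (measurableTypeR R) R kappa `]r, t]%classic
    (fun p => H (Num.min p.2 t, p.1))) => //.
  by apply: (measurableT_comp mH); exact: predictable_stop.
apply/funext => w; apply: eq_integral => s.
by rewrite inE/= in_itv/= => /andP[_ /min_idPl ->].
Qed.

End filtered.

Lemma radon_le (R : realType) (nu : radon R) (A B : set R) :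
  measurable A -> measurable B -> A `<=` B -> (nu A <= nu B)%E.
Proof. by move=> mA mB AB; apply: le_measure; rewrite ?inE. Qed.

Lemma radon_le_itv (R : realType) (nu : radon R) (i j : interval R) :
  [set` i] `<=` [set` j] -> (nu [set` i] <= nu [set` j])%E.
Proof. by apply: radon_le; exact: measurable_itv. Qed.

Section adjacent_intervals.
Local Open Scope ereal_scope.
Context (R : realType).
Implicit Types (mu : {measure set (measurableTypeR R) -> \bar R}) (x y z : itv_bound R).

Lemma itv_adjacent_disjoint x y z : [set` Interval x y] `&` [set` Interval y z] = set0.
Proof.
apply/seteqP; split=> // u []; rewrite /= !itv_boundlr => /andP[_ uy] /andP[yu _].
by have := le_trans uy yu; rewrite bnd_simp ltxx.
Qed.

Lemma measure_itv_cat mu x y z : (x <= y)%O -> (y <= z)%O ->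
  mu [set` Interval x z] = mu [set` Interval x y] + mu [set` Interval y z].
Proof.
move=> xy yz; rewrite (itv_bndbnd_setU xy yz) measureU//; try exact: measurable_itv.
exact: itv_adjacent_disjoint.
Qed.

Lemma ge0_integral_itv_cat mu x y z (f : R -> \bar R) : (x <= y)%O -> (y <= z)%O ->
  (forall s, 0 <= f s) -> measurable_fun setT f ->
  \int[mu]_(s in [set` Interval x z]) f s =
  \int[mu]_(s in [set` Interval x y]) f s + \int[mu]_(s in [set` Interval y z]) f s.
Proof.
move=> xy yz f0 mf; rewrite (itv_bndbnd_setU xy yz) ge0_integral_setU//=.
- exact: measurable_funTS.
- by apply/disj_set2P; exact: itv_adjacent_disjoint.
Qed.

Lemma lebesgue_itv_lty (a b : R) : lebesgue_measure `]a, b]%classic < +oo.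
Proof. by rewrite lebesgue_measure_itv/=; case: ifP => // _; rewrite ltry. Qed.

End adjacent_intervals.

Section predictable_kernel.
Context (R : realType) (disp : measure_display) (Omega : measurableType disp).
Variables (F : R -> set (set Omega)) (HF : filtration F).
Variables (N : Omega -> radon R) (HA : adapted F N).

Lemma adapted_past (t : R) (C : set R) : measurable C -> C `<=` `]-oo, t] ->
  measurable_fun setT (fun w : past F t => N w C).
Proof. by move=> mC Ct; apply/(measurable_wrt_past HF); exact: HA. Qed.

(** The count over the open past of a time is the supremum, over the rationals [q] before that time,
    of the counts up to [q], each of which is known at [q] and switched on after it. *)
Lemma predictable_count (C : set R) : measurable C ->
  measurable_fun setT (fun p : predictable_space F => N p.2 (C `&` `]-oo, p.1[)).
Proof.
move=> mC; pose q i : R := ratr (odflt 0%Q (unpickle i)).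
pose f i (p : predictable_space F) : \bar R :=
  if q i < p.1 then N p.2 (C `&` `]-oo, q i]) else 0%E.
have mf i : measurable_fun setT (f i).
  apply: (predictable_step HF (q := q i) (f := fun w => N w (C `&` `]-oo, q i])%classic)).
  apply: adapted_past; [|exact: subIsetr].
  exact: measurableI.
rewrite (_ : (fun _ => _) = fun p => esups (f ^~ p) 0); first exact: measurable_fun_esups.
apply/funext => -[t w]/=.
have mCi (i : interval R) : measurable (C `&` [set` i]) by exact: measurableI.
apply/eqP; rewrite eq_le; apply/andP; split; last first.
  apply: ge_ereal_sup => _ [i _ <-]; rewrite /f/=; case: ifPn => // qt.
  apply: radon_le; [exact: mCi|exact: mCi|]; apply: setIS => s /=.
  by rewrite !in_itv/= => /le_lt_trans; apply.
pose G n : set R := C `&` `]-oo, t - n.+1%:R^-1]%classic.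
have ndG : nondecreasing_seq G.
  move=> m n mn; rewrite subsetEset; apply: setIS => s /=.
  rewrite !in_itv/= => /le_trans; apply; rewrite lerB// lef_pV2 ?posrE//.
  by rewrite ler_nat.
have GE : \bigcup_n G n = C `&` `]-oo, t[.
  rewrite -setI_bigcupr; congr (_ `&` _); apply/seteqP; split=> [s [n _] /=|s /=].
    by rewrite !in_itv/= => /le_lt_trans; apply; rewrite ltrBlDr ltrDl.
  rewrite in_itv/= => st; have ts0 : 0 < t - s by rewrite subr_gt0.
  exists (Num.truncn (t - s)^-1) => //=; rewrite in_itv/= lerBrDr -lerBrDl.
  rewrite -[leRHS]invrK lef_pV2 ?posrE ?invr_gt0//; apply/ltW.
  by have /truncn_itv/andP[] : 0 <= (t - s)^-1 by rewrite invr_ge0 ltW.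
have := @nondecreasing_cvg_mu _ _ R (N w) G (fun=> mCi _) _ ndG.
rewrite GE => /(_ (mCi _)) NG; rewrite -(cvg_lim _ NG)//.
apply: lime_le; first by apply/cvg_ex; exists (N w (C `&` `]-oo, t[)).
near=> n.
have [x] := @rat_in_itvoo R (t - n.+1%:R^-1) t ltac:(by rewrite ltrBlDr ltrDl).
rewrite in_itv/= => /andP[nx xt].
apply: le_trans (ereal_sup_ubound _); last first.
  by exists (pickle x) => //=.
rewrite /f /q pickleK/= xt; apply: radon_le; [exact: mCi|exact: mCi|]; apply: setIS => s /=.
by rewrite !in_itv/= => /le_trans; apply; exact: ltW.
Unshelve. all: by end_near.
Qed.

Lemma radon_lty (nu : radon R) (a b : R) (C : set R) : measurable C ->
  C `<=` `[a, b] -> (nu C < +oo)%E.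
Proof.
move=> mC Cab; apply: le_lt_trans (radon_compact nu (@segment_compact R a b)).
by apply: le_measure; rewrite ?inE.
Qed.

(** Restricting [N] to the times before [p.1] turns the moving domain of integration into a kernel
    over the predictable space. The bounded windows [D n] make it finite, and monotone convergence
    removes them. *)
Lemma predictable_convolution (k : R -> R) : (forall u, 0 <= k u) ->
  measurable_fun setT k ->
  measurable_fun setT (fun p : predictable_space F =>
    \int[N p.2]_(s in `]-oo, p.1[) (k (p.1 - s))%:E)%E.
Proof.
move=> k0 mk.
pose kappa (p : predictable_space F) : {measure set (measurableTypeR R) -> \bar R} :=
  mrestr (N p.2) (measurable_itv `]-oo, p.1[).
pose D n : set R := `]- n%:R, n%:R[%classic.
have mD n : measurable (D n) by exact: measurable_itv.
have mkp t : measurable_fun setT (fun s : R => (k (t - s))%:E).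
  apply/measurable_EFinP; apply: measurableT_comp => //.
  by apply: measurable_funB; [exact: measurable_cst|exact: measurable_id].
apply: (emeasurable_fun_cvg (fun n (p : predictable_space F) =>
    \int[kappa p]_(s in D n) (k (p.1 - s))%:E)%E).
  move=> n.
  apply: (@measurable_integral_kernel _ _ (predictable_space F) (measurableTypeR R) R kappa (D n)
    (fun x => (k (x.1.1 - x.2))%:E)) => //.
  - exact: mD.
  - move=> p; apply: (@radon_lty _ (- n%:R) n%:R).
      by apply: measurableI => //; exact: measurable_itv.
    by move=> s [+ _]; rewrite /D/= !in_itv/= => /andP[/ltW -> /ltW ->].
  - by move=> C mC _; exact: predictable_count.
  - by move=> z; rewrite lee_fin.
  - apply/measurable_EFinP; apply: measurableT_comp => //.
    apply: measurable_funB; last exact: measurable_snd.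
    by apply: (measurableT_comp (predictable_fst HF)); exact: measurable_fst.
move=> -[t w] _ /=.
rewrite -[X in integral _ X]setTI -(ge0_integral_mrestr (N w) (measurable_itv `]-oo, t[))//.
have -> : setT = \bigcup_n D n.
  apply/esym/seteqP; split=> // s _; exists (Num.truncn `|s|).+1 => //.
  rewrite /D/= in_itv/= -ltr_norml.
  by have /truncn_itv/andP[] : 0 <= `|s| by [].
apply: ge0_nondecreasing_set_cvg_integral => //.
- move=> m n mn; rewrite subsetEset /D => s; rewrite /= !in_itv/= => /andP[ms sm].
  have mn' : m%:R <= n%:R :> R by rewrite ler_nat.
  by rewrite (le_lt_trans _ ms) ?lerN2//= (lt_le_trans sm).
- by move=> n; apply: measurable_funTS; exact: mkp.
- by move=> n s _; rewrite lee_fin.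
- by move=> s; rewrite lee_fin.
- exact: mkp.
Qed.

Lemma past_integral_count (r t : R) (H : predictable_space F -> \bar R) :
  (forall p, 0 <= H p)%E -> measurable_fun setT H ->
  measurable_fun setT (fun w : past F t => \int[N w]_(s in `]r, t]) H (s, w))%E.
Proof.
apply: (past_integral HF (kappa := fun w => N w)) => [w|C mC Crt].
  apply: (@radon_lty (N w) r t) => // s /=.
  by rewrite !in_itv/= => /andP[/ltW -> ->].
apply: adapted_past => //; apply: subset_trans Crt _ => s /=.
by rewrite !in_itv/= => /andP[].
Qed.

Lemma past_integral_lebesgue (r t : R) (H : predictable_space F -> \bar R) :
  (forall p, 0 <= H p)%E -> measurable_fun setT H ->
  measurable_fun setT
    (fun w : past F t => \int[lebesgue_measure]_(s in `]r, t]) H (s, w))%E.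
Proof.
apply: (past_integral HF (kappa := fun=> lebesgue_measure)) => // w.
exact: lebesgue_itv_lty.
Qed.

End predictable_kernel.

(** * Campbell's formula *)

Section integral_functional.
Local Open Scope ereal_scope.
Context d (T : measurableType d) (R : realType).

(** The properties that characterise an integral against some measure. Both sides of Campbell's
    formula are iterated integrals with these properties and are compared as functionals, without
    building measures on the product space. *)
Definition integral_functional (Phi : (T -> \bar R) -> \bar R) : Prop :=
  [/\ forall f, (forall x, 0 <= f x) -> 0 <= Phi f,
      forall f g, (forall x, 0 <= f x) -> (forall x, 0 <= g x) ->
        measurable_fun setT f -> measurable_fun setT g ->
        Phi (fun x => f x + g x) = Phi f + Phi g,
      forall (k : R) f, (0 <= k)%R -> (forall x, 0 <= f x) ->
        measurable_fun setT f -> Phi (fun x => k%:E * f x) = k%:E * Phi f &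
      forall f_ : (T -> \bar R)^nat, (forall n x, 0 <= f_ n x) ->
        (forall n, measurable_fun setT (f_ n)) ->
        (forall x, nondecreasing_seq (f_ ^~ x)) ->
        Phi (fun x => limn (f_ ^~ x)) = limn (fun n => Phi (f_ n))].

(** This is the uniqueness of finite measures that agree on a generating pi-system: a Dynkin
    argument settles the indicators, monotone approximation the rest. *)
Lemma integral_functional_unique (G : set (set T))
    (Phi Psi : (T -> \bar R) -> \bar R) :
  @measurable _ T = <<s G >> -> setI_closed G ->
  integral_functional Phi -> integral_functional Psi ->
  Phi (cst 1) = Psi (cst 1) -> Psi (cst 1) < +oo ->
  (forall A, G A -> Phi (fun x => (\1_A x)%:E) = Psi (fun x => (\1_A x)%:E)) ->
  forall f, (forall x, 0 <= f x) -> measurable_fun setT f -> Phi f = Psi f.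
Proof.
move=> GE GI [Phi0 PhiD PhiZ Phil] [Psi0 PsiD PsiZ Psil] PPT Pfin PPG.
have mi A : measurable A -> measurable_fun setT (fun x : T => (\1_A x)%:E : \bar R).
  by move=> mA; exact/measurable_EFinP/measurable_indic.
have i0 A (x : T) : 0 <= (\1_A x)%:E :> \bar R by rewrite lee_fin.
apply: ge0_measurable_ind.
- rewrite GE; apply: dynkin_induction GE GI _ PPG _ _.
  + by rewrite indicT.
  + move=> S mS PPS; have mSC := measurableC mS.
    have E (Xi : (T -> \bar R) -> \bar R) :
       (forall f g, (forall x, 0 <= f x) -> (forall x, 0 <= g x) ->
        measurable_fun setT f -> measurable_fun setT g ->
        Xi (fun x => f x + g x) = Xi f + Xi g) ->
       Xi (cst 1) = Xi (fun x => (\1_S x)%:E) + Xi (fun x => (\1_(~` S) x)%:E).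
      move=> XiD; rewrite -XiD//; try exact: mi.
      congr Xi; apply/funext => x; rewrite !indicE in_setC /=.
      by case: (x \in S); rewrite ?adde0 ?add0e.
    have := PPT; rewrite (E _ PhiD) (E _ PsiD) PPS.
    have fS : Psi (fun x => (\1_S x)%:E) \is a fin_num.
      rewrite ge0_fin_numE ?Psi0//; apply: le_lt_trans Pfin.
      by rewrite (E _ PsiD) leeDl// Psi0.
    move/(congr1 (fun z => z - Psi (fun x => (\1_S x)%:E))).
    by rewrite [X in X - _]addeC addeK// [X in X - _]addeC addeK.
  + move=> S mS tS PPS.
    pose U n := \big[setU/set0]_(i < n) S i.
    have mU n : measurable (U n) by apply: bigsetU_measurable.
    have UE : (fun x => (\1_(\bigcup_k S k) x)%:E : \bar R) =
              fun x => limn (fun n => (\1_(U n) x)%:E).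
      apply/funext => x; apply/esym/cvg_lim => //.
      have [Sx|Sx] := boolP (x \in \bigcup_k S k).
        move: (Sx); rewrite inE => -[k _ Skx].
        rewrite indicE Sx; apply: cvg_near_cst; near=> n.
        rewrite indicE mem_set// /U -bigcup_mkord; exists k => //=.
        by near: n; exact: nbhs_infty_gt.
      rewrite indicE (negbTE Sx); apply: cvg_near_cst; near=> n.
      rewrite indicE memNset// /U -bigcup_mkord => -[k _ Skx].
      by move/negP: Sx; apply; rewrite inE; exists k.
    have ndU x : nondecreasing_seq (fun n => (\1_(U n) x)%:E : \bar R).
      move=> m n mn; rewrite lee_fin !indicE ler_nat.
      have [xm|//] := boolP (x \in U m); rewrite (_ : x \in U n)//.
      move: xm; rewrite !inE /U -!bigcup_mkord => -[k /= km Sk].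
      by exists k => //=; exact: leq_trans mn.
    rewrite UE Phil// ?Psil//; try by move=> n; exact: mi.
    congr (limn _); apply/funext => n; elim: n => [|n IHn].
      rewrite /U big_ord0.
      have -> : (fun x : T => (\1_set0 x)%:E : \bar R) = fun x => 0%:E * (\1_setT x)%:E.
        by apply/funext => x; rewrite indic0 mul0e.
      by rewrite PhiZ ?PsiZ ?mul0e//; exact: mi.
    have -> : (fun x : T => (\1_(U n.+1) x)%:E : \bar R) =
        fun x => (\1_(U n) x)%:E + (\1_(S n) x)%:E.
      apply/funext => x; rewrite /U big_ord_recr/= -/(U n) -EFinD !indicE in_setU.
      have [xS|xS] := boolP (x \in S n); last by rewrite orbF addr0.
      have -> : x \in U n = false; last by rewrite add0r.
      apply/negbTE/negP; rewrite inE /U -bigcup_mkord => -[k /= kn Skx].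
      have kE : k = n by apply: tS => //; exists x; split=> //; exact/set_mem.
      by rewrite kE ltnn in kn.
    by rewrite PhiD ?PsiD ?IHn ?PPS//; exact: mi.
- move=> f g f0 g0 mf mg If Ig; by rewrite PhiD ?PsiD ?If ?Ig.
- move=> k f k0 f0 mf If; by rewrite PhiZ ?PsiZ ?If.
- move=> f_ f0 mf ndf If; rewrite Phil ?Psil//.
  by congr (limn _); apply/funext => n; exact: If.
Unshelve. all: by end_near.
Qed.

End integral_functional.

Section campbell.
Context (R : realType) (disp : measure_display) (Omega : measurableType disp).
Variable P : probability Omega R.
Variables (F : R -> set (set Omega)) (HF : filtration F).
Local Open Scope ereal_scope.

(** It serves for both sides of Campbell's formula: [kappa] is [N] and [g] is 1 on one side, [kappa]
    is Lebesgue measure and [g] is the intensity on the other. *)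
Lemma nested_integral_functional (r T : R) (A : set Omega)
    (kappa : Omega -> {measure set (measurableTypeR R) -> \bar R}) (g : R -> Omega -> R) :
  measurable A ->
  (forall w, kappa w `]r, T]%classic < +oo) ->
  (forall C : set R, measurable C -> C `<=` `]r, T] ->
    measurable_fun setT (fun w : past F T => kappa w C)) ->
  (forall t w, 0 <= g t w)%R ->
  measurable_fun setT (fun p : predictable_space F => g p.1 p.2) ->
  integral_functional (fun f : predictable_space F -> \bar R =>
    \int[P]_(w in A) \int[kappa w]_(s in `]r, T]) (f (s, w) * (g s w)%:E)).
Proof.
move=> mA kf mk g0 mg.
have m1 (f : predictable_space F -> \bar R) w : measurable_fun setT f ->
    measurable_fun `]r, T] (fun s : R => f (s, w) * (g s w)%:E).
  move=> mf; apply: measurable_funTS; apply: emeasurable_funM.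
    exact: predictable_path.
  by apply/measurable_EFinP; exact: (predictable_path w mg).
have fg0 (f : predictable_space F -> \bar R) p : (forall x, 0 <= f x) ->
    0 <= f p * (g p.1 p.2)%:E by move=> f0; rewrite mule_ge0 ?lee_fin.
have m2 (f : predictable_space F -> \bar R) : (forall x, 0 <= f x) ->
    measurable_fun setT f -> measurable_fun A
      (fun w => \int[kappa w]_(s in `]r, T]) (f (s, w) * (g s w)%:E)).
  move=> f0 mf; apply: measurable_funTS; apply: (past_measurable HF (t := T)).
  apply: (past_integral HF (H := fun p => f p * (g p.1 p.2)%:E)) => //.
    by move=> p; exact: fg0.
  by apply: emeasurable_funM => //; exact/measurable_EFinP.
have i0 (f : predictable_space F -> \bar R) w : (forall x, 0 <= f x) ->
    0 <= \int[kappa w]_(s in `]r, T]) (f (s, w) * (g s w)%:E).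
  by move=> f0; apply: integral_ge0 => s _; exact: (fg0 _ (s, w)).
split.
- by move=> f f0; apply: integral_ge0 => w _; exact: i0.
- move=> f1 f2 f10 f20 mf1 mf2.
  rewrite -ge0_integralD//; try exact: m2; try by move=> w _; exact: i0.
  apply: eq_integral => w _; rewrite -ge0_integralD//; try exact: m1.
  + by apply: eq_integral => s _; rewrite ge0_muleDl.
  + by move=> s _; exact: (fg0 _ (s, w)).
  + by move=> s _; exact: (fg0 _ (s, w)).
- move=> k f k0 f0 mf.
  rewrite -ge0_integralZl_EFin//; try exact: m2; try by move=> w _; exact: i0.
  apply: eq_integral => w _; rewrite -ge0_integralZl_EFin//; try exact: m1.
  + by apply: eq_integral => s _; rewrite muleA.
  + by move=> s _; exact: (fg0 _ (s, w)).
- move=> f_ f0 mf ndf; rewrite -monotone_convergence//.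
  + apply: eq_integral => w _; rewrite -monotone_convergence//.
    * apply: eq_integral => s _; apply/esym/cvg_lim => //.
      apply: cvgeZr => //.
      exact: (ereal_nondecreasing_is_cvgn (ndf (s, w))).
    * by move=> n; exact: m1.
    * by move=> n s _; exact: (fg0 _ (s, w)).
    * by move=> s _ m n mn; rewrite lee_wpmul2r ?lee_fin//; exact: ndf.
  + by move=> n; exact: m2.
  + by move=> n w _; exact: i0.
  + move=> w _ m n mn; apply: ge0_le_integral => //; try exact: m1.
    * by move=> s _; exact: (fg0 _ (s, w)).
    * by move=> s _; rewrite lee_wpmul2r ?lee_fin//; exact: ndf.
Qed.

Variables (N : Omega -> radon R) (HA : adapted F N).
Variable lam : R -> Omega -> R.
Hypothesis lam0 : forall t w, (0 <= lam t w)%R.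
Hypothesis mlam : measurable_fun setT (fun p : predictable_space F => lam p.1 p.2).
Hypothesis Hint : intensity P F N lam.

Local Notation leb := (@lebesgue_measure R).

Lemma radon_itv_fin (nu : radon R) (a b : R) : nu `]a, b]%classic \is a fin_num.
Proof.
rewrite ge0_fin_numE//; apply: (@radon_lty R nu a b) => //.
by move=> s /=; rewrite !in_itv/= => /andP[/ltW -> ->].
Qed.

Lemma measurable_count (a b : R) : measurable_fun setT (fun w => N w `]a, b]%classic).
Proof.
apply: (past_measurable HF (t := b)); apply: (adapted_past HF HA) => //.
by move=> s /=; rewrite !in_itv/= => /andP[].
Qed.

(** The martingale started at [s] vanishes at [s], so its mean over an event of [F s] is still 0 at
    [u]. The last hypothesis matters because the compensator in [intensity] is a real integral,
    which takes the value 0 where the integral is infinite. *)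
Lemma compensator_itv (s u : R) (A : set Omega) : (s <= u)%R -> F s A ->
  \int[P]_(w in A) N w `]s, u]%classic < +oo ->
  (forall w, A w -> \int[leb]_(v in `]s, u]) (lam v w)%:E < +oo) ->
  \int[P]_(w in A) N w `]s, u]%classic =
  \int[P]_(w in A) \int[leb]_(v in `]s, u]) (lam v w)%:E.
Proof.
move=> su FA Nfin lfin; have mA := past_set_measurable HF FA.
have [_ MI MM] := Hint s.
pose M t w := (fine (N w `]s, t]%classic) - \int[leb]_(v in `]s, t]) lam v w)%R.
have {}MI t : (s <= t)%R -> P.-integrable setT (EFin \o M t) := MI t.
have {}MM t t' B : (s <= t)%R -> (t <= t')%R -> F t B ->
  (\int[P]_(w in B) M t' w = \int[P]_(w in B) M t w)%R := MM t t' B.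
pose n w := fine (N w `]s, u]%classic).
have nE w : (n w)%:E = N w `]s, u]%classic by rewrite fineK ?radon_itv_fin.
have n0 w : (0 <= n w)%R by exact: fine_ge0.
have In : P.-integrable A (EFin \o n).
  apply/integrableP; split.
    apply: measurable_funTS; rewrite (_ : EFin \o n = fun w => N w `]s, u]%classic).
      exact: measurable_count.
    by apply/funext => w /=; exact: nE.
  rewrite (eq_integral (fun w => N w `]s, u]%classic))//.
  by move=> w _ /=; rewrite ger0_norm ?nE.
have IM : P.-integrable A (EFin \o M u).
  by apply: integrableS (MI u su) => //; exact: measurableT.
have M0 : \int[P]_(w in A) (M u w)%:E = 0.
  have /fineK <- : \int[P]_(w in A) (M u w)%:E \is a fin_num.
    exact: (integrable_fin_num _ IM).
  rewrite -[fine _]/(Rintegral P A (M u)) (MM s u A) ?lexx//.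
  rewrite /Rintegral integral0_eq// => w _.
  rewrite /M set_itvoc0 measure0 /= /Rintegral integral_set0 /=.
  by rewrite subrr.
have lE w : A w -> \int[leb]_(v in `]s, u]) (lam v w)%:E = (n w)%:E - (M u w)%:E.
  move=> Aw; rewrite -EFinB /M -/(n w) opprB addrC subrK /Rintegral fineK//.
  rewrite ge0_fin_numE ?lfin//.
  by apply: integral_ge0 => v _; rewrite lee_fin.
transitivity (\int[P]_(w in A) ((n w)%:E - (M u w)%:E)).
  by rewrite integralB// M0 sube0; apply: eq_integral => w _; rewrite nE.
by apply: eq_integral => w; rewrite inE => Aw; rewrite lE.
Qed.

(** Left-open rectangles over past events form a pi-system that generates the predictable sets, and
    on such a rectangle the identity reduces to [compensator_itv]. *)
Lemma campbell (r T : R) (A : set Omega) (H : predictable_space F -> \bar R) :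
  (r <= T)%R -> F r A ->
  \int[P]_(w in A) N w `]r, T]%classic < +oo ->
  (forall w, A w -> \int[leb]_(v in `]r, T]) (lam v w)%:E < +oo) ->
  (forall p, 0 <= H p) -> measurable_fun setT H ->
  \int[P]_(w in A) \int[N w]_(s in `]r, T]) H (s, w) =
  \int[P]_(w in A) \int[leb]_(s in `]r, T]) (H (s, w) * (lam s w)%:E).
Proof.
move=> rT FA Nfin lfin H0 mH; have mA := past_set_measurable HF FA.
have mN (C : set R) : measurable C -> C `<=` `]r, T] ->
    measurable_fun setT (fun w : past F T => N w C).
  move=> mC CrT; apply: (adapted_past HF HA) => //; apply: subset_trans CrT _.
  by move=> s /=; rewrite !in_itv/= => /andP[].
have Nty w : N w `]r, T]%classic < +oo.
  by have := radon_itv_fin (N w) r T; rewrite ge0_fin_numE.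
pose N' w : {measure set (measurableTypeR R) -> \bar R} := N w.
have PhiN := @nested_integral_functional r T A N' (fun _ _ => 1%R) mA Nty mN
   (fun _ _ => ler01) (@measurable_cst _ _ _ _ _ _).
have lebty := lebesgue_itv_lty r T.
have Phil := @nested_integral_functional r T A (fun=> leb) lam mA (fun=> lebty)
   (fun _ _ _ => measurable_cst _) lam0 mlam.
have genE (kappa : Omega -> {measure set (measurableTypeR R) -> \bar R})
    (g : R -> Omega -> R) (s u : R) (C : set Omega) :
    \int[P]_(w in A) \int[kappa w]_(v in `]r, T])
      ((\1_(`]s, u] `*` C) (v, w))%:E * (g v w)%:E) =
    \int[P]_(w in A `&` C) \int[kappa w]_(v in `]Num.max r s, Num.min T u]) (g v w)%:E.
  rewrite integral_mkcondr; apply: eq_integral => w _.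
  have -> : `]Num.max r s, Num.min T u]%classic = `]r, T] `&` `]s, u] :> set R.
    apply/seteqP; split=> v /=; rewrite !in_itv/= gt_max le_min.
      by move=> /andP[/andP[-> ->] /andP[-> ->]].
    by move=> [/andP[-> ->] /andP[-> ->]].
  rewrite patchE; case: ifPn => wC; last first.
    apply: integral0_eq => v _; rewrite indicE memNset ?mul0e//= => -[_ /=].
    by move/negP : wC; rewrite inE.
  rewrite integral_mkcondr; apply: eq_integral => v _; rewrite patchE indicE.
  rewrite (_ : ((v, w) \in `]s, u] `*` C) = (v \in (`]s, u]%classic : set R))).
    by case: ifPn => _; rewrite ?mul1e ?mul0e.
  apply/idP/idP => vsu; first by apply/mem_set; case/set_mem: vsu.
  by apply/mem_set; split; exact/set_mem.
pose G := [set E : set (R * Omega) | exists s t A, F s A /\ E = `]s, t] `*` A].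
have FI s (C D : set Omega) : F s C -> F s D -> F s (C `&` D).
  by move=> /(measurable_past HF) mC /(measurable_past HF) mD; apply/(measurable_past HF); exact: measurableI.
have Fle s t C : (s <= t)%R -> F s C -> F t C.
  by have [_ _ Fst] := HF => st; exact: Fst.
transitivity (\int[P]_(w in A) \int[N' w]_(s in `]r, T]) (H (s, w) * 1%:E)).
  by apply: eq_integral => w _; apply: eq_integral => s _; rewrite mule1.
pose Phi (f : predictable_space F -> \bar R) :=
  \int[P]_(w in A) \int[N' w]_(s in `]r, T]) (f (s, w) * 1%:E).
pose Psi (f : predictable_space F -> \bar R) :=
  \int[P]_(w in A) \int[leb]_(s in `]r, T]) (f (s, w) * (lam s w)%:E).
rewrite -[LHS]/(Phi H) -[RHS]/(Psi H).
have mL : \int[P]_(w in A) N w `]r, T]%classic =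
    \int[P]_(w in A) \int[leb]_(v in `]r, T]) (1 * (lam v w)%:E).
  under [RHS]eq_integral do under eq_integral do rewrite mul1e.
  exact: compensator_itv.
apply: (@integral_functional_unique _ (predictable_space F) R G Phi Psi (erefl _)
  _ PhiN Phil _ _ _ H H0 mH); rewrite {}/Phi {}/Psi.
- move=> _ _ [s1 [t1 [A1 [FA1 ->]]]] [s2 [t2 [A2 [FA2 ->]]]].
  exists (Num.max s1 s2), (Num.min t1 t2), (A1 `&` A2); split.
    by apply: FI; [apply: Fle FA1|apply: Fle FA2]; rewrite le_max lexx ?orbT.
  rewrite -setXI; congr (_ `*` _); apply/seteqP; split=> v /=;
    rewrite !in_itv/= gt_max le_min.
    by move=> [/andP[-> ->] /andP[-> ->]].
  by move=> /andP[/andP[-> ->] /andP[-> ->]].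
- rewrite -mL; apply: eq_integral => w _; under eq_integral do rewrite mule1.
  by rewrite integral_cst ?mul1e.
- by rewrite -mL.
- move=> _ [s [u [C [FC ->]]]]; rewrite !genE.
  have [su|us] := leP (Num.max r s) (Num.min T u); last first.
    rewrite set_itv_ge; last by rewrite bnd_simp -leNgt ltW.
    by rewrite !integral0_eq// => w _; rewrite integral_set0.
  have sub : `]Num.max r s, Num.min T u] `<=` (`]r, T] : set R).
    move=> v /=; rewrite !in_itv/= gt_max le_min.
    by move=> /andP[/andP[-> _] /andP[-> _]].
  transitivity (\int[P]_(w in A `&` C) N w `]Num.max r s, Num.min T u]%classic).
    by apply: eq_integral => w _; rewrite integral_cst ?mul1e.
  have mAC := measurableI _ _ mA (past_set_measurable HF FC).
  apply: compensator_itv => //.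
  (* At time [max r s], where the interval starts, both [A] and [C] belong to the past. *)
  + by apply: FI; [apply: Fle FA|apply: Fle FC]; rewrite le_max lexx ?orbT.
  + apply: le_lt_trans Nfin.
    apply: (@le_trans _ _ (\int[P]_(w in A `&` C) N w `]r, T]%classic)).
      apply: ge0_le_integral => //.
      * by apply: measurable_funTS; exact: measurable_count.
      * by apply: measurable_funTS; exact: measurable_count.
      * by move=> w _; exact: radon_le.
    apply: ge0_subset_integral => //.
    by apply: measurable_funTS; exact: measurable_count.
  + move=> w [Aw _]; apply: le_lt_trans (lfin w Aw).
    apply: ge0_subset_integral => //.
    * apply/measurable_EFinP; apply: measurable_funTS.
      exact: (predictable_path w mlam).
    * by move=> v _; rewrite lee_fin.
Qed.

End campbell.

(** * Exponential convolutions and the chain rule *)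

Section convolution.
Local Open Scope ereal_scope.
Context (R : realType).
Implicit Types (k : R -> R) (nu : radon R) (a s t : R).

(** Extended-valued, unlike [hawkes]: an infinite past stays visible as [+oo]. A point at [t] itself
    is excluded, in keeping with predictability. *)
Definition conv k t nu : \bar R := \int[nu]_(s in `]-oo, t[) (k (t - s)%R)%:E.

Definition decay a u : R := expR (- a * u).

Lemma decay_ge0 a u : (0 <= decay a u)%R.
Proof. exact: expR_ge0. Qed.

Lemma decayD a u v : (decay a (u + v) = decay a u * decay a v)%R.
Proof. by rewrite /decay mulrDr expRD. Qed.

Lemma decay_le1 a u : (0 <= a)%R -> (0 <= u)%R -> (decay a u <= 1)%R.
Proof. by move=> a0 u0; rewrite /decay -expR0 ler_expR mulNr oppr_le0 mulr_ge0. Qed.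

Lemma decay_anti a u v : (0 <= a)%R -> (u <= v)%R -> (decay a v <= decay a u)%R.
Proof. by move=> a0 uv; rewrite /decay ler_expR !mulNr lerN2 ler_wpM2l. Qed.

Lemma measurable_decay a : measurable_fun setT (decay a).
Proof.
by rewrite /decay; apply: measurableT_comp => //; exact: measurable_funM.
Qed.

Lemma measurable_kernel_shift k t (D : set R) : measurable_fun setT k ->
  measurable_fun D (fun s => (k (t - s)%R)%:E).
Proof.
move=> mk; apply: measurable_funTS; apply/measurable_EFinP.
apply: measurableT_comp => //.
by apply: measurable_funB; [exact: measurable_cst|exact: measurable_id].
Qed.

Lemma conv_ge0 k t nu : (forall u, 0 <= k u)%R -> 0 <= conv k t nu.
Proof. by move=> k0; apply: integral_ge0 => s _; rewrite lee_fin. Qed.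

Lemma conv_decay_ge0 a t nu : 0 <= conv (decay a) t nu.
Proof. by apply: conv_ge0; exact: decay_ge0. Qed.

Lemma conv_split k s t nu : (s <= t)%R -> (forall u, 0 <= k u)%R ->
  measurable_fun setT k ->
  conv k t nu = \int[nu]_(u in `]-oo, s[) (k (t - u)%R)%:E +
                \int[nu]_(u in `[s, t[) (k (t - u)%R)%:E.
Proof.
move=> st k0 mk; apply: ge0_integral_itv_cat => //.
- by move=> u; rewrite lee_fin.
- exact: measurable_kernel_shift.
Qed.

(** This is the semigroup property of the exponential: what happened before [s] matters after [s]
    only through the value at [s]. *)
Lemma conv_decay_split a s t nu : (s <= t)%R ->
  conv (decay a) t nu = (decay a (t - s))%:E * conv (decay a) s nu +
                        \int[nu]_(u in `[s, t[) (decay a (t - u))%:E.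
Proof.
move=> st; rewrite (conv_split nu st (decay_ge0 a) (measurable_decay a)); congr (_ + _).
rewrite /conv -ge0_integralZl_EFin ?decay_ge0//.
- by apply: eq_integral => u _; rewrite -EFinM -decayD addrA subrK.
- by move=> u _; rewrite lee_fin decay_ge0.
- apply: measurable_kernel_shift; exact: measurable_decay.
Qed.

Lemma conv_decay_ge a s t nu : (s <= t)%R ->
  (decay a (t - s))%:E * conv (decay a) s nu <= conv (decay a) t nu.
Proof.
move=> st; rewrite (conv_decay_split a nu st) leeDl//.
by apply: integral_ge0 => u _; rewrite lee_fin decay_ge0.
Qed.

Lemma conv_decay_le a s t nu : (0 <= a)%R -> (s <= t)%R ->
  conv (decay a) t nu <= conv (decay a) s nu + nu `[s, t[%classic.
Proof.
move=> a0 st; rewrite (conv_decay_split a nu st); apply: leeD.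
  rewrite -[leRHS]mul1e; apply: lee_wpmul2r; first by apply: conv_ge0; exact: decay_ge0.
  by rewrite lee_fin decay_le1// subr_ge0.
rewrite -[leRHS]mul1e -(integral_cst nu (measurable_itv `[s, t[) 1).
apply: ge0_le_integral => //.
- by move=> u _; rewrite lee_fin decay_ge0.
- apply: measurable_kernel_shift; exact: measurable_decay.
- move=> u /=; rewrite in_itv/= => /andP[_ ut].
  by rewrite lee_fin decay_le1// subr_ge0 ltW.
Qed.

Lemma conv_decay_count a s t nu : (0 <= a)%R -> (s <= t)%R ->
  (decay a (t - s))%:E * nu `[s, t[%classic <= conv (decay a) t nu.
Proof.
move=> a0 st; rewrite (conv_decay_split a nu st).
apply: (@le_trans _ _ (\int[nu]_(u in `[s, t[) (decay a (t - u))%:E)).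
  rewrite -(integral_cst nu (measurable_itv `[s, t[) (decay a (t - s))%:E).
  apply: ge0_le_integral => //.
  - by move=> u _; rewrite lee_fin decay_ge0.
  - apply: measurable_kernel_shift; exact: measurable_decay.
  - move=> u /=; rewrite in_itv/= => /andP[su _].
    by rewrite lee_fin decay_anti// lerB.
rewrite leeDr// mule_ge0 ?lee_fin ?decay_ge0//; by apply: conv_ge0; exact: decay_ge0.
Qed.

Lemma radon_co_fin nu s t : nu `[s, t[%classic \is a fin_num.
Proof.
rewrite ge0_fin_numE//; apply: (@radon_lty R nu s t) => //.
by move=> u /=; rewrite !in_itv/= => /andP[-> /ltW ->].
Qed.

(** Forward in time only finitely many points are added; backward, the factor [decay a (s - t)] is
    positive, so an infinite value would persist. Finiteness is thus a property of the path, the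
    same at all times. *)
Lemma conv_decay_lty a s t nu : (0 <= a)%R ->
  conv (decay a) s nu < +oo -> conv (decay a) t nu < +oo.
Proof.
move=> a0 sfin; have [st|/ltW ts] := leP s t.
  apply: le_lt_trans (conv_decay_le nu a0 st) _; apply: lte_add_pinfty => //.
  by have := radon_co_fin nu s t; rewrite ge0_fin_numE.
have := conv_decay_ge a nu ts; have : (0 < decay a (s - t))%R by exact: expR_gt0.
have := conv_ge0 t nu (decay_ge0 a).
case: (conv _ t nu) => [y _ _ _|_ d0|//]; first exact: ltry.
by rewrite gt0_muley ?lte_fin// leye_eq => /eqP E; rewrite E in sfin.
Qed.

Lemma conv_decay_jump a s t nu : (s < t)%R -> nu `]s, t[%classic = 0 ->
  conv (decay a) t nu = (decay a (t - s))%:E * (conv (decay a) s nu + nu [set s]).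
Proof.
move=> st nu0; rewrite (conv_decay_split a nu (ltW st)).
rewrite (ge0_muleDr _ (conv_decay_ge0 _ _ _))//; congr (_ + _).
rewrite (@ge0_integral_itv_cat _ _ (BLeft s) (BRight s)) ?bnd_simp//; last 2 first.
- by move=> u; rewrite lee_fin decay_ge0.
- by apply: measurable_kernel_shift; exact: measurable_decay.
rewrite [X in _ + X](_ : _ = 0) ?adde0; last first.
  apply: null_set_integral => //.
  by apply: measurable_kernel_shift; exact: measurable_decay.
rewrite set_itv1 -(integral_cst nu (measurable_set1 s) (decay a (t - s))%:E).
by apply: eq_integral => u /[!inE] ->.
Qed.

Lemma measurable_conv k nu : (forall u, 0 <= k u)%R -> measurable_fun setT k ->
  measurable_fun setT (fun t => conv k t nu).
Proof.
move=> k0 mk.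
(* A fixed nu is adapted to any filtration of the sample space R. *)
pose F (t : R) : set (set R) := measurable.
have HF : filtration F.
  by split=> [t|t|s t _] //; exact: sigma_algebra_measurable.
have HA : adapted F (fun _ : R => nu).
  move=> t C mC _ B mB; rewrite /F preimage_cst; case: ifPn => _ //; exact: measurable0.
exact: (predictable_path (0 : R)%R (predictable_convolution HF HA k0 mk)).
Qed.

End convolution.

(** * Locating the points of a simple counting measure *)

Section counting.
Local Open Scope ereal_scope.
Context (R : realType).

Definition counting_simple (nu : radon R) : Prop :=
  (forall C : set R, measurable C -> nu C = +oo \/ exists n : nat, nu C = n%:R%:E) /\
  (forall t : R, nu [set t] <= 1).

Variables (nu : radon R) (Hnu : counting_simple nu).

Lemma counting_ltS (C : set R) (n : nat) : measurable C -> n%:R%:E < nu C ->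
  n.+1%:R%:E <= nu C.
Proof.
move=> mC; have [->|[m ->]] := Hnu.1 C mC; first by rewrite leey.
by rewrite lte_fin lee_fin ltr_nat ler_nat.
Qed.

(** [tau] is the point number [n + 1] from [r] on, obtained as the supremum of the times [s] with at
    most [n] points in [[r, s[]. Continuity from below keeps this bound at [tau]; continuity from
    above shows that it fails once [tau] is included. *)
Lemma counting_atom (r t : R) (n : nat) : (r <= t)%R -> n%:R%:E < nu `[r, t[%classic ->
  exists tau : R, [/\ (r <= tau)%R, (tau < t)%R, nu `[r, tau[%classic <= n%:R%:E &
    n%:R%:E < nu `[r, tau]%classic].
Proof.
move=> rt nt.
pose S := [set s : R | (r <= s <= t)%R /\ nu `[r, s[%classic <= n%:R%:E].
have Sr : S r by split; rewrite ?lexx ?rt// set_itvco0 measure0 lee_fin.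
have hS : has_sup S by split; [exists r|exists t => s [/andP[]]].
pose tau := sup S.
have rtau : (r <= tau)%R by exact: (sup_upper_bound hS).
have taut : (tau <= t)%R by apply: sup_le_ub; [exists r|move=> s [/andP[]]].
have ntau : nu `[r, tau[%classic <= n%:R%:E.
  pose G k : set R := `[r, (tau - k.+1%:R^-1)%R[%classic.
  have mG k : measurable (G k) by exact: measurable_itv.
  have ndG : nondecreasing_seq G.
    move=> i j ij; rewrite subsetEset => s; rewrite /G/= !in_itv/= => /andP[-> /=].
    move=> /lt_le_trans; apply; rewrite lerB// lef_pV2 ?posrE// ler_nat ltnS//.
  have GE : \bigcup_k G k = `[r, tau[%classic.
    apply/seteqP; split=> [s [k _]|s]; rewrite /G/= !in_itv/= => /andP[rs st].
      by rewrite rs/=; apply: lt_le_trans st _; rewrite lerBlDr lerDl.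
    have ts0 : (0 < tau - s)%R by rewrite subr_gt0.
    exists (Num.truncn (tau - s)^-1) => //=; rewrite in_itv/= rs/= ltrBrDr -ltrBrDl.
    rewrite -[ltRHS]invrK ltf_pV2 ?posrE ?invr_gt0//.
    by have /truncn_itv/andP[] : (0 <= (tau - s)^-1)%R by rewrite invr_ge0 ltW.
  have := @nondecreasing_cvg_mu _ _ R nu G mG _ ndG.
  rewrite GE => /(_ (measurable_itv _)) NG; rewrite -(cvg_lim _ NG)//.
  apply: lime_le; first by apply/cvg_ex; exists (nu `[r, tau[%classic).
  near=> k.
  have [s Ss ks] : exists2 s, S s & (tau - k.+1%:R^-1 < s)%R.
    by apply: sup_adherent.
  apply: le_trans Ss.2; apply: radon_le; [exact: mG|exact: measurable_itv|].
  by move=> u; rewrite /G/= !in_itv/= => /andP[-> /=] /lt_trans; apply.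
have taut' : (tau < t)%R.
  rewrite lt_neqAle taut andbT; apply/negP => /eqP E.
  by move: nt; rewrite ltNge -E ntau.
exists tau; split => //.
pose G k : set R := `[r, (Num.min t (tau + k.+1%:R^-1))%R[%classic.
have mG k : measurable (G k) by exact: measurable_itv.
have niG : nonincreasing_seq G.
  move=> i j ij; rewrite subsetEset => s; rewrite /G/= !in_itv/= => /andP[-> /=].
  rewrite !lt_min => /andP[-> /=] /lt_le_trans; apply.
  by rewrite lerD2l lef_pV2 ?posrE// ler_nat ltnS.
have GE : \bigcap_k G k = `[r, tau]%classic.
  apply/seteqP; split=> [s Gs|s]; last first.
    rewrite /G/= !in_itv/= => /andP[rs st] k _ /=; rewrite in_itv/= rs/= lt_min.
    by rewrite (le_lt_trans st)//= (le_lt_trans st)// ltrDl.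
  have : s \in `[r, (Num.min t (tau + 1%:R^-1))%R[ := Gs 0%N I; rewrite in_itv/= => /andP[rs _].
  suff : s \in `[r, tau] by []; rewrite in_itv/= rs/=.
  apply/ler_addgt0Pl => e e0.
  have : s \in `[r, (Num.min t (tau + (Num.truncn e^-1).+1%:R^-1))%R[ :=
    Gs (Num.truncn e^-1) I; rewrite in_itv/= lt_min => /andP[_ /andP[_ se]].
  apply/ltW; apply: lt_le_trans se _; rewrite addrC lerD2r.
  rewrite -[leRHS]invrK lef_pV2 ?posrE ?invr_gt0//; apply/ltW.
  by have /truncn_itv/andP[] : (0 <= e^-1)%R by rewrite invr_ge0 ltW.
have := @nonincreasing_cvg_mu _ _ R nu G _ mG _ niG.
rewrite GE => /(_ _ (measurable_itv _)) NG.
have {}NG : nu (G k) @[k --> \oo] --> nu `[r, tau]%classic.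
  by apply: NG; have := radon_co_fin nu r (Num.min t (tau + 1%:R^-1))%R; rewrite ge0_fin_numE.
rewrite -(cvg_lim _ NG)//; apply: (@lt_le_trans _ _ n.+1%:R%:E).
  by rewrite lte_fin ltr_nat.
apply: lime_ge; first by apply/cvg_ex; exists (nu `[r, tau]%classic).
near=> k; apply: counting_ltS; first exact: mG.
rewrite ltNge; apply/negP => nk.
have : (Num.min t (tau + k.+1%:R^-1) <= tau)%R.
  apply: (sup_upper_bound hS); split; last exact: nk.
  rewrite le_min ge_min lexx/= rt/= andbT; apply: le_trans rtau _.
  by rewrite lerDl.
by rewrite leNgt lt_min taut' /= ltrDl invr_gt0 ltr0n.
Unshelve. all: by end_near.
Qed.

End counting.

(** * Chain rule and drift for the fourth power of the potential *)

Section exponential_sums.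
Context (R : realType) (m : nat) (al : 'I_m -> R).

Definition expsum (c : 'I_m -> R) (u : R) : R := \sum_(i < m) c i * decay (al i) u.

Lemma is_derive_expsum c (u : R) :
  is_derive u 1 (expsum c) (- expsum (fun i => c i * al i) u).
Proof.
have d i : is_derive u 1 (fun u => c i * decay (al i) u) (- (c i * al i * decay (al i) u)).
  rewrite /decay; apply: is_derive_eq.
  by rewrite /GRing.scale/=; ring.
rewrite /expsum -sumrN (_ : (fun u => _) = \sum_(i < m) (fun u => c i * decay (al i) u)).
  exact: is_derive_sum.
by apply/funext => v; rewrite fct_sumE.
Qed.

(** The derivative of [expsum c] is minus the [expsum] of the coefficients multiplied by the rates,
    so the integrand is the derivative of [- expsum c ^+ 4] along the path and the fundamental
    theorem of calculus applies. *)
Lemma integral_expsum c (tau e : R) : tau < e ->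
  (\int[lebesgue_measure]_(u in `]tau, e])
     (4 * expsum c (u - tau) ^+ 3 * expsum (fun i => c i * al i) (u - tau))%:E =
   (expsum c 0 ^+ 4)%:E - (expsum c (e - tau) ^+ 4)%:E)%E.
Proof.
move=> te.
pose f u := 4 * expsum c (u - tau) ^+ 3 * expsum (fun i => c i * al i) (u - tau).
pose G u := - expsum c (u - tau) ^+ 4.
have dG u : is_derive u (1 : R) G (f u).
  have d1 : is_derive u (1 : R) (fun u => u - tau) 1.
    by apply: is_derive_eq; rewrite subr0.
  have d2 : is_derive u (1 : R) (fun u => expsum c (u - tau))
      (- expsum (fun i => c i * al i) (u - tau)).
    have := @is_derive1_comp R (expsum c) (fun u => u - tau) u _ _ (is_derive_expsum c _) d1.
    by rewrite mulr1.
  rewrite /G; apply: is_derive_eq.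
  by rewrite /f /GRing.scale/=; ring.
have cexp (c' : 'I_m -> R) : continuous (fun u : R => expsum c' (u - tau)).
  move=> u; apply: continuous_comp.
    by apply: cvgD; [exact: cvg_id|exact: cvg_cst].
  apply: differentiable_continuous; apply/derivable1_diffP.
  by have [] := is_derive_expsum c' (u - tau).
have cf : continuous f.
  move=> u; apply: cvgM; last exact: cexp.
  apply: cvgM; first exact: cvg_cst.
  apply: (continuous_comp (f := fun u => expsum c (u - tau)) (g := fun x => x ^+ 3)).
    exact: cexp.
  exact: exprn_continuous.
have cG : continuous G.
  move=> u; apply: cvgN.
  apply: (continuous_comp (f := fun u => expsum c (u - tau)) (g := fun x => x ^+ 4)).
    exact: cexp.
  exact: exprn_continuous.
rewrite integral_itv_obnd_cbnd; last first.
  by apply/measurable_EFinP; apply: measurable_funTS; exact: continuous_measurable_fun.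
rewrite (@continuous_FTC2 R f G tau e) //.
- by rewrite /G -!EFinB subrr opprK addrC.
- by apply: continuous_subspaceT.
- split.
  + by move=> x _; have [] := dG x.
  + exact/cvg_at_right_filter/cG.
  + exact/cvg_at_left_filter/cG.
- by move=> x _; rewrite derive1E; have [_] := dG x.
Qed.

End exponential_sums.

Section chain_rule.
Local Open Scope ereal_scope.
Context (R : realType) (m : nat) (al : 'I_m -> R) (nu : radon R).
Hypothesis al0 : forall i, (0 < al i)%R.
Hypothesis Hnu : counting_simple nu.

(** Multiplying the weights by the rates gives minus the time derivative between two points; this is
    the role of [D] beside [V] below. *)
Definition potential (w : 'I_m -> R) (t : R) : R :=
  (\sum_(i < m) w i * fine (conv (decay (al i)) t nu))%R.

Lemma potential_ge0 w t : (forall i, 0 <= w i)%R -> (0 <= potential w t)%R.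
Proof.
move=> w0; apply: sumr_ge0 => i _; rewrite mulr_ge0// fine_ge0//.
exact: conv_decay_ge0.
Qed.

Lemma measurable_potential w : measurable_fun setT (potential w).
Proof.
apply: measurable_sum => i; apply: measurable_funM => //.
apply: measurableT_comp => //; apply: measurable_conv; first exact: decay_ge0.
exact: measurable_decay.
Qed.

Variable r : R.
Hypothesis rfin : forall i, conv (decay (al i)) r nu < +oo.

Lemma conv_decay_fin i t : conv (decay (al i)) t nu \is a fin_num.
Proof.
rewrite ge0_fin_numE; last exact: conv_decay_ge0.
exact: conv_decay_lty (ltW (al0 i)) (rfin i).
Qed.

Lemma potential_jump w tau u : (tau < u)%R -> nu `]tau, u[%classic = 0 ->
  potential w u = expsum al (fun i => w i *
     (fine (conv (decay (al i)) tau nu) + fine (nu [set tau])))%R (u - tau).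
Proof.
move=> tu nu0; apply: eq_bigr => i _; rewrite (conv_decay_jump _ tu nu0).
have fn : nu [set tau] \is a fin_num.
  by rewrite ge0_fin_numE//; apply: le_lt_trans (Hnu.2 tau) _; rewrite ltry.
have := conv_decay_fin i tau; move: fn.
case: (nu _) => // x _; case: (conv _ _ _) => // y _ /=.
ring.
Qed.

(** By induction on the number of points: between points [V] is an exponential sum and the
    fundamental theorem applies; at a point every convolution rises by 1 and [V] by [J]. The points
    range over [[r, e[] because [V] is left-continuous: [V r] does not yet contain a point at [r],
    nor [V e] one at [e]. *)
Lemma chain_rule (w : 'I_m -> R) (e : R) : (r <= e)%R -> (forall i, 0 <= w i)%R ->
  let V := potential w in
  let D := potential (fun i => w i * al i)%R in
  let J := (\sum_(i < m) w i)%R in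
  \int[lebesgue_measure]_(s in `]r, e]) (4 * V s ^+ 3 * D s)%:E + (V e ^+ 4)%:E =
  (V r ^+ 4)%:E + \int[nu]_(s in `[r, e[) ((V s + J) ^+ 4 - V s ^+ 4)%:E.
Proof.
move=> re w0 V D J.
have J0 : (0 <= J)%R by apply: sumr_ge0.
have V0 s : (0 <= V s)%R by exact: potential_ge0.
have D0 s : (0 <= D s)%R.
  by apply: potential_ge0 => i; rewrite mulr_ge0// ltW.
have VD0 s : (0 <= 4 * V s ^+ 3 * D s)%R by rewrite mulr_ge0// mulr_ge0// exprn_ge0.
have VJ0 s : (0 <= (V s + J) ^+ 4 - V s ^+ 4)%R.
  by rewrite subr_ge0 lerXn2r ?nnegrE ?addr_ge0// lerDl.
have mVD : measurable_fun setT (fun s => (4 * V s ^+ 3 * D s)%:E : \bar R).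
  apply/measurable_EFinP; apply: measurable_funM; last exact: measurable_potential.
  apply: measurable_funM => //; apply: measurable_funX; exact: measurable_potential.
have mVJ : measurable_fun setT (fun s => ((V s + J) ^+ 4 - V s ^+ 4)%:E : \bar R).
  apply/measurable_EFinP; apply: measurable_funB; apply: measurable_funX.
    by apply: measurable_funD => //; exact: measurable_potential.
  exact: measurable_potential.
pose ident e := \int[lebesgue_measure]_(s in `]r, e]) (4 * V s ^+ 3 * D s)%:E + (V e ^+ 4)%:E =
  (V r ^+ 4)%:E + \int[nu]_(s in `[r, e[) ((V s + J) ^+ 4 - V s ^+ 4)%:E.
have step tau e' : (r <= tau)%R -> (tau < e')%R -> nu `]tau, e'[%classic = 0 ->
    ident tau -> ident e'.
  move=> rtau taue nu0 Itau; rewrite /ident.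
  have nu0' u : (u <= e')%R -> nu `]tau, u[%classic = 0.
    move=> ue; apply/eqP; rewrite eq_le measure_ge0 andbT -nu0.
    apply: radon_le_itv.
    by move=> v /=; rewrite !in_itv/= => /andP[-> /=] /lt_le_trans; apply.
  have fn : nu [set tau] \is a fin_num.
    by rewrite ge0_fin_numE//; apply: le_lt_trans (Hnu.2 tau) _; rewrite ltry.
  pose x := fine (nu [set tau]).
  have xE : x%:E = nu [set tau] by rewrite fineK.
  (* Integrality and the bound on atoms leave 0 and 1, the two values of [x] for which
     [(V + J x)^4 - V^4] is [x] times its value at 1. *)
  have x01 : x = 0%R \/ x = 1%R.
    have := Hnu.2 tau; rewrite -xE lee_fin; have [|[n]] := Hnu.1 [set tau] (measurable_set1 _).
      by move=> E; rewrite E in fn.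
    rewrite -xE => -[->]; rewrite lern1.
    by case: n => [|[|n]]// _; [left|right].
  pose c i := (w i * (fine (conv (decay (al i)) tau nu) + x))%R.
  have VE u : (tau < u <= e')%R -> V u = expsum al c (u - tau).
    by move=> /andP[tu ue]; rewrite /V (potential_jump _ tu (nu0' _ ue)).
  have DE u : (tau < u <= e')%R -> D u = expsum al (fun i => c i * al i)%R (u - tau).
    move=> /andP[tu ue]; rewrite /D (potential_jump _ tu (nu0' _ ue)).
    by apply: eq_bigr => i _; rewrite /c -/x; congr (_ * _)%R; ring.
  have c0E : expsum al c 0 = (V tau + J * x)%R.
    rewrite /expsum /V /J mulr_suml -big_split/=; apply: eq_bigr => i _.
    by rewrite /decay mulr0 expR0 mulr1 /c mulrDr.
  have pVD u : 0 <= (4 * V u ^+ 3 * D u)%:E by rewrite lee_fin.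
  have pVJ u : 0 <= ((V u + J) ^+ 4 - V u ^+ 4)%:E by rewrite lee_fin.
  rewrite (@ge0_integral_itv_cat _ (@lebesgue_measure R) _ (BRight tau)) ?bnd_simp ?(ltW taue)//.
  rewrite (@ge0_integral_itv_cat _ nu _ (BLeft tau)) ?bnd_simp ?(ltW taue)//.
  rewrite (@ge0_integral_itv_cat _ nu (BLeft tau) (BRight tau)) ?bnd_simp// set_itv1.
  rewrite [X in _ = _ + (_ + (_ + X))]null_set_integral ?adde0//; last first.
    exact: measurable_funTS.
  have -> : \int[lebesgue_measure]_(s in `]tau, e']) (4 * V s ^+ 3 * D s)%:E =
      ((V tau + J * x) ^+ 4)%:E - (V e' ^+ 4)%:E.
    rewrite (VE e') ?taue ?lexx// -c0E -(integral_expsum al c taue).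
    by apply: eq_integral => u; rewrite inE/= in_itv/= => ue; rewrite VE// DE.
  have -> : \int[nu]_(s in [set tau]) ((V s + J) ^+ 4 - V s ^+ 4)%:E =
      (((V tau + J) ^+ 4 - V tau ^+ 4) * x)%:E.
    rewrite (eq_integral (fun=> ((V tau + J) ^+ 4 - V tau ^+ 4)%:E)); last first.
      by move=> u; rewrite inE => ->.
    by rewrite integral_cst ?EFinM ?xE//; exact: measurable_set1.
  have alg (a b : \bar R) (v p q d t : R) : a + t%:E = v%:E + b -> (p - t = d)%R ->
      a + (p%:E - q%:E) + q%:E = v%:E + (b + d%:E).
    move=> E <-; rewrite -addeA subeK// [RHS]addeA -E -addeA; congr (_ + _).
    by rewrite -EFinD addrC subrK.
  by apply: alg Itau _; case: x01 => ->; ring.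
have ind n e' : (r <= e')%R -> nu `[r, e'[%classic <= n%:R%:E -> ident e'.
  elim: n e' => [|n IHn] e' re' ne.
    move: re'; rewrite le_eqVlt => /predU1P[<-|re'].
      by rewrite /ident set_itvoc0 set_itvco0 !integral_set0 add0e adde0.
    apply: (step r) => //.
      apply/eqP; rewrite eq_le measure_ge0 andbT; apply: le_trans ne.
      apply: radon_le_itv.
      by move=> v /=; rewrite !in_itv/= => /andP[/ltW -> ->].
    by rewrite /ident set_itvoc0 set_itvco0 !integral_set0 add0e adde0.
  have [/IHn|nlt] := leP (nu `[r, e'[%classic) n%:R%:E; first exact.
  have [tau [rtau taue ntau ntau']] := counting_atom Hnu re' nlt.
  apply: (step tau) => //; last exact: IHn.
  have H1 := counting_ltS Hnu (measurable_itv _) ntau'.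
  have E : nu `[r, e'[%classic = nu `[r, tau]%classic + nu `]tau, e'[%classic.
    by apply: measure_itv_cat; rewrite bnd_simp.
  have f1 : nu `[r, tau]%classic \is a fin_num.
    rewrite ge0_fin_numE//; apply: (@radon_lty R nu r tau) => //; exact: measurable_itv.
  apply/eqP; rewrite eq_le measure_ge0 andbT -(@leeD2lE _ (nu `[r, tau]%classic))// -E adde0.
  exact: le_trans ne H1.
have fre := radon_co_fin nu r e.
apply: (ind (Num.truncn (fine (nu `[r, e[%classic))).+1) => //.
rewrite -[leLHS]fineK// lee_fin; apply: ltW.
by have /truncn_itv/andP[] : (0 <= fine (nu `[r, e[%classic))%R by rewrite fine_ge0.
Qed.

End chain_rule.

(** The jump term is led by [4 * B * J * x ^+ 3 * d], so [B * J < 1] leaves at least four times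
    [kappa * x ^+ 4] of the decay term. One part is the [kappa] of the conclusion; the other three
    absorb the lower-order terms, at most [K * (1 + x ^+ 3)], as soon as [x] exceeds [S]. *)
Lemma drift_bound (R : realType) (B c J lo hi : R) :
  0 <= B -> 0 <= c -> 0 <= J -> 0 < lo -> 0 <= hi -> B * J < 1 ->
  exists kappa C : R, [/\ 0 < kappa, 0 <= C & forall x d, 0 <= x ->
    lo * x <= d <= hi * x ->
    ((x + J) ^+ 4 - x ^+ 4) * (B * (c + d)) + kappa * x ^+ 4 <= 4 * x ^+ 3 * d + C].
Proof.
move=> B0 c0 J0 lo0 hi0 BJ.
pose kappa := (1 - B * J) * lo.
have kappa0 : 0 < kappa by rewrite mulr_gt0// subr_gt0.
pose K := 4 * J * B * c + B * (c + hi) * (6 * J ^+ 2 + 4 * J ^+ 3 + J ^+ 4).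
have K0 : 0 <= K.
  by rewrite addr_ge0// ?mulr_ge0// ?addr_ge0// ?mulr_ge0// exprn_ge0.
pose S := K / (3 * kappa).
have S0 : 0 <= S by rewrite divr_ge0// mulr_ge0// ltW.
exists kappa, (K * (1 + S ^+ 3)); split => //.
  by rewrite mulr_ge0// addr_ge0// exprn_ge0.
move=> x d x0 /andP[lod dhi].
have x3 : 0 <= x ^+ 3 by rewrite exprn_ge0.
have xj1 : x <= 1 + x ^+ 3.
  have [x1|x1] := leP x 1; first by rewrite (le_trans x1)// lerDl.
  by rewrite -[leLHS]add0r lerD// -[leLHS]expr1 ler_eXn2l ?ltW.
have xj2 : x ^+ 2 <= 1 + x ^+ 3.
  have [x1|x1] := leP x 1; first by rewrite (@le_trans _ _ 1) ?lerDl ?exprn_ile1.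
  by rewrite -[leLHS]add0r lerD// ler_eXn2l ?ltW.
have poly_le : (6 * J ^+ 2 * x ^+ 2 + 4 * J ^+ 3 * x + J ^+ 4) * (c + hi * x) <=
    (c + hi) * (6 * J ^+ 2 + 4 * J ^+ 3 + J ^+ 4) * (1 + x ^+ 3).
  have -> : (6 * J ^+ 2 * x ^+ 2 + 4 * J ^+ 3 * x + J ^+ 4) * (c + hi * x) =
    (6 * J ^+ 2 * c + 4 * J ^+ 3 * hi) * x ^+ 2 + (4 * J ^+ 3 * c + J ^+ 4 * hi) * x +
    J ^+ 4 * c * 1 + 6 * J ^+ 2 * hi * x ^+ 3 by ring.
  have -> : (c + hi) * (6 * J ^+ 2 + 4 * J ^+ 3 + J ^+ 4) * (1 + x ^+ 3) =
    (6 * J ^+ 2 * c + 4 * J ^+ 3 * hi) * (1 + x ^+ 3) +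
    (4 * J ^+ 3 * c + J ^+ 4 * hi) * (1 + x ^+ 3) +
    J ^+ 4 * c * (1 + x ^+ 3) + 6 * J ^+ 2 * hi * (1 + x ^+ 3) by ring.
  by rewrite !lerD// ler_wpM2l// ?addr_ge0 ?mulr_ge0 ?exprn_ge0// ?lerDl ?lerDr.
have -> : ((x + J) ^+ 4 - x ^+ 4) * (B * (c + d)) =
    4 * (B * J) * (x ^+ 3 * d) + 4 * J * B * c * x ^+ 3 +
    B * ((6 * J ^+ 2 * x ^+ 2 + 4 * J ^+ 3 * x + J ^+ 4) * (c + d)) by ring.
have h1 : B * ((6 * J ^+ 2 * x ^+ 2 + 4 * J ^+ 3 * x + J ^+ 4) * (c + d)) <=
    B * ((c + hi) * (6 * J ^+ 2 + 4 * J ^+ 3 + J ^+ 4) * (1 + x ^+ 3)).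
  rewrite ler_wpM2l//; apply: le_trans poly_le; rewrite ler_wpM2l ?lerD2l//.
  by rewrite !addr_ge0 ?mulr_ge0 ?exprn_ge0.
have h2 : 4 * J * B * c * x ^+ 3 <= 4 * J * B * c * (1 + x ^+ 3).
  by rewrite ler_wpM2l ?mulr_ge0// lerDr.
have h3 : kappa * x ^+ 4 <= (1 - B * J) * (x ^+ 3 * d).
  have -> : kappa * x ^+ 4 = (1 - B * J) * (x ^+ 3 * (lo * x)).
    by rewrite /kappa; ring.
  by apply: ler_wpM2l; [rewrite subr_ge0 ltW|exact: ler_wpM2l].
have h4 : K * (1 + x ^+ 3) <= 3 * (kappa * x ^+ 4) + K * (1 + S ^+ 3).
  have [xS|Sx] := leP x S.
    apply: (@le_trans _ _ (K * (1 + S ^+ 3))).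
      by rewrite ler_wpM2l// lerD2l lerXn2r ?nnegrE.
    by rewrite lerDr; apply: mulr_ge0 => //; apply: mulr_ge0; [exact: ltW|exact: exprn_ge0].
  have : K * x ^+ 3 <= 3 * (kappa * x ^+ 4).
    have -> : 3 * (kappa * x ^+ 4) = (3 * kappa * x) * x ^+ 3 by ring.
    rewrite ler_wpM2r//.
    have -> : K = 3 * kappa * S.
      by rewrite /S mulrC divfK// mulf_neq0// gt_eqF.
    by apply: ler_wpM2l; [apply: mulr_ge0 => //; exact: ltW|exact: ltW].
  have : 0 <= K * S ^+ 3 by rewrite mulr_ge0 ?exprn_ge0.
  lra.
rewrite /K in h4 *; lra.
Qed.

Section potential_bounds.
Context (R : realType) (m : nat) (al : 'I_m -> R) (nu : radon R) (r : R).
Hypothesis al0 : forall i, 0 < al i.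
Hypothesis rfin : forall i, (conv (decay (al i)) r nu < +oo)%E.

Lemma potential_le w s t : s <= t -> (forall i, 0 <= w i) ->
  potential al nu w t <= potential al nu w s + (\sum_i w i) * fine (nu `[s, t[%classic).
Proof.
move=> st w0; rewrite /potential mulr_suml -big_split/=; apply: ler_sum => i _.
rewrite -mulrDr ler_wpM2l// -lee_fin EFinD !fineK ?radon_co_fin//.
- by apply: conv_decay_le => //; exact: ltW.
- exact: (conv_decay_fin al0 rfin).
- exact: (conv_decay_fin al0 rfin).
Qed.

Lemma potential_decay w hi s t : s <= t -> (forall i, 0 <= w i) ->
  (forall i, al i <= hi) ->
  decay hi (t - s) * potential al nu w s <= potential al nu w t.
Proof.
move=> st w0 alhi; rewrite /potential mulr_sumr; apply: ler_sum => i _.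
rewrite mulrCA ler_wpM2l//.
apply: (@le_trans _ _ (decay (al i) (t - s) * fine (conv (decay (al i)) s nu))).
  rewrite ler_wpM2r ?fine_ge0 ?conv_ge0//; first exact: decay_ge0.
  by rewrite /decay ler_expR !mulNr lerN2 ler_wpM2r// subr_ge0.
rewrite -lee_fin EFinM !fineK; first exact: conv_decay_ge.
- exact: (conv_decay_fin al0 rfin).
- exact: (conv_decay_fin al0 rfin).
Qed.

Lemma potential_mul w lo hi t : (forall i, 0 <= w i) ->
  (forall i, lo <= al i <= hi) ->
  lo * potential al nu w t <= potential al nu (fun i => w i * al i) t <=
  hi * potential al nu w t.
Proof.
move=> w0 alb; have c0 i : 0 <= w i * fine (conv (decay (al i)) t nu).
  by rewrite mulr_ge0// fine_ge0// conv_decay_ge0.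
rewrite /potential !mulr_sumr; apply/andP; split; apply: ler_sum => i _.
  by rewrite (mulrC (w i) (al i)) -mulrA ler_wpM2r//; have /andP[] := alb i.
by rewrite (mulrC (w i) (al i)) -mulrA ler_wpM2r//; have /andP[] := alb i.
Qed.

End potential_bounds.

Section predictable_potential.
Context (R : realType) (disp : measure_display) (Omega : measurableType disp).
Variables (F : R -> set (set Omega)) (HF : filtration F).
Variables (N : Omega -> radon R) (HA : adapted F N).

Lemma predictable_at t d (E : measurableType d) (f : predictable_space F -> E) :
  measurable_fun setT f -> measurable_fun setT (fun w : past F t => f (t, w)).
Proof.
move=> mf.
have -> : (fun w : past F t => f (t, w)) =
    f \o (fun p : past F t * R => (Num.min p.2 t, p.1)) \o (fun w => (w, t)).
  by apply/funext => w /=; rewrite minxx.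
apply: measurableT_comp.
  by apply: (measurableT_comp mf); exact: predictable_stop.
exact: measurable_fun_pair.
Qed.

Lemma predictable_conv (k : R -> R) : (forall u, 0 <= k u) -> measurable_fun setT k ->
  measurable_fun setT (fun p : predictable_space F => conv k p.1 (N p.2)).
Proof. exact: predictable_convolution. Qed.

Lemma predictable_potential m (al : 'I_m -> R) w :
  measurable_fun setT (fun p : predictable_space F => potential al (N p.2) w p.1).
Proof.
apply: measurable_sum => i; apply: measurable_funM => //.
apply: measurableT_comp => //.
by apply: predictable_conv; [exact: decay_ge0|exact: measurable_decay].
Qed.

End predictable_potential.

(** * A softmax maximal inequality *)

Section log_sum_exp.
Context (R : realType).

Lemma expR_le_quadratic (y b : R) : `|y| <= b -> b <= 2^-1 ->
  expR y <= 1 + y + 2 * b ^+ 2.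
Proof.
move=> yb b2; have y1 : 0 < 1 - y.
  have := le_trans (ler_norm y) (le_trans yb b2); lra.
have h : expR y <= (1 - y)^-1.
  rewrite -[y in leLHS]opprK expRN lef_pV2 ?posrE ?expR_gt0//.
  exact: expR_ge1Dx.
apply: le_trans h _; rewrite -[leLHS]mul1r ler_pdivrMr//.
have y2 : y ^+ 2 <= b ^+ 2 by rewrite -(@real_normK _ y) ?num_real// lerXn2r ?nnegrE// (le_trans _ yb).
have /andP[yl yh] : - b <= y <= b by rewrite -ler_norml.
have b0 : 0 <= b ^+ 2 by exact: sqr_ge0.
have : b ^+ 2 * y <= b ^+ 2 * 2^-1 by apply: ler_wpM2l => //; lra.
have -> : (1 + y + 2 * b ^+ 2) * (1 - y) = 1 - y ^+ 2 + 2 * b ^+ 2 - 2 * (b ^+ 2 * y) by ring.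
lra.
Qed.

(** A second-order expansion of log-sum-exp, whose gradient is the vector of softmax weights. The
    constant 4 is large enough for every [b], so the increments need no smallness. *)
Lemma log_sum_exp_step (J : finType) (x y : J -> R) (b : R) : (0 < #|J|)%N ->
  (forall j, `|y j| <= b) ->
  ln (\sum_j expR (x j + y j)) <= ln (\sum_j expR (x j)) +
    \sum_j (expR (x j) / (\sum_i expR (x i)) * y j) + 4 * b ^+ 2.
Proof.
move=> /card_gt0P[j0 _] yb; set Z := \sum_j expR (x j).
have Z0 : 0 < Z.
  rewrite /Z (bigD1 j0)//= ltr_pwDl ?expR_gt0// sumr_ge0// => j _; exact: expR_ge0.
pose w j := expR (x j) / Z.
have w0 j : 0 <= w j by rewrite divr_ge0 ?expR_ge0 ?ltW.
have w1 : \sum_j w j = 1 by rewrite -mulr_suml divff// gt_eqF.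
pose rho := \sum_j (w j * expR (y j)).
have E : \sum_j expR (x j + y j) = Z * rho.
  rewrite /rho mulr_sumr; apply: eq_bigr => j _.
  by rewrite expRD /w mulrA mulrCA divff ?gt_eqF// mulr1.
have rho0 : 0 < rho.
  rewrite -(pmulr_rgt0 _ Z0) -E (bigD1 j0)//=; apply: ltr_pwDl; first exact: expR_gt0.
  by apply: sumr_ge0 => j _; exact: expR_ge0.
rewrite E lnM ?posrE// -addrA lerD2l.
have b0 : 0 <= b by apply: le_trans (yb j0).
have wy : - b <= \sum_j (w j * y j).
  rewrite -[- b]mul1r -w1 mulr_suml; apply: ler_sum => j _; apply: ler_wpM2l => //.
  by have := yb j; rewrite ler_norml => /andP[].
have [b2|b2] := leP b 2^-1.
  apply: (@le_trans _ _ (rho - 1)).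
    rewrite -ler_expR lnK ?posrE//.
    by apply: le_trans (expR_ge1Dx _); rewrite addrC subrK.
  apply: (@le_trans _ _ (\sum_j (w j * (1 + y j + 2 * b ^+ 2)) - 1)).
    by rewrite lerD2r; apply: ler_sum => j _; apply: ler_wpM2l => //; exact: expR_le_quadratic.
  under eq_bigr do rewrite !mulrDr mulr1.
  rewrite !big_split/= w1 -mulr_suml w1 mul1r.
  have : 0 <= b ^+ 2 by exact: sqr_ge0.
  lra.
(* For large [b] no expansion is used: [ln rho] and minus the first-order term are both at most [b],
   and [2 * b <= 4 * b ^+ 2] once [b > 1/2]. *)
have rb : ln rho <= b.
  rewrite -ler_expR lnK ?posrE// -[leRHS]mul1r -w1 mulr_suml.
  apply: ler_sum => j _; apply: ler_wpM2l => //; rewrite ler_expR.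
  exact: le_trans (ler_norm _) (yb j).
have : b <= 2 * b ^+ 2.
  rewrite expr2 mulrA -[leLHS]mul1r; apply: ler_wpM2r => //; lra.
lra.
Qed.

Variables (K : nat) (K0 : (0 < K)%N) (beta : R) (beta0 : 0 < beta).

Definition signed (b : bool) (x : R) : R := if b then x else - x.

(** A smooth substitute for the exponential of [beta] times the largest absolute value. The pairs of
    index and sign account for the absolute value, and for the [2 * K] under the logarithm. *)
Definition softmax_sum (x : 'I_K -> R) : R :=
  \sum_(j : 'I_K * bool) expR (beta * signed j.2 (x j.1)).

Definition softmax_weight (x : 'I_K -> R) (j : 'I_K * bool) : R :=
  expR (beta * signed j.2 (x j.1)) / softmax_sum x.

Let cardJ : (0 < #|{: 'I_K * bool}|)%N.
Proof. by rewrite card_prod card_ord card_bool muln_gt0 K0. Qed.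

Lemma softmax_sum_gt0 x : 0 < softmax_sum x.
Proof.
rewrite /softmax_sum (bigD1 (Ordinal K0, true))//= ltr_pwDl ?expR_gt0//.
by rewrite sumr_ge0// => j _; exact: expR_ge0.
Qed.

Lemma softmax_weight01 x j : 0 <= softmax_weight x j <= 1.
Proof.
rewrite /softmax_weight divr_ge0 ?expR_ge0 ?(ltW (softmax_sum_gt0 x))//=.
rewrite ler_pdivrMr ?softmax_sum_gt0// mul1r /softmax_sum (bigD1 j)//= lerDl.
by rewrite sumr_ge0// => i _; exact: expR_ge0.
Qed.

Lemma max_le_softmax x :
  beta * \big[Num.max/0]_(k < K) `|x k| <= ln (softmax_sum x).
Proof.
have le1 j : expR (beta * signed j.2 (x j.1)) <= softmax_sum x.
  rewrite /softmax_sum (bigD1 j)//= lerDl.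
  by rewrite sumr_ge0// => i _; exact: expR_ge0.
have leln k b : beta * signed b (x k) <= ln (softmax_sum x).
  by rewrite -ler_expR lnK ?posrE ?softmax_sum_gt0//; exact: (le1 (k, b)).
have lenorm k : beta * `|x k| <= ln (softmax_sum x).
  have [xk|xk] := leP 0 (x k).
    by rewrite ger0_norm//; exact: (leln k true).
  by rewrite ltr0_norm//; exact: (leln k false).
rewrite mulrC -ler_pdivlMr//; apply: bigmax_le => [|k _].
  apply: divr_ge0; last exact: ltW.
  by apply: le_trans (lenorm (Ordinal K0)); rewrite mulr_ge0// ltW.
by rewrite ler_pdivlMr// mulrC.
Qed.

Lemma softmax_sum_cst0 : softmax_sum (fun=> 0) = (2 * K)%:R.
Proof.
rewrite /softmax_sum (eq_bigr (fun=> 1)).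
  by rewrite sumr_const card_prod card_ord card_bool mulnC.
by move=> -[k []] _ /=; rewrite ?oppr0 mulr0 expR0.
Qed.

(** The logarithm starts at [ln (2 * K)] and gains at each step a quadratic term and a first-order
    one. The weights of the latter depend on earlier increments only, which is what lets it vanish
    in the mean for martingale increments. *)
Lemma softmax_telescope (xi : nat -> 'I_K -> R) (xb : nat -> R) (n : nat) :
  (forall i k, (i < n)%N -> `|xi i k| <= xb i) ->
  beta * \big[Num.max/0]_(k < K) `|\sum_(l < n) xi l k| <= ln (2 * K)%:R +
    \sum_(i < n) (\sum_j softmax_weight (fun k => \sum_(l < i) xi l k) j *
      (beta * signed j.2 (xi i j.1)) + 4 * (beta * xb i) ^+ 2).
Proof.
move=> xib; pose S i k := \sum_(l < i) xi l k.
rewrite -[X in beta * X]/(\big[Num.max/0]_(k < K) `|S n k|).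
apply: le_trans (max_le_softmax _) _.
elim: n xib => [_|n IHn xib].
  rewrite big_ord0 addr0 -softmax_sum_cst0 le_eqVlt; apply/orP; left; apply/eqP.
  by congr (ln (softmax_sum _)); apply/funext => k; rewrite /S big_ord0.
rewrite big_ord_recr/= addrA.
apply: le_trans (lerD (IHn (fun i k lt => xib i k (ltnW lt))) (lexx _)).
have := @log_sum_exp_step _ (fun j : 'I_K * bool => beta * signed j.2 (S n j.1))
  (fun j => beta * signed j.2 (xi n j.1)) (beta * xb n) cardJ.
move=> h; rewrite [leRHS]addrA.
rewrite (_ : softmax_sum (S n.+1) =
   \sum_(j : 'I_K * bool) expR (beta * signed j.2 (S n j.1) + beta * signed j.2 (xi n j.1))).
  apply: h => j; rewrite normrM (gtr0_norm beta0); apply: ler_wpM2l; first exact: ltW.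
  by case: j => k []; rewrite /= ?normrN; apply: xib.
apply: eq_bigr => -[k b] _ /=; rewrite -mulrDr; congr (expR (_ * _)).
by rewrite /S big_ord_recr/=; case: b => //=; rewrite opprD.
Qed.

End log_sum_exp.

Lemma measurable_softmax_weight d (T : measurableType d) (R : realType) (K : nat)
    (beta : R) (f : 'I_K -> T -> R) j : (0 < K)%N ->
  (forall k, measurable_fun setT (f k)) ->
  measurable_fun setT (fun w => softmax_weight beta (fun k => f k w) j).
Proof.
move=> K0 mf.
have mexp (i : 'I_K * bool) :
    measurable_fun setT (fun w => expR (beta * signed i.2 (f i.1 w))).
  apply: measurableT_comp => //; apply: measurable_funM => //.
  by case: i => k [] /=; [exact: mf|exact: measurable_funN].
have mZ : measurable_fun setT (fun w => softmax_sum beta (fun k => f k w)).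
  by apply: measurable_sum => i; exact: mexp.
apply: measurable_funM; first exact: mexp.
(* The denominator is positive, so its inverse is the exponential of minus its logarithm, a
   composition of measurable maps. *)
rewrite (_ : (fun w => _) = fun w => expR (- ln (softmax_sum beta (fun k => f k w)))).
  apply: measurableT_comp => //; apply: measurableT_comp => //.
  by apply: measurableT_comp mZ => //; exact: measurable_ln.
by apply/funext => w; rewrite expRN lnK// posrE; exact: softmax_sum_gt0.
Qed.

Section maximal_inequality.
Local Open Scope ereal_scope.
Context (R : realType) (d : measure_display) (Omega : measurableType d).
Variable P : probability Omega R.

(** The last hypothesis removes the first-order terms in the mean, leaving the starting value and
    the quadratic terms. Only second moments of the random bounds [xb] enter, no exponential
    moment. *)
Lemma softmax_maximal (A : set Omega) (K n : nat) (beta V : R)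
    (xi : nat -> 'I_K -> Omega -> R) (xb : nat -> Omega -> R) :
  measurable A -> (0 < K)%N -> (0 < beta)%R ->
  (forall i k, (i < n)%N -> measurable_fun setT (xi i k)) ->
  (forall i, (i < n)%N -> measurable_fun setT (xb i)) ->
  (forall i k w, (i < n)%N -> A w -> (`|xi i k w| <= xb i w)%R) ->
  \sum_(i < n) \int[P]_(w in A) (xb i w ^+ 2)%:E <= V%:E ->
  (forall i j, (i < n)%N -> \int[P]_(w in A)
     (softmax_weight beta (fun k => \sum_(l < i) xi l k w) j * xi i j.1 w)%:E = 0) ->
  \int[P]_(w in A) (\big[Num.max/0]_(k < K) `|\sum_(l < n) xi l k w|)%:E <=
  (ln (2 * K)%:R / beta + 4 * beta * V)%:E.
Proof.
move=> mA K0 b0 mxi mxb xib xbV orth.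
have xb20 i w : 0 <= (xb i w ^+ 2)%:E by rewrite lee_fin sqr_ge0.
have mxi' i k : (i <= n)%N -> measurable_fun setT (fun w => \sum_(l < i) xi l k w)%R.
  by move=> ni; apply: measurable_sum => l; apply: mxi; exact: leq_trans (ltn_ord l) ni.
pose W i (j : 'I_K * bool) w := softmax_weight beta (fun k => \sum_(l < i) xi l k w)%R j.
have W01 i j w : (0 <= W i j w <= 1)%R by exact: softmax_weight01.
have mW i j : (i <= n)%N -> measurable_fun setT (W i j).
  by move=> ni; apply: measurable_softmax_weight => // k; exact: mxi'.
have ixb2 i : (i < n)%N -> P.-integrable A (fun w => (xb i w ^+ 2)%:E).
  move=> ni; apply/integrableP; split.
    apply/measurable_EFinP; apply: measurable_funTS; apply: measurable_funX; exact: mxb.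
  rewrite (eq_integral (fun w => (xb i w ^+ 2)%:E)); last first.
    by move=> w _; rewrite gee0_abs.
  apply: (@le_lt_trans _ _ V%:E); last exact: ltry.
  apply: le_trans xbV; rewrite (bigD1 (Ordinal ni))//= leeDl//.
  by apply: sume_ge0 => l _; exact: integral_ge0.
have icst (x : R) : P.-integrable A (fun=> x%:E).
  exact: finite_measure_integrable_cst.
have iWxi i j : (i < n)%N -> P.-integrable A (fun w => (W i j w * xi i j.1 w)%:E).
  move=> ni; apply: (le_integrable mA _ _ (integrableD mA (icst 1%R) (ixb2 _ ni))).
    apply/measurable_EFinP; apply: measurable_funTS; apply: measurable_funM.
      by apply: mW; exact: ltnW.
    exact: mxi.
  move=> w Aw /=; rewrite lee_fin normrM.
  have /andP[W0 W1] := W01 i j w.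
  have s0 : (0 <= 1 + xb i w ^+ 2)%R by rewrite addr_ge0 ?sqr_ge0.
  rewrite (ger0_norm W0) (ger0_norm s0).
  have xw := xib i j.1 w ni Aw.
  apply: (@le_trans _ _ (1 * xb i w)%R); first exact: ler_pM.
  rewrite mul1r; have := sqr_ge0 (xb i w - 1); rewrite sqrrB1.
  have : (0 <= xb i w ^+ 2)%R by exact: sqr_ge0.
  lra.
pose t i (j : 'I_K * bool) w := (W i j w * (beta * signed j.2 (xi i j.1 w)))%R.
have tE i j w : (t i j w)%:E = (beta * signed j.2 1)%:E * (W i j w * xi i j.1 w)%:E.
  by rewrite -EFinM; congr (_%:E); rewrite /t; case: j.2; rewrite /=; ring.
have it i j : (i < n)%N -> P.-integrable A (fun w => (t i j w)%:E).
  by move=> ni; under eq_fun do rewrite tE; apply: integrableZl => //; exact: iWxi.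
have It i j : (i < n)%N -> \int[P]_(w in A) (t i j w)%:E = 0.
  move=> ni; under eq_integral do rewrite tE.
  by rewrite integralZl ?orth ?mule0//; exact: iWxi.
have ib2 i : (i < n)%N -> P.-integrable A (fun w => (4 * (beta * xb i w) ^+ 2)%:E).
  move=> ni; rewrite (_ : (fun w => _) = fun w => (4 * beta ^+ 2)%:E * (xb i w ^+ 2)%:E).
    by apply: integrableZl => //; exact: ixb2.
  by apply/funext => w; rewrite -EFinM; congr (_%:E); ring.
have iS i : (i < n)%N -> P.-integrable A (fun w => \sum_j (t i j w)%:E).
  by move=> ni; apply: integrable_sum => // j _; exact: it.
have iSb i : (i < n)%N -> P.-integrable A
    (fun w => \sum_j (t i j w)%:E + (4 * (beta * xb i w) ^+ 2)%:E).
  by move=> ni; apply: integrableD => //; [exact: iS|exact: ib2].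
have iSS : P.-integrable A
    (fun w => \sum_(i < n) (\sum_j (t i j w)%:E + (4 * (beta * xb i w) ^+ 2)%:E)).
  by apply: integrable_sum => // i _; exact: iSb.
pose m w : R := (\big[Num.max/0]_(k < K) `|\sum_(l < n) xi l k w|)%R.
have m0 w : (0 <= m w)%R by exact: bigmax_ge_id.
have mm : measurable_fun setT m.
  rewrite /m; elim: (index_enum _) => [|k s IHs].
    by under eq_fun do rewrite big_nil; exact: measurable_cst.
  under eq_fun do rewrite big_cons; apply: measurable_maxr => //.
  by apply: measurableT_comp => //; exact: mxi'.
have key : \int[P]_(w in A) (beta * m w)%:E <= (ln (2 * K)%:R + 4 * beta ^+ 2 * V)%:E.
  pose f w := (ln (2 * K)%:R)%:E +
     \sum_(i < n) (\sum_j (t i j w)%:E + (4 * (beta * xb i w) ^+ 2)%:E).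
  have mf w : A w -> (beta * m w)%:E <= f w.
    move=> Aw; rewrite /f.
    under eq_bigr do rewrite sumEFin -EFinD.
    rewrite sumEFin -EFinD lee_fin.
    exact: (softmax_telescope K0 b0 (xi := fun i k => xi i k w) (xb := xb ^~ w)
      (n := n) (fun i k ni => xib i k w ni Aw)).
  have fE : \int[P]_(w in A) f w = (ln (2 * K)%:R)%:E * P A +
      (4 * beta ^+ 2)%:E * \sum_(i < n) \int[P]_(w in A) (xb i w ^+ 2)%:E.
    rewrite /f integralD//; congr (_ + _); first exact: integral_cst.
    rewrite integral_sum//; last by move=> i; exact: iSb.
    rewrite ge0_sume_distrr; last by move=> i _; exact: integral_ge0.
    apply: eq_bigr => i _; rewrite integralD//; [|exact: iS|exact: ib2].
    rewrite integral_sum//; last by move=> j; exact: it.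
    rewrite big1 ?add0e; last by move=> j _; exact: It.
    rewrite -integralZl//; last exact: ixb2.
    by apply: eq_integral => w _; rewrite -EFinM; congr (_%:E); ring.
  apply: (@le_trans _ _ (\int[P]_(w in A) f w)).
    apply: ge0_le_integral => //.
    - by move=> w _; rewrite lee_fin mulr_ge0// ltW.
    - by apply/measurable_EFinP; apply: measurable_funTS; exact: measurable_funM.
    - by apply: (measurable_int P); apply: integrableD.
  rewrite fE EFinD; apply: leeD.
    rewrite -[leRHS]mule1; apply: lee_wpmul2l; last exact: probability_le1.
    rewrite lee_fin ln_ge0// ler1n; by case: (K) K0.
  rewrite [leRHS]EFinM; apply: lee_wpmul2l => //.
  by rewrite lee_fin mulr_ge0// exprn_ge0// ltW.
have -> : (ln (2 * K)%:R / beta + 4 * beta * V)%R =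
    (beta^-1 * (ln (2 * K)%:R + 4 * beta ^+ 2 * V))%R.
  by field; rewrite gt_eqF.
rewrite EFinM lee_pdivlMl//; apply: le_trans key.
rewrite -ge0_integralZl_EFin//; last 3 first.
- by move=> w _; rewrite lee_fin; exact: m0.
- by apply/measurable_EFinP; exact: measurable_funTS.
- exact: ltW.
Qed.

End maximal_inequality.

(** * Finiteness of the past *)

Section finite_past.
Local Open Scope ereal_scope.
Context (R : realType).
Implicit Types nu : radon R.

Lemma nneseries_geometric_le (c q : R) : (0 <= c)%R -> (0 <= q < 1)%R ->
  \sum_(n <oo) (c * q ^+ n)%:E <= (c / (1 - q))%:E.
Proof.
move=> c0 /andP[q0 q1]; have q1' : (0 < 1 - q)%R by rewrite subr_gt0.
have t0 n : 0 <= (c * q ^+ n)%:E by rewrite lee_fin mulr_ge0// exprn_ge0.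
apply: lime_le; first by apply: is_cvg_nneseries => n _ _; exact: t0.
apply: nearW => n; rewrite sumEFin lee_fin ler_pdivlMr// -mulr_sumr -mulrA.
rewrite -[leRHS]mulr1; apply: ler_wpM2l => //.
have -> : ((\sum_(0 <= i < n) q ^+ i) * (1 - q) = 1 - q ^+ n)%R.
  rewrite big_mkord mulrC -[in RHS](expr1n _ n) subrXX; congr (_ * _)%R.
  by apply: eq_bigr => i _; rewrite expr1n mul1r.
by rewrite lerBlDr lerDl exprn_ge0.
Qed.

(** Counts that grow like exp(a n / 2) into the past are beaten by the kernel, which is at most
    exp(- a n) on the n-th unit interval, so the sum is geometric. *)
Lemma conv_decay_geometric a r c nu : (0 < a)%R -> (0 <= c)%R ->
  (forall n, nu `](r - n.+1%:R)%R, (r - n%:R)%R]%classic <= (c * expR (a / 2 * n%:R))%:E) ->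
  conv (decay a) r nu < +oo.
Proof.
move=> a0 c0 nuc; pose I n := `](r - n.+1%:R)%R, (r - n%:R)%R]%classic : set R.
pose q := expR (- (a / 2)).
have q01 : (0 <= q < 1)%R by rewrite expR_ge0 expR_lt1 oppr_lt0 divr_gt0.
have mk (D : set R) : measurable_fun D (fun s => (decay a (r - s))%:E).
  exact: measurable_kernel_shift (measurable_decay a).
apply: le_lt_trans (ltry (c / (1 - q))%R); apply: le_trans _ (nneseries_geometric_le c0 q01).
apply: (@le_trans _ _ (\int[nu]_(s in \bigcup_n I n) (decay a (r - s))%:E)).
  apply: ge0_subset_integral => //.
  - by apply: bigcupT_measurable => n; exact: measurable_itv.
  - exact: mk.
  - by move=> s _; rewrite lee_fin decay_ge0.
  - move=> s /=; rewrite in_itv/= => sr; exists (Num.truncn (r - s)) => //=.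
    have /truncn_itv/andP[h1 h2] : (0 <= r - s)%R by rewrite subr_ge0 ltW.
    by rewrite /I/= in_itv/=; apply/andP; split; lra.
rewrite ge0_integral_bigcup//; last 2 first.
- by move=> s _; rewrite lee_fin decay_ge0.
- move=> i j _ _ [s []]; rewrite /I/= !in_itv/= => /andP[i1 i2] /andP[j1 j2].
  have : (i%:R < j.+1%:R :> R)%R by lra.
  have : (j%:R < i.+1%:R :> R)%R by lra.
  by rewrite !ltr_nat !ltnS => ji ij; apply/eqP; rewrite eqn_leq ij ji.
- apply: lee_nneseries => [n _ _|n _].
    by apply: integral_ge0 => s _; rewrite lee_fin decay_ge0.
  apply: (@le_trans _ _ (\int[nu]_(s in I n) (cst (decay a n%:R)%:E s))).
    apply: ge0_le_integral => //; first exact: measurable_itv.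
    - by move=> s _; rewrite lee_fin decay_ge0.
    - exact: mk.
    - move=> s; rewrite /I/= in_itv/= => /andP[_ sn]; rewrite lee_fin.
      by apply: decay_anti; [exact: ltW|rewrite lerBrDr -lerBrDl].
  have -> : \int[nu]_(s in I n) (cst (decay a n%:R)%:E s) = (decay a n%:R)%:E * nu (I n).
    by rewrite integral_cst//; exact: measurable_itv.
  apply: (@le_trans _ _ ((decay a n%:R)%:E * (c * expR (a / 2 * n%:R))%:E)).
    by apply: lee_wpmul2l (nuc n); rewrite lee_fin decay_ge0.
  rewrite -EFinM lee_fin mulrCA; apply: ler_wpM2l => //.
  rewrite /decay -expRD /q -expRM_natr ler_expR; lra.
- by move=> n; exact: measurable_itv.
- exact: mk.
Qed.

Context (disp : measure_display) (Omega : measurableType disp).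
Variable P : probability Omega R.
Variable N : Omega -> radon R.

(** Borel-Cantelli at the levels exp(a n / 2), at which tails of order 1/x are summable. The event
    [A] allows a use on the event of an infinite past itself, to show that it is null. *)
Lemma conv_decay_lty_ae (A : set Omega) (a r C : R) : (0 < a)%R -> measurable A ->
  (forall s t : R, measurable_fun setT (fun w => N w `]s, t]%classic)) ->
  measurable_fun setT (fun w => conv (decay a) r (N w)) ->
  (forall n x, (0 < x)%R ->
    P (A `&` [set w | x%:E < N w `](r - n.+1%:R)%R, (r - n%:R)%R]%classic]) <= (C / x)%:E) ->
  P (A `&` [set w | conv (decay a) r (N w) = +oo]) = 0.
Proof.
move=> a0 mA mN mconv tail.
pose E n := A `&` [set w | (expR (a / 2 * n%:R))%:E < N w `](r - n.+1%:R)%R, (r - n%:R)%R]%classic].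
have mE n : measurable (E n).
  apply: measurableI => //; rewrite -[X in measurable X]setTI.
  by apply: emeasurable_fun_o_infty => //; exact: mN.
have C0 : (0 <= C)%R.
  have := tail 0%N 1%R ltr01; rewrite divr1 -lee_fin; exact: le_trans.
pose q := expR (- (a / 2)).
have q01 : (0 <= q < 1)%R by rewrite expR_ge0 expR_lt1 oppr_lt0 divr_gt0.
have PE0 : P (lim_sup_set E) = 0.
  apply: lim_sup_set_cvg0 => //.
  apply: le_lt_trans (ltry (C / (1 - q))%R); apply: le_trans _ (nneseries_geometric_le C0 q01).
  apply: lee_nneseries => // n _; apply: le_trans (tail n _ (expR_gt0 _)) _.
  by rewrite lee_fin ler_wpM2l// -expRN /q -expRM_natr ler_expR mulNr.
have mI : measurable [set w | conv (decay a) r (N w) = +oo].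
  rewrite (_ : mkset _ = setT `&` (fun w => conv (decay a) r (N w)) @^-1` [set +oo]).
    exact: mconv.
  by rewrite setTI.
apply/eqP; rewrite eq_le measure_ge0 andbT -PE0; apply: le_measure; rewrite ?inE.
- exact: measurableI.
- by apply: bigcapT_measurable => n; apply: bigcup_measurable => j _; exact: mE.
move=> w [Aw wI] n _; apply: contrapT => nE.
(* It is enough to be finite at [r - n]: before that time no unit interval is exceptional, and the
   shift by [n] only multiplies the geometric bound by a constant. *)
suff : conv (decay a) (r - n%:R) (N w) < +oo.
  move/(conv_decay_lty (r) (ltW a0)); rewrite wI; by [].
apply: (@conv_decay_geometric a _ (expR (a / 2 * n%:R)) _ a0 (expR_ge0 _)) => i.
rewrite -expRD -mulrDr -natrD -!addrA -!opprD -!natrD addnS leNgt; apply/negP => h.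
by apply: nE; exists (n + i)%N; [rewrite /= leq_addr|split].
Qed.

End finite_past.

(** * Expansion of the Hawkes class *)

Section taylor_kernel.
Local Open Scope ereal_scope.
Context (R : realType).
Implicit Types nu : radon R.

Lemma expR_nneseries (x : R) : (0 <= x)%R ->
  \sum_(j <oo) (x ^+ j / j`!%:R)%:E = (expR x)%:E.
Proof.
move=> x0; rewrite /expR -EFin_lim; last exact: is_cvg_series_exp_coeff.
by congr (limn _); apply/funext => n; rewrite /= sumEFin.
Qed.

Variables (ah at_ : R).
Hypothesis at0 : (0 < at_)%R.

(* The absolute value only serves to keep the kernel nonnegative for u < 0, where
   it is never integrated. *)
Definition taylor_kernel j u : R := (`|at_ * u| ^+ j / j`!%:R * decay ah u)%R.

Lemma taylor_kernel_ge0 j u : (0 <= taylor_kernel j u)%R.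
Proof. by rewrite mulr_ge0 ?decay_ge0// divr_ge0// exprn_ge0. Qed.

Lemma measurable_taylor_kernel j : measurable_fun setT (taylor_kernel j).
Proof.
apply: measurable_funM; last exact: measurable_decay.
apply: measurable_funM => //; apply: measurable_funX; exact: measurableT_comp.
Qed.

(** Factoring out [decay ah u] leaves exp((ah - a) u), whose series has nonnegative terms because
    [a <= ah]. Scaling by [at_] confines the dependence on [a] to the powers of a ratio. *)
Lemma decay_taylor a u : (a <= ah)%R -> (0 <= u)%R ->
  (decay a u)%:E = \sum_(j <oo) (((ah - a) / at_) ^+ j * taylor_kernel j u)%:E.
Proof.
move=> aah u0.
have -> : (decay a u)%:E = (decay ah u)%:E * (expR ((ah - a) * u))%:E.
  by rewrite -EFinM /decay -expRD; congr (expR _)%:E; ring.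
rewrite -expR_nneseries; last by rewrite mulr_ge0// subr_ge0.
rewrite -nneseriesZl; last first.
  by move=> j _; rewrite lee_fin divr_ge0// exprn_ge0// mulr_ge0// subr_ge0.
apply: eq_eseriesr => j _; rewrite -EFinM /taylor_kernel ger0_norm; last first.
  by rewrite mulr_ge0// ltW.
rewrite exprMn exprMn exprMn exprVn; congr EFin.
field; rewrite pnatr_eq0 -lt0n fact_gt0/= expf_neq0// gt_eqF//.
Qed.

(** Each kernel is a single term of the expansion at the rate [ah - at_], for which the ratio is
    1. *)
Lemma taylor_kernel_le j u : (0 <= u)%R -> (taylor_kernel j u <= decay (ah - at_) u)%R.
Proof.
move=> u0; rewrite -lee_fin (@decay_taylor (ah - at_)%R)//; last by rewrite gerBl ltW.
have t0 i : 0 <= (((ah - (ah - at_)) / at_) ^+ i * taylor_kernel i u)%:E.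
  rewrite lee_fin mulr_ge0 ?taylor_kernel_ge0// exprn_ge0//.
  by rewrite opprB addrCA subrr addr0 divff ?gt_eqF.
apply: (@le_trans _ _ (\sum_(0 <= i < j.+1) (((ah - (ah - at_)) / at_) ^+ i * taylor_kernel i u)%:E)).
  rewrite big_nat_recr//= -[leLHS]add0e; apply: leeD; first by apply: sume_ge0.
  by rewrite opprB addrCA subrr addr0 divff ?gt_eqF// expr1n mul1r.
by apply: nneseries_lim_ge => i _ _; exact: t0.
Qed.

Lemma conv_le (k k' : R -> R) t nu : measurable_fun setT k -> measurable_fun setT k' ->
  (forall u, 0 <= k u)%R -> (forall u, 0 < u -> k u <= k' u)%R ->
  conv k t nu <= conv k' t nu.
Proof.
move=> mk mk' k0 kk'; apply: ge0_le_integral => //.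
- by move=> s _; rewrite lee_fin.
- exact: measurable_kernel_shift.
- exact: measurable_kernel_shift.
- by move=> s /=; rewrite in_itv/= => st; rewrite lee_fin kk'// subr_gt0.
Qed.

Lemma conv_taylor_le j t nu :
  conv (taylor_kernel j) t nu <= conv (decay (ah - at_)) t nu.
Proof.
apply: conv_le.
- exact: measurable_taylor_kernel.
- exact: measurable_decay.
- exact: taylor_kernel_ge0.
- by move=> u /ltW; exact: taylor_kernel_le.
Qed.

Lemma conv_taylor a t nu : (a <= ah)%R -> conv (decay a) t nu =
  \sum_(j <oo) (((ah - a) / at_) ^+ j)%:E * conv (taylor_kernel j) t nu.
Proof.
move=> aah; have th0 j : (0 <= ((ah - a) / at_) ^+ j)%R.
  by rewrite exprn_ge0// divr_ge0 ?subr_ge0// ltW.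
have mk j (D : set R) : measurable_fun D (fun s => (taylor_kernel j (t - s))%:E).
  exact: measurable_kernel_shift (measurable_taylor_kernel j).
transitivity (\int[nu]_(s in `]-oo, t[) \sum_(j <oo)
    (((ah - a) / at_) ^+ j)%:E * (taylor_kernel j (t - s)%R)%:E).
  apply: eq_integral => s /set_mem; rewrite /= in_itv/= => st.
  have ts0 : (0 <= t - s)%R by rewrite subr_ge0 ltW.
  rewrite (decay_taylor aah ts0).
  by apply: eq_eseriesr => j _; rewrite EFinM.
rewrite integral_nneseries//.
- apply: eq_eseriesr => j _; rewrite ge0_integralZl_EFin//.
    by move=> s _; rewrite lee_fin taylor_kernel_ge0.
  exact: mk.
- by move=> j; apply: measurable_funeM; exact: mk.
- by move=> j s _; rewrite -EFinM lee_fin mulr_ge0// taylor_kernel_ge0.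
Qed.

(** Index 0 is reserved for the baseline of the intensity, whose coefficient in [basis_coef] is
    [c]. *)
Definition basis nu (j : nat) (t : R) : R :=
  if j is i.+1 then fine (conv (taylor_kernel i) t nu) else 1%R.

Lemma basis_ge0 nu j t : (0 <= basis nu j t)%R.
Proof. by case: j => //= j; rewrite fine_ge0// conv_ge0//; exact: taylor_kernel_ge0. Qed.

Lemma basis_le nu j t : conv (decay (ah - at_)) t nu < +oo ->
  (basis nu j t <= 1 + fine (conv (decay (ah - at_)) t nu))%R.
Proof.
move=> fin; have c0 : 0 <= conv (decay (ah - at_)) t nu by exact: conv_decay_ge0.
case: j => [|j] /=; first by rewrite lerDl fine_ge0.
rewrite ler_wpDl// fine_le//; last exact: conv_taylor_le.
- rewrite ge0_fin_numE ?conv_ge0//; last exact: taylor_kernel_ge0.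
  exact: le_lt_trans (conv_taylor_le _ _ _) fin.
- by rewrite ge0_fin_numE.
Qed.

Definition basis_coef (L : nat) (c : R) (dd a : 'rV[R]_L) (j : nat) : R :=
  if j is i.+1 then (\sum_(l < L) dd 0%R l * ((ah - a 0%R l) / at_) ^+ i)%R else c.

End taylor_kernel.

Section hawkes_expansion.
Local Open Scope ereal_scope.
Context (R : realType) (disp : measure_display) (Omega : measurableType disp).
Variable N : Omega -> radon R.

(** The finite part is taken of the whole sum: a single infinite convolution of positive weight
    sends the entire memory term to 0. *)
Lemma hawkes_conv (L : nat) (c : R) (dd a : 'rV[R]_L) t w : (forall l, 0 <= dd 0%R l)%R ->
  hawkes N c dd a t w =
  (c + fine (\sum_(l < L) (dd 0%R l)%:E * conv (decay (a 0%R l)) t (N w)))%R.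
Proof.
move=> d0; rewrite /hawkes /Rintegral; congr (_ + fine _)%R.
transitivity (\int[N w]_(s in `]-oo, t[) \sum_(l < L) (dd 0%R l)%:E * (decay (a 0%R l) (t - s))%:E).
  by apply: eq_integral => s _; rewrite -sumEFin; apply: eq_bigr => l _; rewrite EFinM.
rewrite ge0_integral_sum//.
- apply: eq_bigr => l _; rewrite ge0_integralZl_EFin//.
    by move=> s _; rewrite lee_fin decay_ge0.
  exact: measurable_kernel_shift (measurable_decay _).
- move=> l; apply: measurable_funeM.
  exact: measurable_kernel_shift (measurable_decay _).
- by move=> l s _; rewrite mule_ge0// lee_fin// decay_ge0.
Qed.

Variables (ah at_ : R).
Hypothesis at0 : (0 < at_)%R.

Lemma hawkes_basis (L : nat) (c : R) (dd a : 'rV[R]_L) t w :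
  (0 <= c)%R -> (forall l, 0 <= dd 0%R l)%R ->
  (forall l, ah - at_ <= a 0%R l <= ah)%R ->
  conv (decay (ah - at_)) t (N w) < +oo ->
  (hawkes N c dd a t w)%:E =
  \sum_(j <oo) (basis_coef ah at_ c dd a j * basis ah at_ (N w) j t)%:E.
Proof.
move=> c0 d0 al fin; rewrite hawkes_conv//.
have th0 l j : (0 <= ((ah - a 0 l) / at_) ^+ j)%R.
  by rewrite exprn_ge0// divr_ge0 ?(ltW at0)// subr_ge0; have /andP[] := al l.
have cfin l : conv (decay (a 0%R l)) t (N w) < +oo.
  apply: le_lt_trans fin; apply: conv_le.
  - exact: measurable_decay.
  - exact: measurable_decay.
  - exact: decay_ge0.
  - move=> u u0; rewrite /decay ler_expR !mulNr lerN2 ler_wpM2r ?(ltW u0)//.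
    by have /andP[] := al l.
have cge0 l : 0 <= conv (decay (a 0%R l)) t (N w) by exact: conv_decay_ge0.
have tfin j : conv (taylor_kernel ah at_ j) t (N w) \is a fin_num.
  rewrite ge0_fin_numE; first exact: le_lt_trans (conv_taylor_le _ at0 _ _ _) fin.
  by apply: conv_ge0; exact: taylor_kernel_ge0.
have t0 j : 0 <= conv (taylor_kernel ah at_ j) t (N w).
  by apply: conv_ge0; exact: taylor_kernel_ge0.
rewrite EFinD fineK; last first.
  rewrite sum_fin_num; apply/allP => x /mapP[l _ ->].
  by apply: fin_numM => //; rewrite ge0_fin_numE.
have p0 l j : 0 <= (dd 0%R l)%:E * ((((ah - a 0 l) / at_) ^+ j)%:E * conv (taylor_kernel ah at_ j) t (N w)).
  by rewrite !mule_ge0// lee_fin.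
have bc0 j : 0 <= (basis_coef ah at_ c dd a j * basis ah at_ (N w) j t)%:E.
  rewrite lee_fin mulr_ge0 ?basis_ge0//.
  by case: j => [|j] //=; apply: sumr_ge0 => l _; rewrite mulr_ge0.
rewrite [RHS]nneseries_recl//.
rewrite /= mulr1; congr (_ + _).
transitivity (\sum_(l < L) \sum_(j <oo) (dd 0%R l)%:E *
    ((((ah - a 0%R l) / at_) ^+ j)%:E * conv (taylor_kernel ah at_ j) t (N w))).
  apply: eq_bigr => l _; have /andP[_ ala] := al l.
  rewrite (conv_taylor at0 t (N w) ala) nneseriesZl// => j _.
  by rewrite mule_ge0// lee_fin.
rewrite -nneseries_sum//.
rewrite -(nneseries_addn (f := fun j => (basis_coef ah at_ c dd a j * basis ah at_ (N w) j t)%:E) 1 bc0).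
apply: eq_eseriesr => j _; rewrite addn1/=.
rewrite mulr_suml -sumEFin; apply: eq_bigr => l _.
by rewrite !EFinM fineK// muleA.
Qed.

End hawkes_expansion.

(** * Uniform comparison of integrals and least squares on one path *)

Section pathwise.
Local Open Scope ereal_scope.
Context (R : realType).
Local Notation leb := (@lebesgue_measure R).

(** One identity for the two integrals to be compared: [mu] is the point process and [rho] the
    observation window, or [mu] is Lebesgue measure and [rho] the window times the intensity. *)
Lemma class_integral (mu : {measure set (measurableTypeR R) -> \bar R}) (D : set R)
    (K : nat) (b : 'I_K -> R) (coef : nat -> R) (h : R -> R) (u : nat -> R -> R)
    (X : 'I_K -> R -> R) (rho : R -> R) : measurable D ->
  (forall k, 0 <= b k)%R -> (forall j, 0 <= coef j)%R -> (forall j t, 0 <= u j t)%R ->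
  (forall k t, 0 <= X k t)%R -> (forall t, 0 <= rho t)%R ->
  (forall j, measurable_fun setT (u j)) -> (forall k, measurable_fun setT (X k)) ->
  measurable_fun setT rho ->
  (forall t, D t -> (h t)%:E = \sum_(j <oo) (coef j * u j t)%:E) ->
  \int[mu]_(t in D) (h t * (\sum_k X k t * b k) * rho t)%:E =
  \sum_k (b k)%:E * \sum_(j <oo) (coef j)%:E * \int[mu]_(t in D) (u j t * X k t * rho t)%:E.
Proof.
move=> mD b0 coef0 u0 X0 rho0 mu_ mX mrho hE.
have muXr k j : measurable_fun D (fun t => (u j t * X k t * rho t)%:E).
  apply/measurable_EFinP; apply: measurable_funTS; apply: measurable_funM => //.
  exact: measurable_funM.
have t0 k j t : 0 <= (u j t * X k t * rho t)%:E by rewrite lee_fin !mulr_ge0.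
have c0 k j t : 0 <= (coef j)%:E * (u j t * X k t * rho t)%:E by rewrite mule_ge0// lee_fin.
have s0 k t : 0 <= \sum_(j <oo) (coef j)%:E * (u j t * X k t * rho t)%:E.
  by apply: nneseries_ge0 => j _ _; exact: c0.
have ms k : measurable_fun D (fun t => \sum_(j <oo) (coef j)%:E * (u j t * X k t * rho t)%:E).
  apply: ge0_emeasurable_sum => // j _.
  exact: measurable_funeM.
transitivity (\int[mu]_(t in D) \sum_k (b k)%:E *
    \sum_(j <oo) (coef j)%:E * (u j t * X k t * rho t)%:E).
  apply: eq_integral => t /set_mem Dt.
  rewrite mulrAC mulr_sumr -sumEFin; apply: eq_bigr => k _.
  have -> : (h t * rho t * (X k t * b k) = b k * (X k t * rho t * h t))%R by ring.
  rewrite EFinM; congr (_ * _); rewrite EFinM hE// -nneseriesZl; last first.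
    by move=> j _; rewrite lee_fin mulr_ge0.
  by apply: eq_eseriesr => j _; rewrite -!EFinM; congr EFin; ring.
rewrite ge0_integral_sum//; last 2 first.
- by move=> k; exact: (measurable_funeM _ (ms k)).
- by move=> k t _; rewrite mule_ge0// lee_fin.
apply: eq_bigr => k _; rewrite ge0_integralZl_EFin//; last exact: ms.
congr (_ * _); rewrite integral_nneseries//.
  by apply: eq_eseriesr => j _; rewrite ge0_integralZl_EFin//; exact: muXr.
by move=> j; exact: (measurable_funeM _ (muXr k j)).
Qed.

(** Replacing [s j k] by [c j k] costs at most the maximum over [k] of the differences. Neither this
    maximum nor [kap] depends on [b] or [coef], so the error term is uniform over the class. *)
Lemma class_integral_le (K : nat) (B : R) (b : 'I_K -> R) (coef kap : nat -> R)
    (s c : nat -> 'I_K -> \bar R) :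
  (forall k, 0 <= b k)%R -> (\sum_k b k <= B)%R -> (forall j, 0 <= coef j <= kap j)%R ->
  (forall j k, 0 <= s j k) -> (forall j k, 0 <= c j k) ->
  (forall j k, s j k \is a fin_num) -> (forall j k, c j k \is a fin_num) ->
  \sum_k (b k)%:E * \sum_(j <oo) (coef j)%:E * s j k <=
  \sum_k (b k)%:E * \sum_(j <oo) (coef j)%:E * c j k +
  B%:E * \sum_(j <oo) (kap j * \big[Num.max/0]_k `|fine (s j k) - fine (c j k)|)%:E.
Proof.
move=> b0 bB ck s0 c0 sfin cfin.
pose mx j := (\big[Num.max/0]_k `|fine (s j k) - fine (c j k)|)%R.
have mx0 j : (0 <= mx j)%R by exact: bigmax_ge_id.
have coef0 j : (0 <= coef j)%R by have /andP[] := ck j.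
have kap0 j : (0 <= kap j)%R by have /andP[c1 c2] := ck j; exact: le_trans c1 c2.
have km0 j : 0 <= (kap j * mx j)%:E by rewrite lee_fin mulr_ge0.
have sc j k : s j k <= c j k + (mx j)%:E.
  rewrite -[s j k]fineK// -[c j k]fineK// -EFinD lee_fin -lerBlDl.
  by apply: le_trans (ler_norm _) _; rewrite /mx (bigmaxD1 k)// le_max lexx.
apply: (@le_trans _ _ (\sum_k ((b k)%:E * \sum_(j <oo) (coef j)%:E * c j k +
    (b k)%:E * \sum_(j <oo) (kap j * mx j)%:E))).
  apply: lee_sum => k _; rewrite -ge0_muleDr; last 2 first.
  - by apply: nneseries_ge0 => j _ _; rewrite mule_ge0// lee_fin.
  - by apply: nneseries_ge0 => j _ _; exact: km0.
  apply: lee_wpmul2l; first by rewrite lee_fin.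
  rewrite -nneseriesD; last 2 first.
  - by move=> j _ _; rewrite mule_ge0// lee_fin.
  - by move=> j _ _; exact: km0.
  apply: lee_nneseries => [j _ _|j _]; first by rewrite mule_ge0// lee_fin.
  apply: (@le_trans _ _ ((coef j)%:E * (c j k + (mx j)%:E))).
    by apply: lee_wpmul2l => //; rewrite lee_fin.
  rewrite ge0_muleDr ?lee_fin//; apply: leeD => //.
  by rewrite -EFinM lee_fin ler_wpM2r//; have /andP[] := ck j.
rewrite big_split/=; apply: leeD => //.
rewrite -ge0_sume_distrl; last by move=> k _; rewrite lee_fin.
apply: lee_wpmul2r; first by apply: nneseries_ge0 => j _ _; exact: km0.
by rewrite sumEFin lee_fin.
Qed.

Lemma integral_bounded_fin (mu : {measure set (measurableTypeR R) -> \bar R}) (D : set R)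
    (f : R -> R) (k : R) : measurable D -> mu D < +oo -> measurable_fun D f ->
  (forall t, 0 <= f t)%R -> (forall t, D t -> f t <= k)%R ->
  \int[mu]_(t in D) (f t)%:E \is a fin_num.
Proof.
move=> mD Dfin mf f0 fk; rewrite ge0_fin_numE; last first.
  by apply: integral_ge0 => t _; rewrite lee_fin.
apply: (@le_lt_trans _ _ (\int[mu]_(t in D) cst (Num.max 0 k)%:E t)).
  apply: ge0_le_integral => //.
  - by move=> t _; rewrite lee_fin.
  - exact/measurable_EFinP.
  - by move=> t Dt; rewrite lee_fin le_max fk// orbT.
by rewrite integral_cst// lte_mul_pinfty// lee_fin le_max lexx.
Qed.

(** The basic inequality of least squares: in [q f1 <= q f0], bounding the [nu]-integral of [f1]
    from above and that of [f0] from below, each up to [W], leaves an integrated squared difference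
    of at most [4 * W]. The bound [k] makes the integrals finite and does not enter the
    conclusion. *)
Lemma least_squares_excess (nu : radon R) (T W k : R) (f0 f1 : R -> R) : (0 < T)%R ->
  measurable_fun setT f0 -> measurable_fun setT f1 ->
  (forall t, 0 <= f0 t)%R -> (forall t, 0 <= f1 t)%R ->
  (forall t, 0 <= t <= T -> f0 t <= k)%R -> (forall t, 0 <= t <= T -> f1 t <= k)%R ->
  let q f := (- (2 / T) * (\int[nu]_(t in `[0%R, T]) f t)%R +
    T^-1 * (\int[leb]_(t in `[0%R, T]) (f t ^+ 2)%R)%R)%R in
  (q f1 <= q f0)%R ->
  \int[nu]_(t in `[0%R, T]) (f1 t)%:E <=
    \int[leb]_(t in `[0%R, T]) (f1 t * f0 t)%:E + W%:E ->
  \int[leb]_(t in `[0%R, T]) (f0 t * f0 t)%:E <=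
    \int[nu]_(t in `[0%R, T]) (f0 t)%:E + W%:E ->
  (0 <= T^-1 * (\int[leb]_(t in `[0%R, T]) ((f0 t - f1 t) ^+ 2)%R)%R <= 4 * W / T)%R.
Proof.
move=> T0 mf0 mf1 f00 f10 f0k f1k q.
have mD : measurable (`[0%R, T]%classic : set R) by exact: measurable_itv.
have lD : leb (`[0%R, T]%classic : set R) < +oo.
  by rewrite lebesgue_measure_itv/=; case: ifP => // _; rewrite ltry.
have nD : nu `[0%R, T]%classic < +oo by apply: radon_compact; exact: segment_compact.
have k0 : (0 <= k)%R by apply: le_trans (f00 0%R) (f0k _ _); rewrite lexx ltW.
have fin (mu : {measure set (measurableTypeR R) -> \bar R}) (f : R -> R) (c : R) :
    mu `[0%R, T]%classic < +oo -> measurable_fun setT f -> (forall t, 0 <= f t)%R ->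
    (forall t, 0 <= t <= T -> f t <= c)%R ->
    \int[mu]_(t in `[0%R, T]) (f t)%:E \is a fin_num.
  move=> muD mf ff fc; apply: (integral_bounded_fin (k := c) mD muD _ ff).
    exact: measurable_funTS.
  by move=> t tT; apply: fc; move: tT; rewrite /= in_itv.
have I0 := fin nu f0 k nD mf0 f00 f0k; have I1 := fin nu f1 k nD mf1 f10 f1k.
have finM (f g : R -> R) : measurable_fun setT f -> measurable_fun setT g ->
    (forall t, 0 <= f t)%R -> (forall t, 0 <= g t)%R ->
    (forall t, 0 <= t <= T -> f t <= k)%R -> (forall t, 0 <= t <= T -> g t <= k)%R ->
    \int[leb]_(t in `[0%R, T]) (f t * g t)%:E \is a fin_num.
  move=> mf mg ff gg fk gk; apply: (fin leb (fun t => f t * g t)%R (k * k)%R lD).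
  - exact: measurable_funM.
  - by move=> t; exact: mulr_ge0.
  - by move=> t tT; apply: ler_pM => //; [exact: fk|exact: gk].
have Q00 := finM f0 f0 mf0 mf0 f00 f00 f0k f0k.
have Q11 := finM f1 f1 mf1 mf1 f10 f10 f1k f1k.
have Q10 := finM f1 f0 mf1 mf0 f10 f00 f1k f0k.
pose d t := ((f0 t - f1 t) ^+ 2)%R.
have md : measurable_fun setT d by apply: measurable_funX; exact: measurable_funB.
have dfin : \int[leb]_(t in `[0%R, T]) (d t)%:E \is a fin_num.
  apply: (fin leb d (k ^+ 2)%R) => // [t|t tT]; first exact: sqr_ge0.
  rewrite /d -[(_ ^+ 2)%R]real_normK ?num_real// lerXn2r ?nnegrE// ler_norml.
  have := f0k t tT; have := f1k t tT; have := f00 t; have := f10 t => ? ? ? ?.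
  by apply/andP; split; lra.
have E : \int[leb]_(t in `[0%R, T]) (d t)%:E +
    (\int[leb]_(t in `[0%R, T]) (f1 t * f0 t)%:E + \int[leb]_(t in `[0%R, T]) (f1 t * f0 t)%:E) =
    \int[leb]_(t in `[0%R, T]) (f0 t * f0 t)%:E + \int[leb]_(t in `[0%R, T]) (f1 t * f1 t)%:E.
  have mM (f g : R -> R) : measurable_fun setT f -> measurable_fun setT g ->
      measurable_fun (`[0%R, T]%classic : set R) (fun t => (f t * g t)%:E).
    by move=> mf mg; apply/measurable_EFinP; apply: measurable_funTS; exact: measurable_funM.
  have pM (f g : R -> R) t : (forall t, 0 <= f t)%R -> (forall t, 0 <= g t)%R -> 0 <= (f t * g t)%:E.
    by move=> ff gg; rewrite lee_fin mulr_ge0.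
  rewrite -ge0_integralD//; [|by move=> t _; exact: pM|exact: mM|by move=> t _; exact: pM|exact: mM].
  rewrite -ge0_integralD//; last 4 first.
  - by move=> t _; rewrite lee_fin sqr_ge0.
  - by apply/measurable_EFinP; exact: measurable_funTS.
  - by move=> t _; rewrite adde_ge0// pM.
  - by apply: emeasurable_funD; exact: mM.
  rewrite -ge0_integralD//; [|by move=> t _; exact: pM|exact: mM|by move=> t _; exact: pM|exact: mM].
  by apply: eq_integral => t _; rewrite -!EFinD; congr EFin; rewrite /d; ring.
have eR (mu : {measure set (measurableTypeR R) -> \bar R}) (f : R -> R) :
    (\int[mu]_(t in `[0%R, T]) f t)%R = fine (\int[mu]_(t in `[0%R, T]) (f t)%:E) by [].
have sq (f : R -> R) : \int[leb]_(t in `[0%R, T]) (f t ^+ 2)%:E = \int[leb]_(t in `[0%R, T]) (f t * f t)%:E.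
  by apply: eq_integral.
have D0 : (0 <= fine (\int[leb]_(t in `[0%R, T]) (d t)%:E))%R.
  by apply: fine_ge0; apply: integral_ge0 => t _; rewrite lee_fin sqr_ge0.
rewrite /q !eR !sq -[\int[leb]_(t in _) ((_ - _) ^+ 2)%:E]/(\int[leb]_(t in `[0%R, T]) (d t)%:E).
move: E D0; rewrite -(fineK dfin) -(fineK Q00) -(fineK Q11) -(fineK Q10) -(fineK I0) -(fineK I1) /=.
move: (fine (\int[leb]_(t in _) (d t)%:E)) => x.
move: (fine (\int[leb]_(t in _) (f0 t * f0 t)%:E)) => q00.
move: (fine (\int[leb]_(t in _) (f1 t * f1 t)%:E)) => q11.
move: (fine (\int[leb]_(t in _) (f1 t * f0 t)%:E)) => q10.
move: (fine (\int[nu]_(t in _) (f0 t)%:E)) => i0.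
move: (fine (\int[nu]_(t in _) (f1 t)%:E)) => i1.
rewrite -!EFinD !lee_fin => -[E] x0 le_q le1 le2.
have iT : (0 < T^-1)%R by rewrite invr_gt0.
have le_q' : (q11 - 2 * i1 <= q00 - 2 * i0)%R.
  rewrite -(ler_pM2l iT); apply: le_trans (le_trans _ le_q) _; rewrite le_eqVlt; apply/orP; left; apply/eqP; ring.
apply/andP; split; first by rewrite mulr_ge0// ltW.
rewrite [leRHS]mulrC ler_pM2l//; lra.
Qed.

End pathwise.

Section hawkes_process.
Local Open Scope ereal_scope.
Context (R : realType) (disp : measure_display) (Omega : measurableType disp).
Variables (F : R -> set (set Omega)) (HF : filtration F).
Variables (N : Omega -> radon R) (HA : adapted F N).

Lemma predictable_hawkes (L : nat) (c : R) (dd a : 'rV[R]_L) : (forall l, 0 <= dd 0%R l)%R ->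
  measurable_fun setT (fun p : predictable_space F => hawkes N c dd a p.1 p.2).
Proof.
move=> d0.
rewrite (_ : (fun p => _) = fun p : predictable_space F => (c + fine (\sum_(l < L)
    (dd 0%R l)%:E * conv (decay (a 0%R l)) p.1 (N p.2)))%R); last first.
  by apply/funext => p; rewrite hawkes_conv.
apply: measurable_funD => //; apply: measurableT_comp => //.
apply: emeasurable_sum => l; apply: measurable_funeM.
by apply: predictable_conv => //; [exact: decay_ge0|exact: measurable_decay].
Qed.

Lemma hawkes_ge (L : nat) (c : R) (dd a : 'rV[R]_L) t w : (forall l, 0 <= dd 0%R l)%R ->
  (c <= hawkes N c dd a t w)%R.
Proof.
move=> d0; rewrite hawkes_conv// lerDl fine_ge0// sume_ge0// => l _.
by rewrite mule_ge0 ?lee_fin// conv_decay_ge0.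
Qed.

(** With finite convolutions the real integral is the genuine one, and the rate of a term of zero
    weight may be chosen at will. *)
Lemma hawkes_finite (L : nat) (c : R) (dd a a' : 'rV[R]_L) t w : (forall l, 0 <= dd 0%R l)%R ->
  (forall l, dd 0%R l != 0%R -> a 0%R l = a' 0%R l) ->
  (forall l, conv (decay (a' 0%R l)) t (N w) < +oo) ->
  hawkes N c dd a t w = (c + \sum_(l < L) dd 0%R l * fine (conv (decay (a' 0%R l)) t (N w)))%R.
Proof.
move=> d0 aa' fin; rewrite hawkes_conv//; congr (_ + _)%R.
rewrite (eq_bigr (fun l => (dd 0%R l * fine (conv (decay (a' 0%R l)) t (N w)))%:E)).
  by rewrite sumEFin.
move=> l _; have [->|dl] := eqVneq (dd 0%R l) 0%R; first by rewrite mul0e mul0r.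
rewrite aa'// EFinM fineK// ge0_fin_numE//.
exact: conv_decay_ge0.
Qed.

(** One infinite term makes the whole memory integral infinite, and the finite part of [+oo] is
    0. *)
Lemma hawkes_infinite (L : nat) (c : R) (dd a : 'rV[R]_L) t w l : (forall l, 0 <= dd 0%R l)%R ->
  dd 0%R l != 0%R -> conv (decay (a 0%R l)) t (N w) = +oo -> hawkes N c dd a t w = c.
Proof.
move=> d0 dl cl; rewrite hawkes_conv// (bigD1 l)//= cl gt0_muley; last first.
  by rewrite lte_fin lt_neqAle eq_sym dl d0.
rewrite addye ?addr0//; apply/eqP => E.
have : 0 <= \sum_(i < L | i != l) (dd 0%R i)%:E * conv (decay (a 0%R i)) t (N w).
  by apply: sume_ge0 => i _; rewrite mule_ge0 ?lee_fin// conv_decay_ge0.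
by rewrite E.
Qed.

Lemma hawkes_le (L : nat) (c rho r T : R) (dd a : 'rV[R]_L) t w : (0 < rho)%R ->
  (forall l, 0 <= dd 0%R l)%R -> (forall l, rho <= a 0%R l)%R ->
  conv (decay rho) r (N w) < +oo -> (r <= t <= T)%R ->
  (hawkes N c dd a t w <= c + (\sum_(l < L) dd 0%R l) *
     (fine (conv (decay rho) r (N w)) + fine (N w `[r, T[%classic)))%R.
Proof.
move=> rho0 d0 ra fin /andP[rt tT].
have rho_fin s : conv (decay rho) s (N w) \is a fin_num.
  rewrite ge0_fin_numE; first exact: conv_decay_lty (ltW rho0) fin.
  exact: conv_decay_ge0.
have cle l s : conv (decay (a 0%R l)) s (N w) <= conv (decay rho) s (N w).
  apply: conv_le.
  - exact: measurable_decay.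
  - exact: measurable_decay.
  - exact: decay_ge0.
  - by move=> u u0; rewrite /decay ler_expR !mulNr lerN2 ler_wpM2r ?(ltW u0).
have afin l s : conv (decay (a 0%R l)) s (N w) \is a fin_num.
  rewrite ge0_fin_numE; last exact: conv_decay_ge0.
  by apply: le_lt_trans (cle l s) _; rewrite -ge0_fin_numE// conv_decay_ge0.
rewrite (@hawkes_finite _ _ _ _ a)//; last first.
  by move=> l; rewrite -ge0_fin_numE// conv_decay_ge0.
rewrite lerD2l mulr_suml; apply: ler_sum => l _; apply: ler_wpM2l => //.
rewrite -lee_fin EFinD !fineK ?radon_co_fin//.
apply: le_trans (cle l t) _; apply: le_trans (conv_decay_le (N w) (ltW rho0) rt) _.
apply: leeD => //; apply: radon_le_itv.
by move=> u /=; rewrite !in_itv/= => /andP[-> ut]; exact: lt_le_trans ut tT.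
Qed.

Lemma predictable_covariates (K : nat) (X : R -> Omega -> 'rV[R]_K) k : covariates F X ->
  measurable_fun setT (fun p : predictable_space F => X p.1 p.2 0%R k).
Proof. by move=> [pX _ _]; apply/measurable_wrt_predictable; exact: pX. Qed.

Lemma predictable_linear (K : nat) (X : R -> Omega -> 'rV[R]_K) (b : 'rV[R]_K) : covariates F X ->
  measurable_fun setT (fun p : predictable_space F => linear_covariates X b p.1 p.2).
Proof.
move=> cX; apply: measurable_sum => k; apply: measurable_funM => //.
exact: predictable_covariates.
Qed.

Lemma linear_covariates_bound (K : nat) (X : R -> Omega -> 'rV[R]_K) (b : 'rV[R]_K) B t w :
  covariates F X -> (forall k, 0 <= b 0%R k)%R -> (l1norm b <= B)%R ->
  (0 <= linear_covariates X b t w <= B)%R.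
Proof.
move=> [_ _ X01] b0 bB; apply/andP; split.
  by apply: sumr_ge0 => k _; rewrite mulr_ge0//; have /andP[] := X01 t w k.
apply: le_trans bB; apply: ler_sum => k _; rewrite ger0_norm//.
by rewrite ler_piMl//; have /andP[] := X01 t w k.
Qed.

End hawkes_process.

(** * Moments and noise of a controlled process *)

Lemma pow4_le (R : realDomainType) (v : R) : (1 + v) ^+ 4 <= 8 * (1 + v ^+ 4).
Proof.
have -> : (8 * (1 + v ^+ 4) = (1 + v) ^+ 4 + (4 * (1 + v ^+ 2) ^+ 2 - (1 + v) ^+ 4) +
  4 * (1 - v ^+ 2) ^+ 2) by ring.
have -> : (4 * (1 + v ^+ 2) ^+ 2 - (1 + v) ^+ 4 =
   (1 - v) ^+ 2 * (2 * (1 + v ^+ 2) + (1 + v) ^+ 2)) by ring.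
rewrite -addrA lerDl; apply: addr_ge0; apply: mulr_ge0 => //; try exact: sqr_ge0.
by apply: addr_ge0; [apply: mulr_ge0 => //; apply: addr_ge0 => //|]; exact: sqr_ge0.
Qed.

Lemma linear_growth_le (R : realType) (p b k : R) : (forall n : nat, n%:R * p <= n%:R * b + k) -> p <= b.
Proof.
move=> H; rewrite leNgt; apply/negP => bp.
have k0 : 0 <= k by have := H 0%N; rewrite !mul0r add0r.
have pb : 0 < p - b by rewrite subr_gt0.
have := H (Num.truncn (k / (p - b))).+1.
have /truncn_itv/andP[_] : 0 <= k / (p - b) by rewrite divr_ge0// ltW.
rewrite ltr_pdivrMr// mulrBr; set n := _%:R; lra.
Qed.

Section markov.
Local Open Scope ereal_scope.
Context (R : realType) (disp : measure_display) (Omega : measurableType disp).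
Variable P : probability Omega R.

Lemma markov_event (A : set Omega) (f : Omega -> \bar R) (x : R) :
  measurable A -> measurable_fun setT f -> (forall w, 0 <= f w) -> (0 < x)%R ->
  x%:E * P (A `&` [set w | x%:E < f w]) <= \int[P]_(w in A) f w.
Proof.
move=> mA mf f0 x0.
have mE : measurable (A `&` [set w | x%:E < f w]).
  apply: measurableI => //; rewrite -[X in measurable X]setTI.
  exact: emeasurable_fun_o_infty.
have -> : x%:E * P (A `&` [set w | x%:E < f w]) =
   \int[P]_(w in A `&` [set w | x%:E < f w]) cst x%:E w by rewrite integral_cst.
apply: (@le_trans _ _ (\int[P]_(w in A `&` [set w | x%:E < f w]) f w)).
  apply: ge0_le_integral => //.
  - by move=> w _; rewrite lee_fin ltW.
  - exact: measurable_funTS.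
  - by move=> w [_ /ltW].
by apply: ge0_subset_integral => //; exact: measurable_funTS.
Qed.

End markov.

Section controlled_process.
Local Open Scope ereal_scope.
Context (R : realType) (disp : measure_display) (Omega : measurableType disp).
Variable P : probability Omega R.
Variables (F : R -> set (set Omega)) (HF : filtration F).
Variables (N : Omega -> radon R) (HA : adapted F N).
Hypothesis HN : forall w, counting_simple (N w).
Variable lam : R -> Omega -> R.
Hypothesis lam0 : forall t w, (0 <= lam t w)%R.
Hypothesis mlam : measurable_fun setT (fun p : predictable_space F => lam p.1 p.2).
Hypothesis Hint : intensity P F N lam.

Local Notation leb := (@lebesgue_measure R).

Variables (m : nat) (al wt : 'I_m -> R) (B c lo hi : R).
Hypotheses (B0 : (0 <= B)%R) (c0 : (0 <= c)%R) (lo0 : (0 < lo)%R).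
Hypothesis alb : forall i, (lo <= al i <= hi)%R.
Hypothesis wt0 : forall i, (0 <= wt i)%R.

Let V t w := potential al (N w) wt t.
Let D t w := potential al (N w) (fun i => wt i * al i)%R t.
Let J : R := (\sum_i wt i)%R.

Hypothesis BJ : (B * J < 1)%R.
Hypothesis hi0 : (0 <= hi)%R.
Variable j0 : 'I_m.
Hypothesis wtj0 : (0 < wt j0)%R.

(** Since [A] belongs to the past of [r], the martingale property after [r] can be used on it; a
    bounded initial potential stands in for moments of the stationary law, which are not known. *)
Record controlled (r M : R) (A : set Omega) : Prop := Controlled {
  controlled_past : F r A ;
  controlled_fin : forall w i, A w -> conv (decay (al i)) r (N w) < +oo ;
  controlled_le : forall w, A w -> (V r w <= M)%R ;
  controlled_lam : forall w t, A w -> (r <= t)%R -> (lam t w <= B * (c + D t w))%R }.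

Let al0 i : (0 < al i)%R.
Proof. by have /andP[+ _] := alb i; exact: lt_le_trans. Qed.

Let J0 : (0 <= J)%R.
Proof. exact: sumr_ge0. Qed.

Let V0 t w : (0 <= V t w)%R.
Proof. exact: potential_ge0. Qed.

Let D0 t w : (0 <= D t w)%R.
Proof. by apply: potential_ge0 => i; rewrite mulr_ge0// ltW. Qed.

Let DV t w : (D t w <= hi * V t w)%R.
Proof. by have /andP[] := potential_mul (N w) t wt0 alb. Qed.

Lemma count_co_oc (nu : radon R) (s t : R) : counting_simple nu -> (s <= t)%R ->
  (fine (nu `[s, t[%classic) <= 1 + fine (nu `]s, t]%classic))%R.
Proof.
move=> Hnu st; rewrite -lee_fin EFinD !fineK ?radon_co_fin ?radon_itv_fin//.
apply: (@le_trans _ _ (nu ([set s] `|` `]s, t]%classic))).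
  apply: radon_le; [exact: measurable_itv|apply: measurableU => //; exact: measurable_itv|].
  move=> u /=; rewrite !in_itv/= => /andP[]; rewrite le_eqVlt => /predU1P[->|su ut]; first by left.
  by right; rewrite su ltW.
apply: le_trans (measureU2 _ _ _) _ => //.
by apply: leeD => //; exact: Hnu.2.
Qed.

Lemma controlled_V r M A s w : controlled r M A -> A w -> (r <= s)%R ->
  (V s w <= M + J * (1 + fine (N w `]r, s]%classic)))%R.
Proof.
move=> HA' Aw rs; apply: le_trans (potential_le al0 _ rs wt0) _.
  by move=> i; exact: (controlled_fin HA').
apply: lerD; first exact: (controlled_le HA').
by apply: ler_wpM2l => //; exact: count_co_oc.
Qed.

Lemma controlled_lam_le r M A s T w : controlled r M A -> A w -> (r <= s <= T)%R ->
  (lam s w <= B * (c + hi * (M + J * (1 + fine (N w `]r, T]%classic)))))%R.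
Proof.
move=> HA' Aw /andP[rs sT]; apply: le_trans (controlled_lam HA' Aw rs) _.
apply: ler_wpM2l => //; rewrite lerD2l; apply: le_trans (DV _ _) _.
apply: ler_wpM2l => //; apply: le_trans (controlled_V HA' Aw rs) _.
rewrite lerD2l; apply: ler_wpM2l => //; rewrite lerD2l -lee_fin !fineK ?radon_itv_fin//.
apply: radon_le_itv.
by move=> u /=; rewrite !in_itv/= => /andP[-> /=] /le_trans; apply.
Qed.

Lemma mlam_path w (I : set R) : measurable_fun I (fun t => (lam t w)%:E).
Proof.
apply/measurable_EFinP; apply: measurable_funTS; exact: (predictable_path w mlam).
Qed.

Lemma integral_lam_le (s u K : R) w : (s <= u)%R ->
  (forall t, (s < t <= u)%R -> (lam t w <= K)%R) ->
  \int[leb]_(t in `]s, u]) (lam t w)%:E <= (K * (u - s))%:E.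
Proof.
move=> su lamK; apply: (@le_trans _ _ (\int[leb]_(t in `]s, u]) (cst K%:E t))).
  apply: ge0_le_integral => //.
  - by move=> t _; rewrite lee_fin.
  - exact: mlam_path.
have -> : \int[leb]_(t in `]s, u]) (cst K%:E t) = K%:E * leb `]s, u]%classic.
  by rewrite integral_cst.
rewrite EFinM lebesgue_measure_itv/= lte_fin.
by move: su; rewrite le_eqVlt => /predU1P[->|->]; rewrite ?ltxx ?subrr.
Qed.

(** The martingale is integrable by definition and the compensator is bounded, so their sum, the
    count, has a finite mean. *)
Lemma bounded_intensity_count (s u k : R) (A : set Omega) : (s <= u)%R -> F s A ->
  (forall w, A w -> forall t, (s < t <= u)%R -> (lam t w <= k)%R) ->
  \int[P]_(w in A) N w `]s, u]%classic < +oo.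
Proof.
move=> su FA lamk; have mA := past_set_measurable HF FA.
have [_ MI _] := Hint s; have {MI} := MI _ su; set M' := EFin \o _ => MI.
have /integrableP[mM Mfin] : P.-integrable A M'.
  by apply: integrableS MI => //; exact: measurableT.
have mnM : measurable_fun A (fun w => `|M' w|) by exact: measurableT_comp.
apply: (@le_lt_trans _ _ (\int[P]_(w in A) (`|M' w| + `|(k * (u - s))%:E|))).
  apply: ge0_le_integral => //.
  - by apply: measurable_funTS; exact: (measurable_count HF HA).
  - exact: emeasurable_funD.
  - move=> w Aw; have Il := integral_lam_le su (lamk w Aw).
    have I0 : 0 <= \int[leb]_(t in `]s, u]) (lam t w)%:E.
      by apply: integral_ge0 => t _; rewrite lee_fin.
    have Ifin : \int[leb]_(t in `]s, u]) (lam t w)%:E \is a fin_num.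
      by rewrite ge0_fin_numE//; apply: le_lt_trans Il _; exact: ltry.
    rewrite -(fineK (radon_itv_fin (N w) s u)) /M' /= /Rintegral.
    move: Il; rewrite -{1}(fineK Ifin) -EFinD !lee_fin -lerBlDl => Il.
    by rewrite lerBlDr; apply: le_trans (lerD (le_trans Il (ler_norm _)) (ler_norm _)); rewrite addrC subrK.
rewrite ge0_integralD// integral_cst//.
by rewrite lte_add_pinfty// lte_mul_pinfty// (le_lt_trans (probability_le1 P mA))// ltry.
Qed.

Lemma controlled_lam_lty r M A T w : controlled r M A -> A w -> (r <= T)%R ->
  \int[leb]_(t in `]r, T]) (lam t w)%:E < +oo.
Proof.
move=> HA' Aw rT.
have lamK t : (r < t <= T)%R ->
    (lam t w <= B * (c + hi * (M + J * (1 + fine (N w `]r, T]%classic)))))%R.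
  by move=> /andP[/ltW rt tT]; apply: (controlled_lam_le HA' Aw); rewrite rt.
exact: le_lt_trans (integral_lam_le rT lamK) (ltry _).
Qed.

(** The intensity is not bounded, as new points raise it. Over a step of length [dl] this feedback
    amounts to at most half of the new points and is absorbed on the left; what remains involves the
    integrable martingale and the earlier count, whose mean is finite by induction on the steps. *)
Lemma controlled_count r M A T : controlled r M A -> (r <= T)%R ->
  \int[P]_(w in A) N w `]r, T]%classic < +oo.
Proof.
move=> HA' rT; have mA := past_set_measurable HF (controlled_past HA').
have mN s t : measurable_fun A (fun w => N w `]s, t]%classic).
  by apply: measurable_funTS; exact: (measurable_count HF HA).
pose Jd : R := (\sum_i wt i * al i)%R.
have Jd0 : (0 <= Jd)%R by apply: sumr_ge0 => i _; rewrite mulr_ge0// ltW.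
(* Short enough that [dl * (B * Jd)], the share of the new points in their own compensator, is at
   most one half. *)
pose dl : R := ((2 * (B * Jd + 1))^-1)%R.
have dl0 : (0 < dl)%R by rewrite invr_gt0 mulr_gt0// ltr_wpDl// mulr_ge0.
have dlB : (dl * (B * Jd) <= 2^-1)%R.
  rewrite /dl invfM -mulrA -[leRHS]mulr1; apply: ler_wpM2l; first by rewrite invr_ge0.
  by rewrite mulrC ler_pdivrMr ?mul1r ?lerDl// ltr_wpDl// mulr_ge0.
have step s : (r <= s)%R -> \int[P]_(w in A) N w `]r, s]%classic < +oo ->
    \int[P]_(w in A) N w `]s, (s + dl)%R]%classic < +oo.
  move=> rs Ns; have sd : (s <= s + dl)%R by rewrite lerDl ltW.
  have [_ MI _] := Hint s.
  have {MI} := MI _ sd; set M' := EFin \o _ => MI.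
  have MIA : P.-integrable A M' by apply: integrableS MI => //; exact: measurableT.
  pose C1 : R := (2 * (dl * (B * (c + Jd + hi * (M + J)))))%R.
  pose C2 : R := (2 * (dl * (B * (hi * J))))%R.
  have C20 : (0 <= C2)%R by rewrite !mulr_ge0// ltW.
  have key w : A w -> N w `]s, (s + dl)%R]%classic <=
      2%:E * `|M' w| + (C1%:E + C2%:E * N w `]r, s]%classic).
    move=> Aw; set n := fine (N w `]s, (s + dl)%R]%classic).
    set n0 := fine (N w `]r, s]%classic).
    have nE : n%:E = N w `]s, (s + dl)%R]%classic by rewrite fineK// radon_itv_fin.
    have n0E : n0%:E = N w `]r, s]%classic by rewrite fineK// radon_itv_fin.
    have lamK t : (s < t <= s + dl)%R ->
        (lam t w <= B * (c + (hi * (M + J * (1 + n0)) + Jd * (1 + n))))%R.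
      move=> /andP[st ts]; have rt : (r <= t)%R by apply: le_trans rs _; exact: ltW.
      apply: le_trans (controlled_lam HA' Aw rt) _; apply: ler_wpM2l => //; rewrite lerD2l.
      apply: le_trans (potential_le (r := r) al0 _ (ltW st) _) _.
      - by move=> i; exact: (controlled_fin HA').
      - by move=> i; rewrite mulr_ge0// ltW.
      apply: lerD.
        apply: le_trans (DV _ _) _; apply: ler_wpM2l => //; exact: (controlled_V HA').
      apply: ler_wpM2l => //; apply: le_trans (count_co_oc (HN w) (ltW st)) _.
      rewrite lerD2l -lee_fin !fineK ?radon_itv_fin//.
      apply: radon_le_itv.
      by move=> u /=; rewrite !in_itv/= => /andP[-> /=] /le_trans; apply.
    have Il := integral_lam_le sd lamK.
    have I0 : 0 <= \int[leb]_(t in `]s, (s + dl)%R]) (lam t w)%:E.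
      by apply: integral_ge0 => t _; rewrite lee_fin.
    have Ifin : \int[leb]_(t in `]s, (s + dl)%R]) (lam t w)%:E \is a fin_num.
      by rewrite ge0_fin_numE//; apply: le_lt_trans Il _; exact: ltry.
    rewrite -n0E -nE /M' /= /Rintegral.
    move: Il I0; rewrite -(fineK Ifin).
    rewrite -/n; set I := fine _; rewrite !lee_fin => Il I0.
    rewrite [fine I%:E]/=.
    have nI : (n - I <= `|n - I|)%R by exact: ler_norm.
    have n0' : (0 <= n)%R by rewrite fine_ge0.
    have hn : (dl * (B * Jd) * n <= 2^-1 * n)%R by apply: ler_wpM2r.
    have Il' : (I <= dl * (B * (c + Jd + hi * (M + J))) + dl * (B * (hi * J)) * n0 +
        dl * (B * Jd) * n)%R.
      apply: le_trans Il _; rewrite addrAC subrr add0r.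
      by rewrite le_eqVlt; apply/orP; left; apply/eqP; ring.
    rewrite /C1 /C2; lra.
  apply: (@le_lt_trans _ _ (\int[P]_(w in A)
      (2%:E * `|M' w| + (`|C1|%:E + C2%:E * N w `]r, s]%classic)))).
    apply: ge0_le_integral => //.
    - apply: emeasurable_funD.
        apply: measurable_funeM; apply: measurableT_comp => //.
        exact: (measurable_int P MIA).
      by apply: emeasurable_funD => //; exact: measurable_funeM.
    - move=> w Aw; apply: le_trans (key w Aw) _; apply: leeD => //; apply: leeD => //.
      by rewrite lee_fin ler_norm.
  have mMA : measurable_fun A (fun w => `|M' w|).
    by apply: measurableT_comp => //; exact: (measurable_int P MIA).
  have M2 : measurable_fun A (fun w => 2%:E * `|M' w|) by exact: measurable_funeM.
  have M3 : measurable_fun A (fun w => C2%:E * N w `]r, s]%classic) by exact: measurable_funeM.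
  rewrite ge0_integralD//=; last 2 first.
  - by move=> w _; rewrite adde_ge0// mule_ge0.
  - by apply: emeasurable_funD.
  rewrite ge0_integralZl_EFin// ge0_integralD//; last by move=> w _; rewrite mule_ge0.
  rewrite ge0_integralZl_EFin// integral_cst//.
  have MIfin : \int[P]_(w in A) `|M' w| < +oo by have /integrableP[] := MIA.
  have PA : P A < +oo by rewrite (le_lt_trans (probability_le1 P mA))// ltry.
  by rewrite !lte_add_pinfty// lte_mul_pinfty.
have all k : \int[P]_(w in A) N w `]r, (r + k%:R * dl)%R]%classic < +oo.
  elim: k => [|k IHk].
    by rewrite mul0r addr0 set_itvoc0; under eq_integral do rewrite measure0; rewrite integral0.
  have rk : (r <= r + k%:R * dl)%R by rewrite lerDl mulr_ge0// ltW.
  have := step _ rk IHk; rewrite -addrA.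
  rewrite (_ : (k%:R * dl + dl)%R = (k.+1%:R * dl)%R); last by rewrite -natr1 mulrDl mul1r.
  move=> IHk'; rewrite (eq_integral (fun w => N w `]r, (r + k%:R * dl)%R]%classic +
       N w `](r + k%:R * dl)%R, (r + k.+1%:R * dl)%R]%classic)).
    by rewrite ge0_integralD// lte_add_pinfty.
  move=> w _; apply: measure_itv_cat; rewrite bnd_simp//.
  by rewrite lerD2l ler_wpM2r ?ler_nat// ltW.
pose k := (Num.truncn ((T - r) / dl)).+1.
apply: le_lt_trans (all k); apply: ge0_le_integral => //.
move=> w _; apply: radon_le_itv.
move=> u /=; rewrite !in_itv/= => /andP[-> /=] /le_trans; apply.
rewrite -lerBlDl -ler_pdivrMr//; apply/ltW.
by have /truncn_itv/andP[] : (0 <= (T - r) / dl)%R by rewrite divr_ge0 ?subr_ge0// ltW.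
Qed.

(** * Fourth moments of the potential *)

Section moments.

(* Cutting before the (n+1)-st point after r makes both sides of the chain rule
   integrable, so that they can be compared in mean. *)
Let chi (r : R) (n : nat) (p : predictable_space F) : R :=
  if N p.2 (`[r, +oo[ `&` `]-oo, p.1[) <= n%:R%:E then 1%R else 0%R.

Let mchi r n : measurable_fun setT (chi r n).
Proof.
apply: measurable_fun_ifT => //; apply: measurable_fun_lee => //.
exact: (predictable_count HF HA (measurable_itv `[r, +oo[)).
Qed.

Let chiE r n s w : chi r n (s, w) = if N w `[r, s[%classic <= n%:R%:E then 1%R else 0%R.
Proof.
rewrite /chi/= (_ : `[r, +oo[ `&` `]-oo, s[ = `[r, s[%classic :> set R)//.
apply/seteqP; split=> u /=; rewrite !in_itv/= andbT; first by move=> [-> ->].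
by move=> /andP[-> ->].
Qed.

Let chi01 r n p : (0 <= chi r n p <= 1)%R.
Proof. by rewrite /chi; case: ifP => _; rewrite ?lexx ler01. Qed.

Let mV : measurable_fun setT (fun p : predictable_space F => V p.1 p.2).
Proof. exact: predictable_potential. Qed.

Let g s w : R := ((V s w + J) ^+ 4 - V s w ^+ 4)%R.

Let g0 s w : (0 <= g s w)%R.
Proof. by rewrite subr_ge0 lerXn2r ?nnegrE ?addr_ge0// lerDl. Qed.

Let mg : measurable_fun setT (fun p : predictable_space F => g p.1 p.2).
Proof.
apply: measurable_funB; apply: measurable_funX => //.
exact: measurable_funD.
Qed.

(** The threshold is the point number [n + 1] from [r] on, or [T]. As [chi] counts strictly earlier
    points, it is still 1 at the threshold itself. *)
Lemma chi_threshold r T n w : (r <= T)%R -> exists e : R, (r <= e <= T)%R /\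
  forall s, (r < s <= T)%R -> chi r n (s, w) = if (s <= e)%R then 1%R else 0%R.
Proof.
move=> rT; have [le|nlt] := leP (N w `[r, T[%classic) n%:R%:E.
  exists T; split=> [|s /andP[rs sT]]; first by rewrite rT/=.
  rewrite chiE sT ifT//; apply: le_trans le.
  apply: radon_le_itv.
  by move=> u /=; rewrite !in_itv/= => /andP[-> /=] /lt_le_trans; apply.
have [tau [rtau tauT le nlt']] := counting_atom (HN w) rT nlt.
exists tau; split=> [|s /andP[rs sT]]; first by rewrite rtau ltW.
rewrite chiE; have [stau|taus] := leP s tau.
  rewrite ifT//; apply: le_trans le.
  apply: radon_le_itv.
  by move=> u /=; rewrite !in_itv/= => /andP[-> /=] /lt_le_trans; apply.
rewrite ifF//; apply/negbTE; rewrite -ltNge; apply: lt_le_trans nlt' _.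
apply: radon_le_itv.
by move=> u /=; rewrite !in_itv/= => /andP[-> /=] /le_lt_trans; apply.
Qed.

(** The chain rule up to the threshold. Campbell's formula wants left-open intervals, so a possible
    point at [r] is set apart; its jump is what turns [M] into [M + J]. *)
Lemma chain_rule_truncated r M A T n w : controlled r M A -> A w -> (r <= T)%R ->
  \int[leb]_(s in `]r, T]) (chi r n (s, w) * (4 * V s w ^+ 3 * D s w))%:E <=
  ((M + J) ^+ 4)%:E + \int[N w]_(s in `]r, T]) (chi r n (s, w) * g s w)%:E.
Proof.
move=> HA' Aw rT; have [e [/andP[re eT] chie]] := chi_threshold n w rT.
have cut (mu : {measure set (measurableTypeR R) -> \bar R}) (f : R -> R) :
    \int[mu]_(s in `]r, T]) (chi r n (s, w) * f s)%:E = \int[mu]_(s in `]r, e]) (f s)%:E.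
  have -> : `]r, e]%classic = `]r, T] `&` `]-oo, e] :> set R.
    apply/seteqP; split=> u /=; rewrite !in_itv/=.
      by move=> /andP[-> ue]; rewrite ue (le_trans ue eT).
    by move=> [/andP[-> _] ->].
  rewrite integral_mkcondr; apply: eq_integral => s; rewrite inE/= in_itv/= => sT.
  rewrite chie// patchE; have [se|es] := leP s e.
    by rewrite mem_set ?mul1r//= in_itv.
  by rewrite memNset ?mul0r//= in_itv/= leNgt es.
rewrite !cut.
have chain : \int[leb]_(s in `]r, e]) (4 * V s w ^+ 3 * D s w)%:E + (V e w ^+ 4)%:E =
    (V r w ^+ 4)%:E + \int[N w]_(s in `[r, e[) (g s w)%:E :=
  chain_rule al0 (HN w) (fun i => controlled_fin HA' i Aw) re wt0.
have le1 : \int[leb]_(s in `]r, e]) (4 * V s w ^+ 3 * D s w)%:E <=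
    (V r w ^+ 4)%:E + \int[N w]_(s in `[r, e[) (g s w)%:E.
  by rewrite -chain leeDl// lee_fin exprn_ge0.
apply: le_trans le1 _.
have mgw : measurable_fun setT (fun s : R => (g s w)%:E).
  by apply/measurable_EFinP; exact: (predictable_path w mg).
apply: (@le_trans _ _ ((V r w ^+ 4)%:E +
   \int[N w]_(s in [set r] `|` `]r, e]) (g s w)%:E)).
  rewrite leeD2l//; apply: ge0_subset_integral => //.
  - by apply: measurableU => //; exact: measurable_itv.
  - exact: measurable_funTS.
  - by move=> u _; rewrite lee_fin.
  - move=> u /=; rewrite !in_itv/= => /andP[].
    by rewrite le_eqVlt => /predU1P[->|ru ue]; [left|right; rewrite ru ltW].
rewrite ge0_integral_setU//; last 3 first.
- exact: measurable_funTS.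
- by move=> u _; rewrite lee_fin.
- by apply/disj_set2P/seteqP; split=> // u [] /= ->; rewrite in_itv/= ltxx.
have -> : \int[N w]_(x in [set r]) (g x w)%:E = (g r w)%:E * N w [set r].
  rewrite (eq_integral (fun=> (g r w)%:E)); last by move=> u; rewrite inE => ->.
  by rewrite integral_cst//; exact: measurable_set1.
rewrite addeA; apply: leeD => //.
apply: (@le_trans _ _ ((V r w ^+ 4)%:E + (g r w)%:E)).
  rewrite leeD2l// -[leRHS]mule1; apply: lee_wpmul2l; first by rewrite lee_fin.
  exact: (HN w).2.
rewrite -EFinD lee_fin /g addrC subrK.
have VM : (V r w <= M)%R := controlled_le HA' Aw.
rewrite lerXn2r ?nnegrE ?addr_ge0// ?lerD2r//.
exact: le_trans VM.
Qed.

(** In the mean, jumps integrated against [N] may be integrated against the intensity, and by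
    [drift_bound] the decay term exceeds them by a multiple of V^4, up to a constant. The resulting
    [C] is the same for all [r], [M], [A] and [T]. *)
Lemma moment_integral : exists2 C : R, (0 <= C)%R &
  forall r M A T, controlled r M A -> (0 <= M)%R -> (r <= T)%R ->
  \int[P]_(w in A) \int[leb]_(s in `]r, T]) (V s w ^+ 4)%:E <=
  (C * ((M + J) ^+ 4 + (T - r)))%:E.
Proof.
have [k [C [k0 C0 drift]]] := drift_bound B0 c0 J0 lo0 hi0 BJ.
exists (k^-1 * (1 + C))%R; first by rewrite mulr_ge0 ?invr_ge0 ?addr_ge0// ltW.
move=> r M A T HA' M0 rT.
have FA := controlled_past HA'; have mA := past_set_measurable HF FA.
have lebE : leb `]r, T]%classic = (T - r)%:E.
  rewrite lebesgue_measure_itv/= lte_fin.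
  by move: rT; rewrite le_eqVlt => /predU1P[->|->]; rewrite ?ltxx ?subrr.
have mintN (H : predictable_space F -> \bar R) : (forall p, 0 <= H p) ->
    measurable_fun setT H ->
    measurable_fun A (fun w => \int[N w]_(s in `]r, T]) H (s, w)).
  move=> H0 mH; apply: measurable_funTS; apply: (past_measurable HF (t := T)).
  exact: past_integral_count.
have mintL (H : predictable_space F -> \bar R) : (forall p, 0 <= H p) ->
    measurable_fun setT H ->
    measurable_fun A (fun w => \int[leb]_(s in `]r, T]) H (s, w)).
  move=> H0 mH; apply: measurable_funTS; apply: (past_measurable HF (t := T)).
  exact: past_integral_lebesgue.
have mpath (f : predictable_space F -> R) w : measurable_fun setT f ->
    measurable_fun `]r, T] (fun s : R => (f (s, w))%:E).
  by move=> mf; apply/measurable_EFinP; apply: measurable_funTS; exact: predictable_path.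
have bound n : \int[P]_(w in A) \int[leb]_(s in `]r, T]) (chi r n (s, w) * V s w ^+ 4)%:E <=
    (k^-1 * (1 + C) * ((M + J) ^+ 4 + (T - r)))%:E.
  pose I1 w := \int[leb]_(s in `]r, T]) (chi r n (s, w) * g s w * lam s w)%:E.
  pose I2 w := \int[leb]_(s in `]r, T]) (chi r n (s, w) * V s w ^+ 4)%:E.
  pose I4 w := \int[N w]_(s in `]r, T]) (chi r n (s, w) * g s w)%:E.
  have chi0 p : (0 <= chi r n p)%R by have /andP[] := chi01 r n p.
  have mcg : measurable_fun setT (fun p : predictable_space F => chi r n p * g p.1 p.2)%R.
    exact: measurable_funM.
  have mcgl : measurable_fun setT
      (fun p : predictable_space F => chi r n p * g p.1 p.2 * lam p.1 p.2)%R.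
    exact: measurable_funM.
  have mcV : measurable_fun setT (fun p : predictable_space F => chi r n p * V p.1 p.2 ^+ 4)%R.
    by apply: measurable_funM => //; exact: measurable_funX.
  have mI1 : measurable_fun A I1.
    apply: (mintL (fun p => (chi r n p * g p.1 p.2 * lam p.1 p.2)%:E)).
      by move=> p; rewrite lee_fin mulr_ge0// mulr_ge0.
    exact/measurable_EFinP.
  have mI2 : measurable_fun A I2.
    apply: (mintL (fun p => (chi r n p * V p.1 p.2 ^+ 4)%:E)).
      by move=> p; rewrite lee_fin mulr_ge0// exprn_ge0.
    exact/measurable_EFinP.
  have mI4 : measurable_fun A I4.
    apply: (mintN (fun p => (chi r n p * g p.1 p.2)%:E)).
      by move=> p; rewrite lee_fin mulr_ge0.
    exact/measurable_EFinP.
  have I10 w : 0 <= I1 w by apply: integral_ge0 => s _; rewrite lee_fin !mulr_ge0.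
  have I20 w : 0 <= I2 w by apply: integral_ge0 => s _; rewrite lee_fin mulr_ge0// exprn_ge0.
  have I40 w : 0 <= I4 w by apply: integral_ge0 => s _; rewrite lee_fin mulr_ge0.
  pose K : R := ((M + J) ^+ 4 + C * (T - r))%R.
  have K0 : (0 <= K)%R by rewrite addr_ge0 ?exprn_ge0 ?addr_ge0// mulr_ge0// subr_ge0.
  have alg (x : \bar R) (a b : R) : a%:E + x + b%:E = x + (a + b)%:E.
    by rewrite EFinD addeA (addeC x).
  have path w : A w -> I1 w + k%:E * I2 w <= I4 w + K%:E.
    move=> Aw.
    have I3le := chain_rule_truncated n HA' Aw rT.
    apply: (@le_trans _ _ (\int[leb]_(s in `]r, T]) (chi r n (s, w) * (4 * V s w ^+ 3 * D s w))%:E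
        + (C * (T - r))%:E)); last first.
      apply: le_trans (leeD I3le (lexx _)) _.
      by rewrite alg.
    have mD : measurable_fun setT (fun p : predictable_space F => D p.1 p.2).
      exact: predictable_potential.
    have m3 : measurable_fun setT (fun p : predictable_space F =>
        chi r n p * (4 * V p.1 p.2 ^+ 3 * D p.1 p.2))%R.
      apply: measurable_funM => //; apply: measurable_funM => //.
      by apply: measurable_funM => //; exact: measurable_funX.
    have cV0 s : (0 <= chi r n (s, w) * V s w ^+ 4)%R by rewrite mulr_ge0// exprn_ge0.
    have c30 s : (0 <= chi r n (s, w) * (4 * V s w ^+ 3 * D s w))%R.
      by rewrite mulr_ge0// mulr_ge0// mulr_ge0// exprn_ge0.
    have cgl0 s : (0 <= chi r n (s, w) * g s w * lam s w)%R by rewrite !mulr_ge0.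
    have kc s : `]r, T]%classic s -> 0 <= k%:E * (chi r n (s, w) * V s w ^+ 4)%:E.
      by move=> _; rewrite mule_ge0 ?lee_fin// ltW.
    have mkc : measurable_fun `]r, T] (fun s => k%:E * (chi r n (s, w) * V s w ^+ 4)%:E).
      by apply: measurable_funeM; exact: (mpath _ w mcV).
    have cV s : `]r, T]%classic s -> 0 <= (chi r n (s, w) * V s w ^+ 4)%:E.
      by move=> _; rewrite lee_fin.
    have cgl s : `]r, T]%classic s -> 0 <= (chi r n (s, w) * g s w * lam s w)%:E.
      by move=> _; rewrite lee_fin.
    have -> : k%:E * I2 w = \int[leb]_(s in `]r, T]) (k%:E * (chi r n (s, w) * V s w ^+ 4)%:E).
      by rewrite ge0_integralZl_EFin//; [exact: (mpath _ w mcV)|exact: ltW].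
    have -> : I1 w + \int[leb]_(s in `]r, T]) (k%:E * (chi r n (s, w) * V s w ^+ 4)%:E) =
        \int[leb]_(s in `]r, T]) ((chi r n (s, w) * g s w * lam s w)%:E +
          k%:E * (chi r n (s, w) * V s w ^+ 4)%:E).
      by rewrite ge0_integralD//; exact: (mpath _ w mcgl).
    have -> : (C * (T - r))%:E = \int[leb]_(s in `]r, T]) (cst C%:E s).
      by rewrite integral_cst// EFinM -lebE.
    rewrite -ge0_integralD//=; try exact: (mpath _ w m3);
      try by (move=> s _; rewrite lee_fin).
    apply: ge0_le_integral => //.
    - by move=> s _; rewrite adde_ge0// lee_fin ?mulr_ge0// ?exprn_ge0// ltW.
    - apply: emeasurable_funD; first exact: (mpath _ w mcgl).
      by apply: measurable_funeM; exact: (mpath _ w mcV).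
    - by apply: emeasurable_funD => //; exact: (mpath _ w m3).
    move=> s /=; rewrite in_itv/= => /andP[rs sT].
    rewrite -EFinM -!EFinD lee_fin.
    have lams := controlled_lam HA' Aw (ltW rs).
    have /andP[DV1 DV2] := potential_mul (N w) s wt0 alb.
    have dr := drift (V s w) (D s w) (V0 s w).
    have {}dr := dr ltac:(by apply/andP; split).
    have gl : (g s w * lam s w <= g s w * (B * (c + D s w)))%R by exact: ler_wpM2l.
    have : (g s w * lam s w + k * V s w ^+ 4 <= 4 * V s w ^+ 3 * D s w + C)%R.
      by apply: le_trans dr; rewrite lerD2r.
    rewrite chiE; case: ifP => _; last by rewrite !mul0r mulr0 addr0 add0r.
    by rewrite !mul1r.
  have I14 : \int[P]_(w in A) I4 w = \int[P]_(w in A) I1 w.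
    rewrite /I4 (campbell HF HA lam0 mlam Hint (H := fun p => (chi r n p * g p.1 p.2)%:E) rT FA) //.
    - exact: (controlled_count HA' rT).
    - by move=> w Aw; exact: (controlled_lam_lty HA' Aw rT).
    - by move=> p; rewrite lee_fin mulr_ge0.
    - exact/measurable_EFinP.
  (* Where [chi] is not 0, [V] is at most [M + J * n], so the integrand is bounded and
     [controlled_count] gives a finite mean. The common term can then be cancelled. *)
  have I4fin : \int[P]_(w in A) I4 w < +oo.
    pose G : R := ((M + J * n%:R + J) ^+ 4)%R.
    have G0 : (0 <= G)%R by rewrite exprn_ge0// !addr_ge0// mulr_ge0.
    apply: (@le_lt_trans _ _ (\int[P]_(w in A) (G%:E * N w `]r, T]%classic))).
      apply: ge0_le_integral => //.
      - by apply: measurable_funeM; apply: measurable_funTS; exact: (measurable_count HF HA).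
      move=> w Aw; apply: (@le_trans _ _ (\int[N w]_(s in `]r, T]) (cst G%:E s))).
        apply: ge0_le_integral => //.
        - by move=> s _; rewrite lee_fin mulr_ge0.
        - exact: (mpath _ w mcg).
        move=> s /=; rewrite in_itv/= => /andP[rs sT]; rewrite lee_fin chiE.
        case: ifPn => [Nn|_]; last by rewrite mul0r.
        rewrite mul1r /g lerBlDr; apply: (@le_trans _ _ G); last by rewrite lerDl exprn_ge0.
        rewrite lerXn2r ?nnegrE ?addr_ge0 ?mulr_ge0// lerD2r.
        apply: le_trans (potential_le (r := r) al0 _ (ltW rs) wt0) _.
          by move=> i; exact: (controlled_fin HA').
        apply: lerD; first exact: (controlled_le HA').
        by apply: ler_wpM2l => //; rewrite -lee_fin fineK ?radon_co_fin.
      by rewrite integral_cst.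
    rewrite ge0_integralZl_EFin//; last first.
      by apply: measurable_funTS; exact: (measurable_count HF HA).
    by rewrite lte_mul_pinfty// (controlled_count HA' rT).
  have tot : \int[P]_(w in A) I1 w + k%:E * \int[P]_(w in A) I2 w <=
      \int[P]_(w in A) I1 w + K%:E.
    rewrite -{2}I14 -ge0_integralZl_EFin//; last exact: ltW.
    rewrite -ge0_integralD//; last 2 first.
    - by move=> w _; rewrite mule_ge0// lee_fin ltW.
    - exact: measurable_funeM.
    apply: (@le_trans _ _ (\int[P]_(w in A) (I4 w + cst K%:E w))).
      apply: ge0_le_integral => //.
      - by move=> w _; rewrite adde_ge0// mule_ge0// lee_fin ltW.
      - by apply: emeasurable_funD => //; exact: measurable_funeM.
      - exact: emeasurable_funD.
    rewrite ge0_integralD//.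
    rewrite leeD2l// integral_cst// -[leRHS]mule1; apply: lee_wpmul2l; first by rewrite lee_fin.
    exact: probability_le1.
  have fI1 : \int[P]_(w in A) I1 w \is a fin_num.
    by rewrite ge0_fin_numE -?I14//; exact: integral_ge0.
  move: tot; rewrite leeD2lE// => tot.
  rewrite -/I2 -(mul1e (\int[P]_(w in A) I2 w)).
  rewrite (_ : 1 = (k^-1 * k)%:E); last by rewrite mulVf ?gt_eqF.
  rewrite EFinM -muleA -mulrA EFinM; apply: lee_wpmul2l.
    by rewrite lee_fin invr_ge0 ltW.
  apply: le_trans tot _; rewrite lee_fin /K mulrDl mul1r mulrDr.
  have : (0 <= C * (M + J) ^+ 4)%R by rewrite mulr_ge0 ?exprn_ge0 ?addr_ge0.
  have : (0 <= T - r)%R by rewrite subr_ge0.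
  lra.
(* The bound does not depend on [n], and the cuts increase to 1 at every time after [r], so monotone
   convergence removes them. *)
pose f n (p : predictable_space F) : \bar R := (chi r n p * V p.1 p.2 ^+ 4)%:E.
have [_ _ _ Phil] := @nested_integral_functional R disp Omega P F HF r T A
   (fun=> leb) (fun _ _ => 1%R) mA (fun=> lebesgue_itv_lty r T) (fun _ _ _ => measurable_cst _)
   (fun _ _ => ler01) (@measurable_cst _ _ _ _ _ _).
have f0 n p : 0 <= f n p.
  by rewrite lee_fin mulr_ge0 ?exprn_ge0//; have /andP[] := chi01 r n p.
have mf n : measurable_fun setT (f n).
  apply/measurable_EFinP; apply: measurable_funM => //; exact: measurable_funX.
have ndf p : nondecreasing_seq (f ^~ p).
  move=> i j ij; rewrite lee_fin ler_wpM2r ?exprn_ge0//.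
  rewrite /chi; case: ifP => [le|_]; last by case: ifP.
  by rewrite ifT//; apply: le_trans le _; rewrite lee_fin ler_nat.
have lf s w : (r < s)%R -> limn (f ^~ (s, w)) = (V s w ^+ 4)%:E.
  move=> rs; apply/cvg_lim => //; apply: cvg_near_cst; near=> n.
  rewrite /f chiE ifT ?mul1r//.
  rewrite -(fineK (radon_co_fin (N w) r s)) lee_fin; near: n; exact: nbhs_infty_ger.
have := Phil f f0 mf ndf.
rewrite (_ : \int[P]_(w in A) _ =
    \int[P]_(w in A) \int[leb]_(s in `]r, T]) (V s w ^+ 4)%:E); last first.
  apply: eq_integral => w _; apply: eq_integral => s; rewrite inE/= in_itv/= => /andP[rs _].
  by rewrite lf// mule1.
move=> ->; apply: lime_le.
  apply: ereal_nondecreasing_is_cvgn => i j ij; apply: ge0_le_integral => //.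
  - by move=> w _; apply: integral_ge0 => s _; rewrite mule1.
  - by under eq_fun do under eq_integral do rewrite mule1; exact: mintL.
  - by under eq_fun do under eq_integral do rewrite mule1; exact: mintL.
  - move=> w Aw; apply: ge0_le_integral => //.
    + by move=> s _; rewrite mule1.
    + rewrite (_ : (fun x => _) = fun x : R => f i (x, w)).
        by apply: measurable_funTS; exact: (predictable_path w (mf i)).
      by apply/funext => x; rewrite mule1.
    + rewrite (_ : (fun x => _) = fun x : R => f j (x, w)).
        by apply: measurable_funTS; exact: (predictable_path w (mf j)).
      by apply/funext => x; rewrite mule1.
    + by move=> s _; rewrite !mule1; exact: ndf.
near=> n; under eq_integral do under eq_integral do rewrite mule1.
exact: bound.
Unshelve. all: by end_near.
Qed.

(** In unit time [V] cannot fall below [decay hi 1] times its value, so its fourth power at the left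
    end of a unit interval is at most a constant times the integral over that interval. *)
Lemma moment_sum : exists2 C : R, (0 <= C)%R &
  forall r M A n, controlled r M A -> (0 <= M)%R ->
  \sum_(i < n) \int[P]_(w in A) (V (r + i%:R) w ^+ 4)%:E <=
  (C * ((M + J) ^+ 4 + n%:R))%:E.
Proof.
have [C C0 HC] := moment_integral.
pose q : R := (decay hi 1 ^+ 4)%R.
have d0 : (0 < decay hi 1)%R by exact: expR_gt0.
have q0 : (0 < q)%R by rewrite exprn_gt0.
exists (q^-1 * C)%R; first by rewrite mulr_ge0// invr_ge0 ltW.
move=> r M A n HA' M0; have mA := past_set_measurable HF (controlled_past HA').
have V40 t w : 0 <= (V t w ^+ 4)%:E by rewrite lee_fin exprn_ge0.
have mVt t : measurable_fun A (fun w => (V t w ^+ 4)%:E).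
  apply/measurable_EFinP; apply: measurable_funTS; apply: measurable_funX.
  apply: (past_measurable HF (t := t) (f := V t)); exact: (predictable_at (t := t) HF mV).
have mVw w (I : set R) : measurable_fun I (fun s => (V s w ^+ 4)%:E).
  apply/measurable_EFinP; apply: measurable_funTS; apply: measurable_funX.
  exact: (predictable_path w mV).
have mI (s t : R) : measurable_fun A (fun w => \int[leb]_(u in `]s, t]) (V u w ^+ 4)%:E).
  apply: measurable_funTS; apply: (past_measurable HF (t := t)).
  apply: (past_integral_lebesgue HF _ (H := fun p => (V p.1 p.2 ^+ 4)%:E)) => //.
  by apply/measurable_EFinP; exact: measurable_funX.
have I0 s t w : 0 <= \int[leb]_(u in `]s, t]) (V u w ^+ 4)%:E.
  exact: integral_ge0.
have rn : (r <= r + n%:R)%R by rewrite lerDl.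
suff key : q%:E * (\sum_(i < n) \int[P]_(w in A) (V (r + i%:R) w ^+ 4)%:E) <=
    \int[P]_(w in A) \int[leb]_(s in `]r, (r + n%:R)%R]) (V s w ^+ 4)%:E.
  have := le_trans key (HC _ _ _ _ HA' M0 rn).
  rewrite addrAC subrr add0r => {}key.
  rewrite -mulrA EFinM lee_pdivlMl//.
elim: n {rn} => [|n IHn].
  by rewrite big_ord0 mule0; apply: integral_ge0.
have S0 : 0 <= \sum_(i < n) \int[P]_(w in A) (V (r + i%:R) w ^+ 4)%:E.
  by apply: sume_ge0 => i _; exact: integral_ge0.
have Sn0 : 0 <= \int[P]_(w in A) (V (r + n%:R) w ^+ 4)%:E by exact: integral_ge0.
rewrite big_ord_recr/= (ge0_muleDr _ S0 Sn0).
have -> : \int[P]_(w in A) \int[leb]_(s in `]r, (r + n.+1%:R)%R]) (V s w ^+ 4)%:E =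
  \int[P]_(w in A) (\int[leb]_(s in `]r, (r + n%:R)%R]) (V s w ^+ 4)%:E +
    \int[leb]_(s in `](r + n%:R)%R, (r + n.+1%:R)%R]) (V s w ^+ 4)%:E).
  apply: eq_integral => w _; apply: ge0_integral_itv_cat => //; rewrite bnd_simp ?lerDl//.
  by rewrite lerD2l ler_nat.
rewrite ge0_integralD//; apply: leeD; first exact: IHn.
have -> : q%:E * \int[P]_(w in A) (V (r + n%:R) w ^+ 4)%:E =
    \int[P]_(w in A) (q%:E * (V (r + n%:R) w ^+ 4)%:E).
  by rewrite ge0_integralZl_EFin//; exact: ltW.
apply: ge0_le_integral => //.
- by move=> w _; rewrite mule_ge0// lee_fin ltW.
- exact: measurable_funeM.
move=> w Aw; rewrite -EFinM.
have -> : (q * V (r + n%:R) w ^+ 4)%:E =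
    \int[leb]_(s in `](r + n%:R)%R, (r + n.+1%:R)%R]) (cst (q * V (r + n%:R) w ^+ 4)%:E s).
  rewrite integral_cst//= lebesgue_measure_itv/= lte_fin ltrD2l ltr_nat ltnSn.
  rewrite -EFinB -natr1 (_ : (r + (n%:R + 1) - (r + n%:R))%R = 1%R) ?mule1//; ring.
apply: ge0_le_integral => //.
- by move=> s _; rewrite lee_fin mulr_ge0 ?exprn_ge0// ltW.
- exact: mVw.
move=> s /=; rewrite in_itv/= => /andP[ns sn].
rewrite lee_fin /q -exprMn lerXn2r ?nnegrE ?mulr_ge0//; first exact: ltW.
apply: le_trans (potential_decay (r := r) al0 _ (ltW ns) wt0 (hi := hi) _).
- rewrite ler_wpM2r//; apply: decay_anti => //.
  by rewrite lerBlDr (le_trans sn)// -natr1 addrA addrC.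
- by move=> i; exact: (controlled_fin HA').
- by move=> i; have /andP[] := alb i.
Qed.

End moments.

(** * Maximal inequality over unit steps on a controlled event *)

Section martingale_maximal.
Variable h : R.
Hypothesis h0 : (0 <= h)%R.

Let q : R := (decay hi 1)^-1%R.

Let q1 : (1 <= q)%R.
Proof. by rewrite /q invf_ge1 ?expR_gt0//; exact: decay_le1. Qed.

Section controlled_event.
Variables (r M : R) (A : set Omega).
Hypothesis HC : controlled r M A.

Let rfin w (Aw : A w) i : conv (decay (al i)) r (N w) < +oo.
Proof. exact: (controlled_fin HC). Qed.

Lemma potential_backward w s t : A w -> (s <= t <= s + 1)%R ->
  (V s w <= q * V t w)%R.
Proof.
move=> Aw /andP[st ts].
rewrite /q mulrC ler_pdivlMr ?expR_gt0// mulrC.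
apply: le_trans (potential_decay al0 (rfin Aw) st wt0 (hi := hi) _).
  rewrite ler_wpM2r//; apply: decay_anti => //; by rewrite lerBlDl.
by move=> i; have /andP[] := alb i.
Qed.

(** Every point of [[t, t + 1[] still weighs at least [decay hi 1] in the convolution of rate
    [al j0] at time [t + 1]. The summand 1 is for a point at [t + 1] itself. *)
Lemma count_le_potential w t : A w ->
  (fine (N w `]t, (t + 1)%R]%classic) <= 1 + q * (wt j0)^-1 * V (t + 1) w)%R.
Proof.
move=> Aw; have tt1 : (t <= t + 1)%R by rewrite lerDl.
have Y : (decay hi 1 * (fine (N w `[t, (t + 1)%R[%classic)) <= (wt j0)^-1 * V (t + 1) w)%R.
  apply: (@le_trans _ _ (fine (conv (decay (al j0)) (t + 1) (N w)))).
    rewrite -lee_fin EFinM !fineK ?radon_co_fin//; last exact: (conv_decay_fin al0 (rfin Aw)).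
    apply: (le_trans _ (conv_decay_count (N w) (ltW (al0 j0)) tt1)).
    apply: lee_wpmul2r => //; rewrite lee_fin addrAC subrr add0r /decay ler_expR.
    by rewrite !mulr1 lerN2; have /andP[] := alb j0.
  rewrite mulrC ler_pdivlMr// mulrC /V /potential (bigD1 j0)//= lerDl.
  apply: sumr_ge0 => i _; rewrite mulr_ge0// fine_ge0// conv_decay_ge0//.
have le1 : (fine (N w `]t, (t + 1)%R]%classic) <= 1 + fine (N w `[t, (t + 1)%R[%classic))%R.
  rewrite -lee_fin EFinD !fineK ?radon_co_fin ?radon_itv_fin// addeC.
  apply: (@le_trans _ _ (N w (`[t, (t + 1)%R[ `|` [set (t + 1)%R]))).
    apply: radon_le; [exact: measurable_itv| |].
      by apply: measurableU => //; exact: measurable_itv.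
    move=> u /=; rewrite !in_itv/= => /andP[tu]; rewrite le_eqVlt => /predU1P[->|ut].
      by right.
    by left; rewrite ltW.
  apply: le_trans (measureU2 _ _ _) _ => //.
  by apply: leeD => //; exact: (HN w).2.
apply: le_trans le1 _; rewrite lerD2l -mulrA /q mulrC ler_pdivlMr ?expR_gt0// mulrC.
exact: Y.
Qed.

Let g1 : R := (1 + q * (wt j0)^-1)%R.
Let g2 : R := (B * (c + hi * q))%R.
(** On a unit interval, with [V] taken at its right end, a regressor is at most [h * q * (1 + V)],
    the number of points at most [g1 * (1 + V)] and the intensity at most [g2 * (1 + V)]. Hence both
    integrals over the interval are at most this constant times the square of [1 + V]. *)
Definition increment_const : R := (h * q * (g1 + g2))%R.

Let q0 : (0 <= q)%R.
Proof. exact: le_trans ler01 q1. Qed.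

Let g10 : (0 <= g1)%R.
Proof. by apply: addr_ge0 => //; apply: mulr_ge0 => //; rewrite invr_ge0 ltW. Qed.

Let g20 : (0 <= g2)%R.
Proof. by rewrite mulr_ge0// addr_ge0// mulr_ge0. Qed.

Variables (K : nat) (K0 : (0 < K)%N) (H : 'I_K -> predictable_space F -> R).
Hypothesis H0 : forall k p, (0 <= H k p)%R.
Hypothesis mH : forall k, measurable_fun setT (H k).
Hypothesis HV : forall k w s, A w -> (r < s)%R -> (H k (s, w) <= h * (1 + V s w))%R.

Definition stoch_int k (a b : R) (w : Omega) : \bar R := \int[N w]_(s in `]a, b]) (H k (s, w))%:E.
Definition comp_int k (a b : R) (w : Omega) : \bar R :=
  \int[leb]_(s in `]a, b]) (H k (s, w) * lam s w)%:E.

Lemma measurable_stoch_int k a b :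
  measurable_fun setT (fun w : past F b => stoch_int k a b w).
Proof.
apply: (past_integral_count HF HA _ (H := fun p => (H k p)%:E)).
- by move=> p; rewrite lee_fin.
- exact/measurable_EFinP.
Qed.

Lemma measurable_comp_int k a b :
  measurable_fun setT (fun w : past F b => comp_int k a b w).
Proof.
apply: (past_integral_lebesgue HF _ (H := fun p => (H k p * lam p.1 p.2)%:E)).
- by move=> p; rewrite lee_fin mulr_ge0.
- by apply/measurable_EFinP; exact: measurable_funM.
Qed.

Lemma stoch_int_ge0 k a b w : 0 <= stoch_int k a b w.
Proof. by apply: integral_ge0 => s _; rewrite lee_fin. Qed.

Lemma comp_int_ge0 k a b w : 0 <= comp_int k a b w.
Proof. by apply: integral_ge0 => s _; rewrite lee_fin mulr_ge0. Qed.

Let HVt k w s t : A w -> (r <= t)%R -> (t < s <= t + 1)%R ->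
  (H k (s, w) <= h * q * (1 + V (t + 1) w))%R.
Proof.
move=> Aw rt /andP[ts st]; apply: le_trans (HV k Aw (le_lt_trans rt ts)) _.
rewrite -mulrA; apply: ler_wpM2l => //; rewrite mulrDr mulr1; apply: lerD => //.
by apply: potential_backward => //; rewrite st lerD2r ltW.
Qed.

Let lamt w s t : A w -> (r <= t)%R -> (t < s <= t + 1)%R ->
  (lam s w <= g2 * (1 + V (t + 1) w))%R.
Proof.
move=> Aw rt /andP[ts st].
apply: le_trans (controlled_lam HC Aw (le_trans rt (ltW ts))) _.
rewrite /g2 -mulrA; apply: ler_wpM2l => //.
rewrite mulrDl; apply: lerD; first by rewrite -[leLHS]mulr1 ler_wpM2l// lerDl.
apply: le_trans (DV _ _) _; rewrite -mulrA; apply: ler_wpM2l => //.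
apply: (@le_trans _ _ (q * V (t + 1) w)%R).
  by apply: potential_backward => //; rewrite st lerD2r ltW.
by rewrite ler_wpM2l// lerDr.
Qed.

Let mHs k w (I : set R) : measurable_fun I (fun s : R => (H k (s, w))%:E).
Proof.
by apply/measurable_EFinP; apply: measurable_funTS; exact: (predictable_path w (mH k)).
Qed.

Let mHls k w (I : set R) : measurable_fun I (fun s : R => (H k (s, w) * lam s w)%:E).
Proof.
apply/measurable_EFinP; apply: measurable_funTS.
by apply: measurable_funM; [exact: (predictable_path w (mH k))|exact: (predictable_path w mlam)].
Qed.

Lemma stoch_int_le k w t : A w -> (r <= t)%R ->
  stoch_int k t (t + 1) w <= (h * q * g1 * (1 + V (t + 1) w) ^+ 2)%:E.
Proof.
move=> Aw rt; apply: (@le_trans _ _ (\int[N w]_(s in `]t, (t + 1)%R])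
    (cst (h * q * (1 + V (t + 1) w))%:E s))).
  apply: ge0_le_integral => //.
  - by move=> s _; rewrite lee_fin.
  - exact: mHs.
  - by move=> s /=; rewrite in_itv/= => ts; rewrite lee_fin; exact: HVt.
have -> : \int[N w]_(s in `]t, (t + 1)%R]) (cst (h * q * (1 + V (t + 1) w))%:E s) =
    (h * q * (1 + V (t + 1) w))%:E * N w `]t, (t + 1)%R]%classic by rewrite integral_cst.
rewrite -(fineK (radon_itv_fin (N w) t (t + 1))) -EFinM lee_fin.
have -> : (h * q * g1 * (1 + V (t + 1) w) ^+ 2 =
    h * q * (1 + V (t + 1) w) * (g1 * (1 + V (t + 1) w)))%R by ring.
apply: ler_wpM2l; first by rewrite !mulr_ge0// addr_ge0.
apply: le_trans (count_le_potential t Aw) _.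
rewrite /g1 mulrDl mul1r; apply: lerD; first by rewrite lerDl.
by rewrite ler_wpM2l ?lerDr// mulr_ge0// invr_ge0 ltW.
Qed.

Lemma comp_int_le k w t : A w -> (r <= t)%R ->
  comp_int k t (t + 1) w <= (h * q * g2 * (1 + V (t + 1) w) ^+ 2)%:E.
Proof.
move=> Aw rt; apply: (@le_trans _ _ (\int[leb]_(s in `]t, (t + 1)%R])
    (cst (h * q * g2 * (1 + V (t + 1) w) ^+ 2)%:E s))).
  apply: ge0_le_integral => //.
  - by move=> s _; rewrite lee_fin mulr_ge0.
  - exact: mHls.
  - move=> s /=; rewrite in_itv/= => ts; rewrite lee_fin.
    have -> : (h * q * g2 * (1 + V (t + 1) w) ^+ 2 =
      h * q * (1 + V (t + 1) w) * (g2 * (1 + V (t + 1) w)))%R by ring.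
    by apply: ler_pM => //; [exact: HVt|exact: lamt].
rewrite integral_cst//= lebesgue_measure_itv/= lte_fin ltrDl ltr01.
by rewrite -EFinB addrAC subrr add0r mule1.
Qed.

Lemma stoch_int_add k w (a b d : R) : (a <= b <= d)%R ->
  stoch_int k a d w = stoch_int k a b w + stoch_int k b d w.
Proof.
move=> /andP[ab bd]; apply: ge0_integral_itv_cat => // s.
by rewrite lee_fin.
Qed.

Lemma comp_int_add k w (a b d : R) : (a <= b <= d)%R ->
  comp_int k a d w = comp_int k a b w + comp_int k b d w.
Proof.
move=> /andP[ab bd]; apply: ge0_integral_itv_cat => // s.
by rewrite lee_fin mulr_ge0.
Qed.

Lemma int_fin k w n : A w ->
  stoch_int k r (r + n%:R) w \is a fin_num /\ comp_int k r (r + n%:R) w \is a fin_num.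
Proof.
move=> Aw; elim: n => [|n [IH1 IH2]].
  by rewrite addr0 /stoch_int /comp_int set_itvoc0 !integral_set0.
have rn : (r <= r + n%:R <= r + n.+1%:R)%R by rewrite lerDl ler0n lerD2l ler_nat leqnSn.
have rn' : (r <= r + n%:R)%R by rewrite lerDl.
rewrite (stoch_int_add _ _ rn) (comp_int_add _ _ rn).
have -> : (r + n.+1%:R = r + n%:R + 1)%R by rewrite -natr1 addrA.
split; rewrite fin_numD ?IH1 ?IH2/= ge0_fin_numE ?stoch_int_ge0 ?comp_int_ge0//=.
  exact: le_lt_trans (stoch_int_le _ Aw rn') (ltry _).
exact: le_lt_trans (comp_int_le _ Aw rn') (ltry _).
Qed.

Let tt1 (t : R) : (t <= t + 1)%R. Proof. by rewrite lerDl. Qed.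

Let mV (t : R) : measurable_fun setT (V t).
Proof.
exact: (past_measurable HF (predictable_at (t := t) HF (predictable_potential HF HA al wt))).
Qed.

Let mA : measurable A.
Proof. exact: (past_set_measurable HF (controlled_past HC)). Qed.

(** Unit steps reduce this to [softmax_maximal]: the weights of a step are formed from the steps
    before it, so their product with its increment has mean 0. The increments are of order
    [(1 + V) ^+ 2], and the factor 8 is that of [pow4_le]. *)
Lemma martingale_maximal (n : nat) (beta S : R) : (0 < beta)%R ->
  \sum_(i < n) \int[P]_(w in A) (1 + V (r + i.+1%:R) w ^+ 4)%:E <= S%:E ->
  \int[P]_(w in A) (\big[Num.max/0]_(k < K)
    `|fine (stoch_int k r (r + n%:R) w) - fine (comp_int k r (r + n%:R) w)|)%:E <=
  (ln (2 * K)%:R / beta + 4 * beta * (increment_const ^+ 2 * 8 * S))%:E.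
Proof.
move=> b0 HS.
pose t (i : nat) := (r + i%:R)%R.
have rt i : (r <= t i)%R by rewrite lerDl.
have tS i : t i.+1 = (t i + 1)%R by rewrite /t -natr1 addrA.
pose s k i w := fine (stoch_int k (t i) (t i + 1) w).
pose d k i w := fine (comp_int k (t i) (t i + 1) w).
pose xi (i : nat) (k : 'I_K) w := (s k i w - d k i w)%R.
pose xb (i : nat) w := (increment_const * (1 + V (t i.+1) w) ^+ 2)%R.
have cst0 : (0 <= increment_const)%R by rewrite !mulr_ge0// addr_ge0.
have sfin k i w : A w -> (s k i w)%:E = stoch_int k (t i) (t i + 1) w.
  move=> Aw; rewrite fineK// ge0_fin_numE ?stoch_int_ge0//.
  exact: le_lt_trans (stoch_int_le _ Aw (rt i)) (ltry _).
have dfin k i w : A w -> (d k i w)%:E = comp_int k (t i) (t i + 1) w.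
  move=> Aw; rewrite fineK// ge0_fin_numE ?comp_int_ge0//.
  exact: le_lt_trans (comp_int_le _ Aw (rt i)) (ltry _).
have s0 k i w : (0 <= s k i w)%R by rewrite fine_ge0// stoch_int_ge0.
have d0 k i w : (0 <= d k i w)%R by rewrite fine_ge0// comp_int_ge0.
have sle k i w : A w -> (s k i w <= xb i w)%R.
  move=> Aw; rewrite -lee_fin sfin//; apply: le_trans (stoch_int_le _ Aw (rt i)) _.
  rewrite -tS lee_fin /xb /increment_const; apply: ler_wpM2r; first exact: sqr_ge0.
  by apply: ler_wpM2l; [exact: mulr_ge0|rewrite lerDl].
have dle k i w : A w -> (d k i w <= xb i w)%R.
  move=> Aw; rewrite -lee_fin dfin//; apply: le_trans (comp_int_le _ Aw (rt i)) _.
  rewrite -tS lee_fin /xb /increment_const; apply: ler_wpM2r; first exact: sqr_ge0.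
  by apply: ler_wpM2l; [exact: mulr_ge0|rewrite lerDr].
have sumE w i k : A w -> (\sum_(l < i) xi l k w =
    fine (stoch_int k r (t i) w) - fine (comp_int k r (t i) w))%R.
  move=> Aw; elim: i => [|i IH].
    by rewrite big_ord0 /t addr0 /stoch_int /comp_int set_itvoc0 !integral_set0 subrr.
  rewrite big_ord_recr/= IH.
  have rr : (r <= t i <= t i + 1)%R by rewrite rt tt1.
  have [f1 f2] := int_fin k i Aw.
  rewrite tS (stoch_int_add _ _ rr) (comp_int_add _ _ rr).
  have f3 : stoch_int k (t i) (t i + 1) w \is a fin_num by rewrite -sfin.
  have f4 : comp_int k (t i) (t i + 1) w \is a fin_num by rewrite -dfin.
  by rewrite (fineD f1 f3) (fineD f2 f4) /xi /s /d opprD addrACA.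
rewrite (_ : \int[P]_(w in A) _ = \int[P]_(w in A)
    (\big[Num.max/0]_(k < K) `|\sum_(l < n) xi l k w|)%:E); last first.
  apply: eq_integral => w /set_mem Aw; congr (_%:E).
  by apply: eq_bigr => k _; rewrite sumE.
have mpast k i u : (t i + 1 <= u)%R -> measurable_fun setT (xi i k : past F u -> R).
  move=> iu; apply: (past_le HF iu).
  by apply: measurable_funB; apply: measurableT_comp => //;
    [exact: measurable_stoch_int|exact: measurable_comp_int].
have mxi k i : measurable_fun setT (xi i k).
  exact: (past_measurable HF (mpast k i _ (lexx _))).
have mxb i : measurable_fun setT (xb i).
  by apply: measurable_funM => //; apply: measurable_funX; exact: measurable_funD.
have xib i k w : A w -> (`|xi i k w| <= xb i w)%R.
  move=> Aw; have := sle k i w Aw; have := dle k i w Aw.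
  have := s0 k i w; have := d0 k i w; rewrite /xi ler_norml => ? ? ? ?.
  by apply/andP; split; lra.
have m4 i : measurable_fun A (fun w => (1 + V (t i) w ^+ 4)%:E).
  apply/measurable_EFinP; apply: measurable_funTS.
  by apply: measurable_funD => //; exact: measurable_funX.
have p4 i w : 0 <= (1 + V (t i) w ^+ 4)%:E by rewrite lee_fin addr_ge0// exprn_ge0.
have xb2 i : \int[P]_(w in A) (xb i w ^+ 2)%:E <=
    (increment_const ^+ 2 * 8)%:E * \int[P]_(w in A) (1 + V (t i.+1) w ^+ 4)%:E.
  have -> : (increment_const ^+ 2 * 8)%:E * \int[P]_(w in A) (1 + V (t i.+1) w ^+ 4)%:E =
     \int[P]_(w in A) ((increment_const ^+ 2 * 8)%:E * (1 + V (t i.+1) w ^+ 4)%:E).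
    by rewrite ge0_integralZl_EFin// mulr_ge0// sqr_ge0.
  apply: ge0_le_integral => //.
  - by move=> w _; rewrite lee_fin sqr_ge0.
  - by apply/measurable_EFinP; apply: measurable_funTS; exact: measurable_funX.
  - exact: measurable_funeM.
  - move=> w Aw; rewrite -EFinM lee_fin /xb exprMn -exprM -[leRHS]mulrA.
    by apply: ler_wpM2l; [exact: sqr_ge0|exact: pow4_le].
have xbfin i : (i < n)%N -> \int[P]_(w in A) (xb i w)%:E < +oo.
  move=> ni; apply: (@le_lt_trans _ _ (\int[P]_(w in A)
      ((increment_const * 8)%:E * (1 + V (t i.+1) w ^+ 4)%:E))).
    apply: ge0_le_integral => //.
    - by move=> w _; rewrite lee_fin mulr_ge0// sqr_ge0.
    - by apply/measurable_EFinP; exact: measurable_funTS.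
    - exact: measurable_funeM.
    - move=> w Aw; rewrite -EFinM lee_fin /xb -[leRHS]mulrA.
      apply: ler_wpM2l => //; apply: le_trans (pow4_le _).
      by rewrite ler_weXn2l// lerDl.
  have -> : \int[P]_(w in A) ((increment_const * 8)%:E * (1 + V (t i.+1) w ^+ 4)%:E) =
     (increment_const * 8)%:E * \int[P]_(w in A) (1 + V (t i.+1) w ^+ 4)%:E.
    by rewrite ge0_integralZl_EFin// mulr_ge0.
  have c8 : (0 <= increment_const * 8)%R by exact: mulr_ge0.
  apply: lte_mul_pinfty => //.
  apply: (@le_lt_trans _ _ S%:E); last exact: ltry.
  apply: le_trans HS; rewrite (bigD1 (Ordinal ni))//= leeDl//.
  by apply: sume_ge0 => l _; apply: integral_ge0 => w _; exact: p4.
apply: (softmax_maximal (xb := xb)) => //.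
- by move=> i k w _; exact: xib.
- apply: (@le_trans _ _ (\sum_(i < n) (increment_const ^+ 2 * 8)%:E *
      \int[P]_(w in A) (1 + V (t i.+1) w ^+ 4)%:E)).
    by apply: lee_sum => i _; exact: xb2.
  rewrite -ge0_sume_distrr; last first.
    by move=> i _; apply: integral_ge0 => w _; exact: p4.
  rewrite [leRHS]EFinM; apply: lee_wpmul2l; last exact: HS.
  by rewrite lee_fin mulr_ge0// sqr_ge0.
move=> i [k b] ni /=.
pose W w := softmax_weight beta (fun k => \sum_(l < i) xi l k w)%R (k, b).
have W01 w : (0 <= W w <= 1)%R by exact: softmax_weight01.
have W0 w : (0 <= W w)%R by have /andP[] := W01 w.
have mW : measurable_fun setT (W : past F (t i) -> R).
  apply: (@measurable_softmax_weight _ (past F (t i)) R K beta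
    (fun k w => \sum_(l < i) xi l k w)%R (k, b) K0) => k'.
  apply: measurable_sum => l; apply: mpast.
  by rewrite -tS lerD2l ler_nat.
have mWo : measurable_fun setT W by exact: (past_measurable HF mW).
(* The weight is formed at [t i] and held from then on, so its product with the regressor is
   predictable; Campbell's formula for this product is the required orthogonality. *)
pose G (p : predictable_space F) := ((if (t i < p.1)%R then W p.2 else 0%R) * H k p)%:E.
have mG : measurable_fun setT G.
  apply/measurable_EFinP; apply: measurable_funM => //.
  have mst := @predictable_step _ _ _ _ HF (t i) _ _ W 0%R mW; exact: mst.
have G0 p : 0 <= G p.
  by rewrite lee_fin mulr_ge0//; case: ifP.
have FA : F (t i) A by have [_ _ Fm] := HF; exact: (Fm _ _ (rt i) _ (controlled_past HC)).
have Nfin : \int[P]_(w in A) N w `](t i), (t i + 1)%R]%classic < +oo.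
  have cc := controlled_count HC (le_trans (rt i) (tt1 (t i))).
  apply: le_lt_trans cc.
  apply: ge0_le_integral => //.
  - by apply: measurable_funTS; exact: (measurable_count HF HA).
  - by apply: measurable_funTS; exact: (measurable_count HF HA).
  - move=> w _; apply: radon_le_itv.
    by move=> u /=; rewrite !in_itv/= => /andP[tu ->]; rewrite (le_lt_trans (rt i)).
have lfin w : A w -> \int[leb]_(v in `](t i), (t i + 1)%R]) (lam v w)%:E < +oo.
  move=> Aw; apply: le_lt_trans (ltry (g2 * (1 + V (t i + 1) w) * (t i + 1 - t i))%R).
  apply: integral_lam_le => // v tv; exact: lamt.
have := campbell HF HA lam0 mlam Hint (H := G) (tt1 (t i)) FA Nfin lfin G0 mG.
have intS w : A w -> \int[N w]_(v in `](t i), (t i + 1)%R]) G (v, w) = (W w * s k i w)%:E.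
  move=> Aw; rewrite EFinM sfin// /stoch_int.
  have -> : (W w)%:E * \int[N w]_(v in `](t i), (t i + 1)%R]) (H k (v, w))%:E =
     \int[N w]_(v in `](t i), (t i + 1)%R]) ((W w)%:E * (H k (v, w))%:E).
    rewrite ge0_integralZl_EFin//; first by move=> v _; rewrite lee_fin.
    exact: mHs.
  apply: eq_integral => v /set_mem; rewrite /= in_itv/= => /andP[tv _].
  by rewrite /G/= tv EFinM.
have intD w : A w -> \int[leb]_(v in `](t i), (t i + 1)%R]) (G (v, w) * (lam v w)%:E) =
    (W w * d k i w)%:E.
  move=> Aw; rewrite EFinM dfin// /comp_int.
  have -> : (W w)%:E * \int[leb]_(v in `](t i), (t i + 1)%R]) (H k (v, w) * lam v w)%:E =
     \int[leb]_(v in `](t i), (t i + 1)%R]) ((W w)%:E * (H k (v, w) * lam v w)%:E).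
    rewrite ge0_integralZl_EFin//; first by move=> v _; rewrite lee_fin mulr_ge0.
    exact: mHls.
  apply: eq_integral => v /set_mem; rewrite /= in_itv/= => /andP[tv _].
  by rewrite /G/= tv -!EFinM mulrA.
under eq_integral => w /set_mem Aw do rewrite intS//.
under [in X in _ = X -> _]eq_integral => w /set_mem Aw do rewrite intD//.
move=> E.
have iW (f : Omega -> R) : measurable_fun setT f -> (forall w, (0 <= f w)%R) ->
    (forall w, A w -> (f w <= xb i w)%R) -> P.-integrable A (fun w => (W w * f w)%:E).
  move=> mf f0 fx; apply/integrableP; split.
    by apply/measurable_EFinP; apply: measurable_funTS; exact: measurable_funM.
  apply: le_lt_trans (xbfin i ni); apply: ge0_le_integral => //.
  - apply: measurableT_comp => //; apply/measurable_EFinP; apply: measurable_funTS.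
    exact: measurable_funM.
  - by apply/measurable_EFinP; exact: measurable_funTS.
  - move=> w Aw; have Wf0 : (0 <= W w * f w)%R by exact: mulr_ge0 (W0 w) (f0 w).
    rewrite gee0_abs lee_fin//.
    rewrite -[leRHS]mul1r; apply: ler_pM => //; last exact: fx.
    by have /andP[] := W01 w.
have ms : measurable_fun setT (s k i).
  apply: measurableT_comp => //.
  apply: (@past_measurable _ _ _ _ HF (t i + 1)%R); exact: measurable_stoch_int.
have md : measurable_fun setT (d k i).
  apply: measurableT_comp => //.
  apply: (@past_measurable _ _ _ _ HF (t i + 1)%R); exact: measurable_comp_int.
under eq_integral do rewrite /xi mulrBr EFinB.
rewrite integralB//.
- rewrite -[X in X - _]/(\int[P]_(w in A) (W w * s k i w)%:E) E subee//.
  by apply: integrable_fin_num => //; apply: iW => // w Aw; exact: dle.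
- by apply: iW => // w Aw; exact: sle.
- by apply: iW => // w Aw; exact: dle.
Qed.

End controlled_event.

End martingale_maximal.

(** * Almost sure finiteness of the stationary past *)

Section stationary_past.
Hypothesis lamfin : forall t w, (forall i, conv (decay (al i)) t (N w) < +oo) ->
  (lam t w <= B * (c + D t w))%R.

Let mconv a t : measurable_fun setT (fun w : past F t => conv (decay a) t (N w)).
Proof.
have h := @predictable_at _ _ _ _ HF t _ _ _ (predictable_conv HF HA (@decay_ge0 R a) (measurable_decay a)).
exact: h.
Qed.

Lemma conv_decay_infty_event a t : F t [set w | conv (decay a) t (N w) = +oo].
Proof.
apply/measurable_past => //.
have := @mconv a t measurableT [set +oo] (emeasurable_set1 +oo); rewrite setTI; exact.
Qed.

Lemma controlled_event r M : controlled r M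
  [set w | (forall i, conv (decay (al i)) r (N w) < +oo) /\ (V r w <= M)%R].
Proof.
split.
- apply/measurable_past => //.
  rewrite (_ : mkset _ = (\bigcap_(i in [set: 'I_m])
      ~` [set w | conv (decay (al i)) r (N w) = +oo]) `&` [set w | V r w <= M]%R).
    apply: measurableI.
      apply: fin_bigcap_measurable => // i _; apply: measurableC.
      by apply/(measurable_past HF); exact: conv_decay_infty_event.
    have mV : measurable_fun setT (fun w : past F r => V r w).
      exact: (predictable_at (t := r) HF (predictable_potential HF HA al wt)).
    have := mV measurableT _ (measurable_itv `]-oo, M]); rewrite setTI.
    by congr (measurable _); apply/seteqP; split => w /=; rewrite in_itv.
  apply/seteqP; split => w /= [fw Vw]; split => // i; first by move=> _ /= E; have := fw i; rewrite E.
  by rewrite ltey; apply/eqP; exact: (fw i I).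
- by move=> w i [].
- by move=> w [].
- move=> w t [fw _] rt; apply: lamfin => i.
  exact: conv_decay_lty (ltW (al0 i)) (fw i).
Qed.

(** The controlled events increase with the bound on [V r], and their union is the almost sure event
    that all convolutions are finite. *)
Lemma controlled_event_large r : (forall i, P [set w | conv (decay (al i)) r (N w) = +oo] = 0) ->
  forall e : R, (0 < e)%R -> exists M A,
    [/\ (0 <= M)%R, controlled r M A & P (~` A) <= e%:E].
Proof.
move=> fin e e0; pose A (n : nat) :=
  [set w | (forall i, conv (decay (al i)) r (N w) < +oo) /\ (V r w <= n%:R)%R].
have mA n : measurable (A n) by exact: (past_set_measurable HF (controlled_past (controlled_event r n%:R))).
have AE : \bigcup_n A n = ~` (\bigcup_(i in [set: 'I_m]) [set w | conv (decay (al i)) r (N w) = +oo]).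
  apply/seteqP; split => [w [n _ [fw _]] [i _ /= E]|w nw]; first by have := fw i; rewrite E.
  exists (Num.truncn (V r w)).+1 => //; split=> [i|].
    by rewrite ltey; apply/eqP => E; apply: nw; exists i.
  by have /truncn_itv/andP[_ /ltW] := V0 r w.
have mI : measurable (\bigcup_(i in [set: 'I_m]) [set w | conv (decay (al i)) r (N w) = +oo]).
  apply: fin_bigcup_measurable => // i _.
  exact: (past_set_measurable HF (conv_decay_infty_event (al i) r)).
have I0 : P (\bigcup_(i in [set: 'I_m]) [set w | conv (decay (al i)) r (N w) = +oo]) = 0.
  apply/eqP; rewrite eq_le measure_ge0 andbT.
  have [Z [mZ Z0 ZP]] : {ae P, forall w, forall i, conv (decay (al i)) r (N w) <> +oo}.
    apply: filter_forall => i; exists [set w | conv (decay (al i)) r (N w) = +oo]; split => //.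
      exact: (past_set_measurable HF (conv_decay_infty_event (al i) r)).
    by move=> w /= /contrapT.
  rewrite -Z0; apply: le_measure; rewrite ?inE//.
  by move=> w [i _ /= wi]; apply: ZP => /= /(_ i).
have cvg : P (A n) @[n --> \oo] --> (1 : \bar R).
  have <- : P (\bigcup_n A n) = 1.
    by rewrite AE probability_setC// I0 sube0.
  apply: (@nondecreasing_cvg_mu _ _ _ P) => //.
    exact: bigcupT_measurable.
  move=> n k nk; apply/subsetPset => w [fw Vw]; split => //.
  by apply: le_trans Vw _; rewrite ler_nat.
have [n _ /(_ n (leqnn n)) nP] : \forall n \near \oo, (1 - e)%:E < P (A n).
  have := cvg [set y | (1 - e)%:E < y]; apply.
  apply: open_nbhs_nbhs; split; first exact: open_ereal_gt_ereal.
  by rewrite /= lte_fin ltrBlDr ltrDl.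
exists n%:R, (A n); split => //; first exact: controlled_event.
rewrite probability_setC// leeBlDr ?fin_num_measure//.
by rewrite -leeBlDl// -EFinB ltW.
Qed.

(** The values at the right ends of the unit steps, where the increments are bounded; reaching the
    last of them takes one more term of [moment_sum] than there are steps. *)
Lemma moment_sum_succ : exists2 C : R, (0 <= C)%R &
  forall r M A n, controlled r M A -> (0 <= M)%R ->
  \sum_(i < n) \int[P]_(w in A) (1 + V (r + i.+1%:R) w ^+ 4)%:E <=
  (C * ((M + J) ^+ 4 + n.+1%:R))%:E.
Proof.
have [C C0 HC] := moment_sum.
exists (C + 1)%R; first exact: addr_ge0.
move=> r M A n Hc M0; have mA := past_set_measurable HF (controlled_past Hc).
have mV t : measurable_fun A (fun w => (V t w ^+ 4)%:E).
  apply/measurable_EFinP; apply: measurable_funTS; apply: measurable_funX.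
  exact: (past_measurable HF (predictable_at (t := t) HF (predictable_potential HF HA al wt))).
have p0 t w : 0 <= (V t w ^+ 4)%:E by rewrite lee_fin exprn_ge0.
apply: (@le_trans _ _ (\sum_(i < n) (1 + \int[P]_(w in A) (V (r + i.+1%:R) w ^+ 4)%:E))).
  apply: lee_sum => i _; under eq_integral do rewrite EFinD.
  rewrite ge0_integralD//; apply: leeD => //.
  have -> : \int[P]_(w in A) 1%:E = P A by rewrite integral_cst// mul1e.
  exact: probability_le1.
rewrite big_split/= mulrDl mul1r EFinD [leRHS]addeC; apply: leeD.
  rewrite (_ : \sum_(i < n) 1 = n%:R%:E); last first.
    by rewrite sumEFin sumr_const card_ord.
  have : (0 <= (M + J) ^+ 4)%R by rewrite exprn_ge0// addr_ge0// sumr_ge0.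
  by rewrite lee_fin -natr1; lra.
apply: le_trans (HC r M A n.+1 Hc M0); rewrite big_ord_recl/= leeDr//.
by apply: integral_ge0 => w _; exact: p0.
Qed.

(* The integral defining a Hawkes intensity takes the junk value 0 when it diverges,
   so that an infinite past would make the intensity bounded. *)
Hypothesis laminf : forall t w i, conv (decay (al i)) t (N w) = +oo -> (lam t w <= B * c)%R.
Hypothesis stat : forall t x, P [set w | x%:E < N w `](t - 1)%R, t]%classic] =
  P [set w | x%:E < N w `](-1)%R, 0%R]%classic].

(** Finiteness does not depend on the time, so the event [I] of an infinite convolution lies in
    every [F s]. On it the intensity is at most [B * c], hence so is the mean count of each unit
    interval over [I]; Markov's inequality and Borel-Cantelli then make the convolution finite
    almost everywhere on [I]. *)
Lemma conv_decay_rate_lty r i : P [set w | conv (decay (al i)) r (N w) = +oo] = 0.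
Proof.
set I := mkset _.
have FI s : F s I.
  have -> : I = [set w | conv (decay (al i)) s (N w) = +oo].
    have imp t t' w : conv (decay (al i)) t (N w) = +oo -> conv (decay (al i)) t' (N w) = +oo.
      move=> E; apply/eqP; rewrite -leye_eq leNgt; apply/negP.
      by move/(conv_decay_lty t (ltW (al0 i))); rewrite E.
    by apply/seteqP; split => w; exact: imp.
  exact: conv_decay_infty_event.
have mI : measurable I := past_set_measurable HF (FI 0%R).
have lamI t w : I w -> (lam t w <= B * c)%R.
  move=> Iw; apply: (laminf (i := i)); apply/eqP; rewrite -leye_eq leNgt; apply/negP.
  by move/(conv_decay_lty r (ltW (al0 i))); rewrite Iw.
have lfin s w : I w -> \int[leb]_(v in `](s - 1)%R, s]) (lam v w)%:E <= (B * c)%:E.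
  move=> Iw; have -> : (B * c = B * c * (s - (s - 1)))%R by ring.
  apply: integral_lam_le => // [|v _]; last exact: lamI.
  by rewrite lerBlDr lerDl.
have EI s : \int[P]_(w in I) N w `](s - 1)%R, s]%classic <= (B * c)%:E.
  have s1 : (s - 1 <= s)%R by rewrite lerBlDr lerDl.
  rewrite (compensator_itv HF HA lam0 Hint s1 (FI _)).
  - apply: (@le_trans _ _ (\int[P]_(w in I) cst (B * c)%:E w)).
      apply: ge0_le_integral => //.
      + by move=> w _; apply: integral_ge0 => v _; rewrite lee_fin.
      + apply: measurable_funTS; apply: (@past_measurable _ _ _ _ HF s).
        apply: (past_integral_lebesgue HF _ (H := fun p => (lam p.1 p.2)%:E)).
        * by move=> p; rewrite lee_fin.
        * exact/measurable_EFinP.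
      + exact: lfin.
    rewrite integral_cst// -[leRHS]mule1; apply: lee_wpmul2l.
      by rewrite lee_fin mulr_ge0.
    exact: probability_le1.
  - by apply: (bounded_intensity_count s1 (FI _)) => w Iw t _; exact: lamI.
  - by move=> w Iw; apply: le_lt_trans (lfin s w Iw) (ltry _).
have := @conv_decay_lty_ae R _ _ P N I (al i) r (B * c) (al0 i) mI
  (measurable_count HF HA) (past_measurable HF (@mconv (al i) r)).
rewrite setIid; apply => n x x0; rewrite mulrC EFinM lee_pdivlMl//.
have -> : (r - n.+1%:R = r - n%:R - 1)%R by rewrite -natr1 opprD addrA.
apply: le_trans (EI _); apply: markov_event => //.
exact: (measurable_count HF HA).
Qed.

(* By stationarity the tail of one unit interval is the average over n of them, and
   the initial value M disappears as n tends to infinity. *)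
Lemma count_tail : exists2 C : R, (0 <= C)%R & forall x : R, (0 < x)%R ->
  P [set w | x%:E < N w `](-1)%R, 0%R]%classic] <= (C / x)%:E.
Proof.
have [C C0 HC] := moment_sum_succ.
pose kp := ((decay hi 1)^-1 / wt j0)%R.
have kp0 : (0 <= kp)%R by rewrite divr_ge0 ?(ltW wtj0)// invr_ge0 expR_ge0.
exists ((1 + kp) * C)%R; first by rewrite mulr_ge0// addr_ge0.
move=> x x0; set E := mkset _.
have mN s t : measurable_fun setT (fun w => N w `]s, t]%classic) by exact: (measurable_count HF HA).
have mE s t : measurable [set w | x%:E < N w `]s, t]%classic].
  by rewrite -[X in measurable X]setTI; exact: emeasurable_fun_o_infty.
have mV t : measurable_fun setT (V t).
  exact: (past_measurable HF (predictable_at (t := t) HF (predictable_potential HF HA al wt))).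
have mE0 : measurable E by exact: mE.
rewrite -[P E]fineK ?fin_num_measure//.
set p := fine (P E); rewrite lee_fin.
apply/ler_addgt0Pl => e e0.
have [M [A [M0 HcA PA]]] := controlled_event_large (conv_decay_rate_lty 0) e0.
have mA := past_set_measurable HF (controlled_past HcA).
have p4 t w : 0 <= (1 + V t w ^+ 4)%:E by rewrite lee_fin addr_ge0// exprn_ge0.
have m4 t : measurable_fun A (fun w => (1 + V t w ^+ 4)%:E).
  apply/measurable_EFinP; apply: measurable_funTS.
  by apply: measurable_funD => //; exact: measurable_funX.
(* Each of the first [n] unit intervals after 0 has the same tail [p]. Leaving [A] costs at most
   [e]; on [A], Markov's inequality applies to a count bounded through the potential at the right
   end. *)
have pn n : (n%:R * p <= n%:R * e + (1 + kp) * C / x * ((M + J) ^+ 4 + n.+1%:R))%R.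
  have step (i : 'I_n) : p%:E <= e%:E + ((1 + kp) / x)%:E *
      \int[P]_(w in A) (1 + V (0 + i.+1%:R) w ^+ 4)%:E.
    rewrite fineK ?fin_num_measure//.
    rewrite /E -(stat i.+1%:R x); set Ei := mkset _.
    apply: (@le_trans _ _ (P (~` A `|` (A `&` Ei)))).
      apply: le_measure; rewrite ?inE.
      - exact: mE.
      - by apply: measurableU; [exact: measurableC|apply: measurableI => //; exact: mE].
      - by move=> w Ew; case: (pselect (A w)) => Aw; [right|left].
    apply: le_trans (measureU2 _ _ _) _.
    - exact: measurableC.
    - by apply: measurableI => //; exact: mE.
    - apply: leeD; first exact: PA.
      rewrite mulrC EFinM -muleA lee_pdivlMl//.
      apply: le_trans (markov_event P mA _ _ x0) _ => //.
      have -> : (1 + kp)%:E * \int[P]_(w in A) (1 + V (0 + i.+1%:R) w ^+ 4)%:E =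
          \int[P]_(w in A) ((1 + kp)%:E * (1 + V (0 + i.+1%:R) w ^+ 4)%:E).
        by rewrite ge0_integralZl_EFin// addr_ge0.
      apply: ge0_le_integral => //.
      - exact: measurable_funTS.
      - by apply: measurable_funeM; exact: m4.
      - move=> w Aw.
        rewrite -(fineK (radon_itv_fin (N w) _ _)) -EFinM lee_fin add0r.
        have := count_le_potential HcA (i.+1%:R - 1) Aw.
        rewrite subrK => /le_trans; apply; rewrite -/kp -/(V i.+1%:R w).
        have v0 := V0 i.+1%:R w; have v4 : (V i.+1%:R w <= 1 + V i.+1%:R w ^+ 4)%R.
          have [v1|/ltW v1] := leP (V i.+1%:R w) 1%R; first by rewrite ler_wpDr// exprn_ge0.
          by rewrite ler_wpDl// exprS ler_peMr// exprn_ege1.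
        rewrite mulrDl; apply: lerD; last exact: ler_wpM2l.
        by rewrite mul1r lerDl exprn_ge0.
  rewrite -lee_fin EFinD.
  apply: (@le_trans _ _ (\sum_(i < n) (e%:E + ((1 + kp) / x)%:E *
      \int[P]_(w in A) (1 + V (0 + i.+1%:R) w ^+ 4)%:E))).
    have -> : (n%:R * p)%:E = \sum_(i < n) p%:E.
      by rewrite sumEFin sumr_const card_ord mulr_natl.
    by apply: lee_sum => i _; exact: step.
  rewrite big_split/=; apply: leeD.
    by rewrite sumEFin sumr_const card_ord mulr_natl.
  rewrite -ge0_sume_distrr; last first.
    by move=> i _; apply: integral_ge0 => w _; exact: p4.
  have -> : ((1 + kp) * C / x * ((M + J) ^+ 4 + n.+1%:R) =
     (1 + kp) / x * (C * ((M + J) ^+ 4 + n.+1%:R)))%R by ring.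
  rewrite [leRHS]EFinM; apply: lee_wpmul2l; last exact: HC.
  by rewrite lee_fin divr_ge0// ?addr_ge0// ltW.
apply: (linear_growth_le (k := (1 + kp) * C / x * ((M + J) ^+ 4 + 1))) => n.
by apply: le_trans (pn n) _; rewrite -natr1; lra.
Qed.

(** By stationarity the tail of [count_tail] holds on every unit interval, so Borel-Cantelli works
    for any positive rate and not only for those of the intensity. *)
Lemma conv_decay_finite (a r : R) : (0 < a)%R ->
  P [set w | conv (decay a) r (N w) = +oo] = 0.
Proof.
move=> a0; have [C C0 HC] := count_tail.
have := @conv_decay_lty_ae R _ _ P N setT a r C a0 measurableT
  (measurable_count HF HA) (past_measurable HF (@mconv a r)).
rewrite setTI; apply => n x x0; rewrite setTI.
have -> : (r - n.+1%:R = r - n%:R - 1)%R by rewrite -natr1 opprD addrA.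
by rewrite stat; exact: HC.
Qed.

End stationary_past.

(** * The noise, uniformly over the Hawkes class and the covariates *)

Section sieve_noise.
Variables (ah at_ : R).
Hypothesis at0 : (0 < at_)%R.
Hypothesis alj0 : al j0 = (ah - at_)%R.

Variables (r M T : R) (A : set Omega) (n : nat).
Hypothesis HC : controlled r M A.
Hypothesis r0 : (r < 0)%R.
Hypothesis Tn : (T <= r + n%:R)%R.

Variables (K : nat) (K0 : (0 < K)%N) (X : R -> Omega -> 'rV[R]_K).
Hypothesis cX : covariates F X.

Let X0 t w k : (0 <= X t w 0%R k)%R.
Proof. by have [_ _ /(_ t w k)/andP[]] := cX. Qed.

Let X1 t w k : (X t w 0%R k <= 1)%R.
Proof. by have [_ _ /(_ t w k)/andP[]] := cX. Qed.

(* The origin r is negative so that the window [0, T], closed at 0 where N may have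
   an atom, lies inside the left-open intervals of the predictable sigma-algebra. *)
Definition window (t : R) : R := if (0 <= t <= T)%R then 1%R else 0%R.

Lemma window01 t : (0 <= window t <= 1)%R.
Proof. by rewrite /window; case: ifP => _; rewrite ?lexx ?ler01. Qed.

Let w0 t : (0 <= window t)%R. Proof. by have /andP[] := window01 t. Qed.

Lemma measurable_window : measurable_fun setT window.
Proof.
rewrite /window; apply: measurable_fun_ifT => //.
by apply: measurable_and; apply: measurable_fun_ler.
Qed.

Definition regressor (j : nat) (k : 'I_K) (p : predictable_space F) : R :=
  (basis ah at_ (N p.2) j p.1 * X p.1 p.2 0%R k * window p.1)%R.

Lemma regressor_ge0 j k p : (0 <= regressor j k p)%R.
Proof. by rewrite !mulr_ge0// basis_ge0. Qed.

Lemma predictable_basis j :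
  measurable_fun setT (fun p : predictable_space F => basis ah at_ (N p.2) j p.1).
Proof.
case: j => [|j] /=; first exact: measurable_cst.
apply: measurableT_comp => //; apply: predictable_conv => //.
  exact: taylor_kernel_ge0.
exact: measurable_taylor_kernel.
Qed.

Lemma measurable_regressor j k : measurable_fun setT (regressor j k).
Proof.
apply: measurable_funM; first apply: measurable_funM.
- exact: predictable_basis.
- exact: predictable_covariates.
- exact: (measurableT_comp measurable_window (predictable_fst HF)).
Qed.

(** All basis convolutions are dominated by the one of rate [al j0], which [V] contains with weight
    [wt j0]; covariates and window are at most 1. *)
Lemma regressor_le j k w s : A w -> (r < s)%R ->
  (regressor j k (s, w) <= (1 + (wt j0)^-1) * (1 + V s w))%R.
Proof.
move=> Aw rs; have cfin i := conv_decay_lty s (ltW (al0 i)) (controlled_fin HC i Aw).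
have b1 := basis_le at0 j (nu := N w) (t := s).
have {}b1 : (basis ah at_ (N w) j s <= 1 + fine (conv (decay (al j0)) s (N w)))%R.
  by rewrite alj0; apply: b1; rewrite -alj0; exact: cfin.
apply: (@le_trans _ _ (1 + fine (conv (decay (al j0)) s (N w)))%R).
  apply: le_trans b1; rewrite /regressor /= -mulrA ler_piMr ?basis_ge0//.
  by have /andP[_ w1] := window01 s; exact: mulr_ile1.
have Vj : (fine (conv (decay (al j0)) s (N w)) <= (wt j0)^-1 * V s w)%R.
  rewrite mulrC ler_pdivlMr// mulrC /V /potential (bigD1 j0)//= lerDl.
  apply: sumr_ge0 => i _; rewrite mulr_ge0// fine_ge0// conv_decay_ge0//.
have i0 : (0 <= (wt j0)^-1)%R by rewrite invr_ge0 ltW.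
rewrite mulrDl mul1r mulrDr mulr1 addrA; have := mulr_ge0 i0 (V0 s w); have := V0 s w.
lra.
Qed.

Let sint j k w : \bar R := stoch_int (regressor j) k r (r + n%:R) w.
Let cint j k w : \bar R := comp_int (regressor j) k r (r + n%:R) w.

Definition deviation j w : R :=
  \big[Num.max/0%R]_(k < K) `|fine (sint j k w) - fine (cint j k w)|%R.

Let h0 : (0 <= 1 + (wt j0)^-1)%R.
Proof. by rewrite addr_ge0// invr_ge0 ltW. Qed.

Lemma deviation_ge0 j w : (0 <= deviation j w)%R.
Proof. exact: bigmax_ge_id. Qed.

Lemma measurable_deviation j : measurable_fun setT (deviation j).
Proof.
rewrite /deviation; elim: (index_enum _) => [|k s IHs].
  by under eq_fun do rewrite big_nil; exact: measurable_cst.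
under eq_fun do rewrite big_cons; apply: measurable_maxr => //.
apply: measurableT_comp => //; apply: (@past_measurable _ _ _ _ HF (r + n%:R)%R).
apply: measurable_funB; apply: measurableT_comp => //.
- exact: (measurable_stoch_int (regressor_ge0 j) (measurable_regressor j)).
- exact: (measurable_comp_int (regressor_ge0 j) (measurable_regressor j)).
Qed.

Lemma deviation_mean j (beta S : R) : (0 < beta)%R ->
  \sum_(i < n) \int[P]_(w in A) (1 + V (r + i.+1%:R) w ^+ 4)%:E <= S%:E ->
  \int[P]_(w in A) (deviation j w)%:E <= (ln (2 * K)%:R / beta + 4 * beta *
    (increment_const (1 + (wt j0)^-1) ^+ 2 * 8 * S))%:E.
Proof.
move=> b0 HS.
exact: (martingale_maximal h0 HC
  K0 (regressor_ge0 j) (measurable_regressor j) (regressor_le j) b0 HS).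
Qed.

Variable kap : nat -> R.
Hypothesis kap0 : forall j, (0 <= kap j)%R.

(** It involves no parameter of the class, so a bound on it also covers a minimiser that depends on
    the path. *)
Definition noise w : \bar R := \sum_(j <oo) (kap j * deviation j w)%:E.

Lemma noise_ge0 w : 0 <= noise w.
Proof. by apply: nneseries_ge0 => j _ _; rewrite lee_fin mulr_ge0// deviation_ge0. Qed.

Lemma measurable_noise : measurable_fun setT noise.
Proof.
apply: ge0_emeasurable_sum => [j w _ _|j _].
  by rewrite lee_fin mulr_ge0// deviation_ge0.
by apply/measurable_EFinP; apply: measurable_funM => //; exact: measurable_deviation.
Qed.

Lemma noise_mean (Kp Psi : R) : (0 <= Psi)%R ->
  \sum_(j <oo) (kap j)%:E <= Kp%:E ->
  (forall j, \int[P]_(w in A) (deviation j w)%:E <= Psi%:E) ->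
  \int[P]_(w in A) noise w <= (Kp * Psi)%:E.
Proof.
move=> Psi0 kapK devP; have mA := past_set_measurable HF (controlled_past HC).
have mdev j : measurable_fun A (fun w => (deviation j w)%:E).
  by apply/measurable_EFinP; apply: measurable_funTS; exact: measurable_deviation.
rewrite /noise integral_nneseries//; last 2 first.
- move=> j; apply/measurable_EFinP; apply: measurable_funTS.
  by apply: measurable_funM => //; exact: measurable_deviation.
- by move=> j w _; rewrite lee_fin mulr_ge0// deviation_ge0.
apply: (@le_trans _ _ (\sum_(j <oo) Psi%:E * (kap j)%:E)); last first.
  rewrite nneseriesZl; last by move=> j _; rewrite lee_fin.
  by rewrite mulrC EFinM; apply: lee_wpmul2l => //; rewrite lee_fin.
apply: lee_nneseries => [j _ _|j _].
  by apply: integral_ge0 => w _; rewrite lee_fin mulr_ge0// deviation_ge0.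
have -> : \int[P]_(w in A) (kap j * deviation j w)%:E =
    (kap j)%:E * \int[P]_(w in A) (deviation j w)%:E.
  under eq_integral do rewrite EFinM.
  by rewrite ge0_integralZl_EFin// => w _; rewrite lee_fin deviation_ge0.
by rewrite muleC; apply: lee_wpmul2r => //; rewrite lee_fin.
Qed.

Variable w : Omega.
Hypothesis Aw : A w.
Variables (L : nat) (cc : R) (dd a : 'rV[R]_L) (b : 'rV[R]_K).
Hypothesis cc0 : (0 <= cc)%R.
Hypothesis dd0 : forall l, (0 <= dd 0%R l)%R.
Hypothesis aa : forall l, (ah - at_ <= a 0%R l <= ah)%R.
Hypothesis b0 : forall k, (0 <= b 0%R k)%R.
Hypothesis bB : (l1norm b <= B)%R.
Hypothesis coefk : forall j, (basis_coef ah at_ cc dd a j <= kap j)%R.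

Let f t : R := (hawkes N cc dd a t w * linear_covariates X b t w)%R.
Let coef j : R := basis_coef ah at_ cc dd a j.

Let coef0 j : (0 <= coef j)%R.
Proof.
case: j => //= j; apply: sumr_ge0 => l _; rewrite mulr_ge0// exprn_ge0//.
by rewrite divr_ge0 ?(ltW at0)// subr_ge0; have /andP[] := aa l.
Qed.

Let mX k : measurable_fun setT (fun t => X t w 0%R k).
Proof. exact: (predictable_path w (predictable_covariates (F := F) k cX)). Qed.

Let mbasis j : measurable_fun setT (basis ah at_ (N w) j).
Proof. exact: (predictable_path w (predictable_basis j)). Qed.

Let mlamw : measurable_fun setT (lam ^~ w).
Proof. exact: (predictable_path w mlam). Qed.

Let integral_window (mu : {measure set (measurableTypeR R) -> \bar R}) (rho : R -> R) :
  (forall t, 0 <= rho t)%R -> measurable_fun setT rho ->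
  \int[mu]_(t in `[0%R, T]) (f t * rho t)%:E =
  \sum_k (b 0%R k)%:E * \sum_(j <oo) (coef j)%:E *
    \int[mu]_(t in `]r, (r + n%:R)%R]) (basis ah at_ (N w) j t * X t w 0%R k * (window t * rho t))%:E.
Proof.
move=> rho0 mrho.
transitivity (\int[mu]_(t in `]r, (r + n%:R)%R]) (hawkes N cc dd a t w *
    (\sum_k X t w 0%R k * b 0%R k) * (window t * rho t))%:E).
  rewrite integral_mkcond [RHS]integral_mkcond; apply: eq_integral => t _.
  rewrite /patch !mem_setE !in_itv/= /window; case: ifPn => tT.
    have /andP[t0 tT'] := tT.
    by rewrite (lt_le_trans r0 t0) (le_trans tT' Tn)/= mul1r.
  by rewrite mul0r mulr0; case: ifP.
apply: class_integral => //.
- by move=> j t; exact: basis_ge0.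
- by move=> t; rewrite mulr_ge0.
- by apply: measurable_funM => //; exact: measurable_window.
- move=> t _; apply: hawkes_basis => //.
  by rewrite -alj0; exact: conv_decay_lty (ltW (al0 _)) (controlled_fin HC j0 Aw).
Qed.

Let fin j k : sint j k w \is a fin_num /\ cint j k w \is a fin_num.
Proof.
exact: (int_fin h0 HC
  (regressor_ge0 j) (measurable_regressor j) (regressor_le j) k n Aw).
Qed.

Let sum_b : (\sum_k b 0%R k <= B)%R.
Proof.
by apply: le_trans bB; apply: ler_sum => k _; exact: ler_norm.
Qed.

Let integralN : \int[N w]_(t in `[0%R, T]) (f t)%:E =
  \sum_k (b 0%R k)%:E * \sum_(j <oo) (coef j)%:E * sint j k w.
Proof.
transitivity (\int[N w]_(t in `[0%R, T]) (f t * cst 1%R t)%:E).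
  by apply: eq_integral => t _; rewrite mulr1.
rewrite integral_window//; apply: eq_bigr => k _; congr (_ * _).
apply: eq_eseriesr => j _; congr (_ * _); apply: eq_integral => t _.
by rewrite /regressor/= mulr1.
Qed.

Let integralL : \int[leb]_(t in `[0%R, T]) (f t * lam t w)%:E =
  \sum_k (b 0%R k)%:E * \sum_(j <oo) (coef j)%:E * cint j k w.
Proof.
rewrite integral_window//; apply: eq_bigr => k _; congr (_ * _).
apply: eq_eseriesr => j _; congr (_ * _); apply: eq_integral => t _.
by rewrite /regressor/= mulrA.
Qed.

Lemma noise_upper : \int[N w]_(t in `[0%R, T]) (f t)%:E <=
  \int[leb]_(t in `[0%R, T]) (f t * lam t w)%:E + B%:E * noise w.
Proof.
rewrite integralN integralL; apply: class_integral_le => //.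
- by move=> j; rewrite coef0; exact: coefk.
- by move=> j k; exact: (stoch_int_ge0 (regressor_ge0 j)).
- by move=> j k; exact: (comp_int_ge0 (regressor_ge0 j)).
- by move=> j k; exact: (fin j k).1.
- by move=> j k; exact: (fin j k).2.
Qed.

Lemma noise_lower : \int[leb]_(t in `[0%R, T]) (f t * lam t w)%:E <=
  \int[N w]_(t in `[0%R, T]) (f t)%:E + B%:E * noise w.
Proof.
rewrite integralN integralL.
have -> : noise w = \sum_(j <oo) (kap j * \big[Num.max/0%R]_k
    `|fine (cint j k w) - fine (sint j k w)|%R)%:E.
  apply: eq_eseriesr => j _; congr (_ * _)%:E; apply: eq_bigr => k _.
  by rewrite distrC.
apply: class_integral_le => //.
- by move=> j; rewrite coef0; exact: coefk.
- by move=> j k; exact: (comp_int_ge0 (regressor_ge0 j)).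
- by move=> j k; exact: (stoch_int_ge0 (regressor_ge0 j)).
- by move=> j k; exact: (fin j k).2.
- by move=> j k; exact: (fin j k).1.
Qed.

End sieve_noise.

End controlled_process.

(** * The rate of the least-squares estimator *)

Section parameters.
Context (R : realType).

Lemma compact_coord_le (L : nat) (S : set 'rV[R]_L) : compact S -> S !=set0 ->
  exists M : R, forall x, S x -> forall l, x 0 l <= M.
Proof.
move=> cS S0.
have /choice[f Hf] : forall l : 'I_L, exists M : R, forall x, S x -> x 0 l <= M.
  move=> l; have [|x0 _ Hx] := @compact_EVT_max _ _ (fun x : 'rV[R]_L => x 0 l) S S0 cS.
    by apply: continuous_subspaceT; exact: coord_continuous.
  by exists (x0 0 l) => x Sx; apply: Hx; rewrite inE.
exists (\big[Num.max/0]_l f l) => x Sx l; apply: le_trans (Hf l x Sx) _.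
by rewrite (bigmaxD1 l)// le_max lexx.
Qed.

Lemma compact_coord_gt0 (L : nat) (S : set 'rV[R]_L) : compact S -> S !=set0 ->
  (forall x, S x -> forall l, 0 < x 0 l) ->
  exists2 e : R, 0 < e & forall x, S x -> forall l, e <= x 0 l.
Proof.
move=> cS S0 Sp.
have /choice[f Hf] : forall l : 'I_L, exists e : R, 0 < e /\ forall x, S x -> e <= x 0 l.
  move=> l; have [|x0 Sx0 Hx] := @compact_EVT_min _ _ (fun x : 'rV[R]_L => x 0 l) S S0 cS.
    by apply: continuous_subspaceT; exact: coord_continuous.
  exists (x0 0 l); split; first by apply: Sp; rewrite inE in Sx0.
  by move=> x Sx; apply: Hx; rewrite inE.
exists (\big[Num.min/1]_l f l); first by apply: lt_bigmin => // l _; exact: (Hf l).1.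
move=> x Sx l; apply: le_trans ((Hf l).2 x Sx).
by rewrite (bigminD1 l)// ge_min lexx.
Qed.

Lemma ln_double_le (K : nat) : (0 < K)%N -> 0 < ln (2 * K)%:R :> R /\
  ln (2 * K)%:R <= 4 * ln (1 + K%:R) :> R.
Proof.
move=> K0; have K1 : (1 : R) <= K%:R by rewrite ler1n.
split; first by rewrite ln_gt0// natrM; lra.
have l0 : 0 <= ln (1 + K%:R) :> R by rewrite ln_ge0//; lra.
apply: (@le_trans _ _ (2 * ln (1 + K%:R))); last by lra.
have k1 : 0 < 1 + K%:R :> R by lra.
have k2 : 0 < (2 * K)%:R :> R by rewrite natrM; lra.
rewrite mulr_natl -lnXn// ler_ln ?posrE ?exprn_gt0// natrM.
have -> : (1 + K%:R : R) ^+ 2 = 1 + 2 * K%:R + K%:R ^+ 2 by ring.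
have := sqr_ge0 (K%:R : R); lra.
Qed.

Lemma unit_grid (T : R) : 1 <= T -> let n := (Num.truncn T).+2 in
  T <= -1 + n%:R /\ n.+1%:R <= 4 * T.
Proof.
move=> T1 n; have /truncn_itv/andP[T2 T3] : 0 <= T by exact: le_trans T1.
by rewrite /n -!natr1 in T3 *; split; lra.
Qed.

(** Dominates [basis_coef] over the whole compact parameter set when [q] is the expansion ratio of
    the smallest rate. *)
Definition majorant (cb db q : R) (j : nat) : R := if j is i.+1 then db * q ^+ i else cb.

Lemma majorant_ge0 cb db q j : 0 <= cb -> 0 <= db -> 0 <= q -> 0 <= majorant cb db q j.
Proof. by move=> c0 d0 q0; case: j => //= j; rewrite mulr_ge0// exprn_ge0. Qed.

Lemma majorant_sum cb db q : 0 <= cb -> 0 <= db -> 0 <= q < 1 ->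
  (\sum_(j <oo) (majorant cb db q j)%:E <= (cb + db / (1 - q))%:E)%E.
Proof.
move=> c0 d0 q01; have /andP[q0 _] := q01.
have m0 j : (0 <= (majorant cb db q j)%:E)%E by rewrite lee_fin majorant_ge0.
rewrite nneseries_recl// EFinD; apply: leeD => //.
rewrite -(nneseries_addn (f := fun j => (majorant cb db q j)%:E) 1 m0).
rewrite (eq_eseriesr (g := fun j => (db * q ^+ j)%:E)); last by move=> j _; rewrite addn1.
exact: nneseries_geometric_le.
Qed.

Lemma basis_coef_le (L : nat) (c : R) (dd a : 'rV[R]_L) (lo hi at_ cb db : R) j :
  0 < at_ -> lo <= hi -> (forall l, 0 <= dd 0 l) -> (forall l, lo <= a 0 l <= hi) ->
  c <= cb -> \sum_l dd 0 l <= db ->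
  basis_coef hi at_ c dd a j <= majorant cb db ((hi - lo) / at_) j.
Proof.
move=> at0 lohi d0 al ccb ddb; case: j => //= j.
have q0 : 0 <= (hi - lo) / at_ by rewrite divr_ge0 ?(ltW at0)// subr_ge0.
apply: (@le_trans _ _ (\sum_l dd 0 l * ((hi - lo) / at_) ^+ j)).
  apply: ler_sum => l _; apply: ler_wpM2l => //; have /andP[a1 a2] := al l.
  apply: lerXn2r; rewrite ?nnegrE//; first by rewrite divr_ge0 ?(ltW at0)// subr_ge0.
  by rewrite ler_pM2r ?invr_gt0//; lra.
by rewrite -mulr_suml; apply: ler_wpM2r => //; rewrite exprn_ge0.
Qed.

Lemma stationary_count (disp : measure_display) (Omega : measurableType disp)
    (P : probability Omega R) (N : Omega -> radon R) :
  stationary_ergodic P (@radon_sigma R) (@radon_shift R) N ->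
  forall t x, P [set w | (x%:E < N w `](t - 1)%R, t]%classic)%E] =
    P [set w | (x%:E < N w `](-1)%R, 0%R]%classic)%E].
Proof.
move=> [_ st _] t x; pose S := [set nu : radon R | (x%:E < nu `](-1)%R, 0%R]%classic)%E].
have mS : radon_sigma S.
  apply: sub_sigma_algebra; exists `](-1)%R, 0%R]%classic, [set y | (x%:E < y)%E]; split => //.
  - exact: measurable_itv.
  - rewrite (_ : mkset _ = `]x%:E, +oo[%classic); first exact: emeasurable_itv.
    by apply/seteqP; split => y /=; rewrite in_itv/= andbT.
rewrite -(st t S mS); congr (P _); apply/funext => w; rewrite /S /=.
suff -> : `](t - 1)%R, t]%classic = translate t @^-1` `](-1)%R, 0%R]%classic by [].
by apply/seteqP; split => s /=; rewrite /translate !in_itv/=; move=> /andP[? ?];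
  apply/andP; split; lra.
Qed.

End parameters.

Theorem theorem2
  (R : realType) (disp : measure_display) (Omega : measurableType disp)
  (P : probability Omega R)
  (F : R -> set (set Omega)) (N : Omega -> radon R)
  (L : nat) (L_gt0 : (0 < L)%N)
  (B c0 : R) (d0 a0 : 'rV[R]_L) (C : set R) (D A : set 'rV[R]_L)
  (g0 : R -> Omega -> R)
  (K : R -> nat)
  (X : forall T : R, R -> Omega -> 'rV[R]_(K T)) (b0 : forall T : R, 'rV[R]_(K T))
  (htilde gtilde : R -> Omega -> R -> Omega -> R) :
  filtration F ->
  point_process N ->
  adapted F N ->
  stationary_ergodic P (@radon_sigma R) (@radon_shift R) N ->
  weak_exogeneity P F N g0 ->
  let h0 := hawkes N c0 d0 a0 in
  let lambda0 := fun t omega => h0 t omega * g0 t omega in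
  (exists t omega, lambda0 t omega != 0) ->
  intensity P F N lambda0 ->
  (forall T, 0 < T ->
    [/\ covariates F (X T),
        (forall k, 0 <= b0 T 0 k),
        l1norm (b0 T) <= B &
        g0 = linear_covariates (X T) (b0 T)]) ->
  B * (\sum_(l < L) d0 0 l / a0 0 l) < 1 ->
  d0 0 (Ordinal L_gt0) = 1 ->
  (forall T, 0 < T -> class_G (X T) B g0) ->
  parameter_space C D A -> C c0 -> D d0 -> A a0 ->
  (* (htilde T, gtilde T) is the minimizer for the data on [0, T] *)
  (forall T, 0 < T -> {ae P, forall omega,
    argmin2 (class_H N C D A) (class_G (X T) B) (fun h g => contrast N T h g omega)
      (htilde T omega) (gtilde T omega)}) ->
  bounded_in_proba P
    (fun T omega => T^-1 * \int[lebesgue_measure]_(t in `[0, T])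
       (h0 t omega * g0 t omega
        - htilde T omega t omega * gtilde T omega t omega) ^+ 2)
    (fun T => B * Num.sqrt (ln (1 + (K T)%:R) / T)).
Proof.
move=> HF PP HA ST _ h0 lambda0 [t1 [w1 lam1]] Hint HX Brho d01 HG PAR Cc Dd Aa Hargmin.
have [[cC Cpos] [cD Dpos] [cA Apos]] := PAR.
have HN w : counting_simple (N w) by have [_ h1 h2] := PP; split=> [S|s]; [exact: h1|exact: h2].
have d0_ge0 l : 0 <= d0 0 l by exact: Dpos.
have a0p l : 0 < a0 0 l by exact: Apos.
have c0p : 0 < c0 by exact: Cpos.
pose l0 := Ordinal L_gt0.
have dl0 : d0 0 l0 != 0 by rewrite d01 oner_neq0.
have g0b t w : 0 <= g0 t w <= B.
  by have [cX b00 bB ->] := HX 1 ltr01; exact: (linear_covariates_bound t w cX b00 bB).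
have B0 : 0 <= B by have /andP[u1 u2] := g0b 0 w1; exact: le_trans u1 u2.
(* A nonzero value of the intensity forces [B > 0] and [K T > 0], so that the rate is positive. *)
have g0nz : g0 t1 w1 != 0 by apply: contra_neq lam1 => g00; rewrite /lambda0 g00 mulr0.
have Bp : 0 < B.
  rewrite lt_neqAle B0 andbT; apply: contra_neq g0nz => B00.
  by apply/eqP; rewrite eq_le; have := g0b t1 w1; rewrite -B00 andbC.
have Kp T : 0 < T -> (0 < K T)%N.
  move=> T0; rewrite lt0n; apply/eqP => K0; move/negP: g0nz; apply; apply/eqP.
  have [_ _ _ ->] := HX T T0; rewrite /linear_covariates big1// => k _.
  by exfalso; have := ltn_ord k; move: (nat_of_ord k) => i; rewrite K0.
have lam_ge0 t w : 0 <= lambda0 t w.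
  have /andP[g1 _] := g0b t w; rewrite mulr_ge0//; apply: le_trans (hawkes_ge N c0 a0 t w d0_ge0).
  exact: ltW.
have mlam : measurable_fun setT (fun p : predictable_space F => lambda0 p.1 p.2).
  apply: measurable_funM; first exact: (predictable_hawkes HF HA).
  by have [cX _ _ ->] := HX 1 ltr01; exact: predictable_linear.
have [alo alo0 Halo] := compact_coord_gt0 cA (ex_intro _ _ Aa) Apos.
have [ahi Hahi] := compact_coord_le cA (ex_intro _ _ Aa).
have [dbar Hdbar] := compact_coord_le cD (ex_intro _ _ Dd).
have [cb Hcb] : exists cb, forall c, C c -> c <= cb.
  have [|c' _ Hc'] := @compact_EVT_max _ _ (@id R) C (ex_intro _ _ Cc) cC.
    by apply: continuous_subspaceT => x; exact: cvg_id.
  by exists c' => c Cc1; apply: Hc'; rewrite inE.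
have cb0 : 0 < cb by exact: lt_le_trans c0p (Hcb _ Cc).
have lohi : alo <= ahi by exact: le_trans (Halo _ Aa l0) (Hahi _ Aa l0).
pose db := dbar *+ L.
have Hdb dd : D dd -> \sum_l dd 0 l <= db.
  move=> Ddd; apply: (@le_trans _ _ (\sum_(l < L) dbar)).
    by apply: ler_sum => l _; exact: Hdbar.
  by rewrite sumr_const card_ord.
have db0 : 0 <= db by apply: le_trans (Hdb _ Dd); exact: sumr_ge0.
(* Replacing the rates of zero weight ensures that any infinite convolution makes the
   Hawkes integral diverge. *)
pose a1 : 'rV[R]_L := \row_l (if d0 0 l == 0 then a0 0 l0 else a0 0 l).
pose al1 l := a1 0 l.
(* The sum of these weights, times [B], is the quantity assumed to be below 1; multiplied by the
   rates they return [d0], so that [D] is the memory term of the intensity. *)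
pose wt1 l := d0 0 l / a0 0 l.
have a1b l : alo <= al1 l <= ahi.
  by rewrite /al1 mxE; case: ifP => _; rewrite Halo// Hahi.
have wt1_ge0 l : 0 <= wt1 l by rewrite divr_ge0// ltW.
have wa1 l : wt1 l * al1 l = d0 0 l.
  rewrite /wt1 /al1 mxE; case: eqP => [->|_]; first by rewrite !mul0r.
  by rewrite divfK// gt_eqF.
have pot1 t w : potential al1 (N w) (fun i => wt1 i * al1 i) t =
    \sum_(l < L) d0 0 l * fine (conv (decay (a1 0 l)) t (N w)).
  by apply: eq_bigr => l _; rewrite wa1.
have lamfin1 t w : (forall i, conv (decay (al1 i)) t (N w) < +oo)%E ->
    lambda0 t w <= B * (c0 + potential al1 (N w) (fun i => wt1 i * al1 i) t).
  move=> fin; have /andP[g1 g2] := g0b t w; rewrite pot1 mulrC /lambda0 /h0.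
  rewrite -(hawkes_finite (N := N) (a := a0) c0 d0_ge0 _ fin); last first.
    by move=> l /negbTE dl; rewrite mxE dl.
  apply: ler_wpM2l => //.
  by apply: le_trans (hawkes_ge N c0 a0 t w d0_ge0); exact: ltW.
have laminf1 t w i : (conv (decay (al1 i)) t (N w) = +oo)%E -> lambda0 t w <= B * c0.
  have /andP[g1 g2] := g0b t w; rewrite /al1 mxE mulrC /lambda0 /h0 => E.
  have -> : hawkes N c0 d0 a0 t w = c0.
    move: E; case: ifPn => [_|dl] E.
      exact: (hawkes_infinite c0 d0_ge0 dl0 E).
    exact: (hawkes_infinite c0 d0_ge0 dl E).
  by apply: ler_wpM2l => //; exact: ltW.
have c0_ge0 : 0 <= c0 by exact: ltW.
have hi0 : 0 <= ahi by apply: le_trans lohi; exact: ltW.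
have wt1l0 : 0 < wt1 l0 by rewrite divr_gt0// d01.
have past_finite a r : 0 < a -> (P [set w | conv (decay a) r (N w) = +oo] = 0)%E.
  exact: (conv_decay_finite HF HA HN lam_ge0 mlam Hint B0 c0_ge0 alo0 a1b wt1_ge0 Brho
    hi0 wt1l0 lamfin1 laminf1 (stationary_count ST)).
(* An extra slow rate ar, of weight eps small enough to keep B * \sum wt2 < 1, makes
   the potential dominate all the Taylor kernels. *)
pose ar := alo / 2.
pose eps := (1 - B * \sum_(l < L) wt1 l) / (2 * (B + 1)).
have ar0 : 0 < ar by rewrite divr_gt0.
have B1 : 0 < 2 * (B + 1) by rewrite mulr_gt0// addr_gt0.
have eps0 : 0 < eps by rewrite divr_gt0// subr_gt0.
pose al2 (i : 'I_L.+1) := oapp al1 ar (unlift ord0 i).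
pose wt2 (i : 'I_L.+1) := oapp wt1 eps (unlift ord0 i).
have al20 : al2 ord0 = ar by rewrite /al2 unlift_none.
have wt20 : wt2 ord0 = eps by rewrite /wt2 unlift_none.
have al2l l : al2 (lift ord0 l) = al1 l by rewrite /al2 liftK.
have wt2l l : wt2 (lift ord0 l) = wt1 l by rewrite /wt2 liftK.
have ara : ar <= alo by rewrite /ar; lra.
have a2b i : ar <= al2 i <= ahi.
  rewrite /al2; case: unliftP => [l _|_] /=; last by rewrite lexx (le_trans ara).
  by have /andP[u1 ->] := a1b l; rewrite (le_trans ara u1).
have wt2_ge0 i : 0 <= wt2 i by rewrite /wt2; case: unliftP => [l _|_] //=; exact: ltW.
have Brho2 : B * (\sum_i wt2 i) < 1.
  rewrite big_ord_recl wt20; under eq_bigr do rewrite wt2l.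
  rewrite mulrDr /eps mulrCA -[X in _ + X < _]mul1r.
  have : (1 - B * \sum_(l < L) wt1 l) * (B / (2 * (B + 1))) <
         (1 - B * \sum_(l < L) wt1 l) * 1.
    by rewrite ltr_pM2l ?subr_gt0// ltr_pdivrMr//; lra.
  lra.
have lamfin2 t w : (forall i, conv (decay (al2 i)) t (N w) < +oo)%E ->
    lambda0 t w <= B * (c0 + potential al2 (N w) (fun i => wt2 i * al2 i) t).
  move=> fin; apply: le_trans (lamfin1 t w _) _ => [i|].
    by have := fin (lift ord0 i); rewrite al2l.
  apply: ler_wpM2l => //; rewrite lerD2l /potential big_ord_recl.
  under [X in _ <= _ + X]eq_bigr do rewrite al2l wt2l.
  rewrite lerDr al20 wt20; apply: mulr_ge0; first by apply: mulr_ge0; exact: ltW.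
  by apply: fine_ge0; exact: conv_decay_ge0.
have wt200 : 0 < wt2 ord0 by rewrite wt20.
(* The dominating rate [ahi - at_] is then [ar], and since [ar < alo] the expansion ratio
   [(ahi - alo) / at_] is below 1. *)
pose at_ := ahi - ar.
have at0 : 0 < at_ by rewrite /at_ /ar; lra.
have alj0 : al2 ord0 = ahi - at_ by rewrite al20 /at_; ring.
pose q := (ahi - alo) / at_.
have q01 : 0 <= q < 1.
  rewrite /q divr_ge0 ?(ltW at0) ?subr_ge0//= ltr_pdivrMr// mul1r /at_ /ar; lra.
have /andP[q0 q1] := q01.
pose kap := majorant cb db q.
have kap_ge0 j : 0 <= kap j by apply: majorant_ge0 => //; exact: ltW.
pose Ks := cb + db / (1 - q).
have Ks0 : 0 < Ks by rewrite ltr_wpDr// divr_ge0// subr_ge0 ltW.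
have Hkap : (\sum_(j <oo) (kap j)%:E <= Ks%:E)%E by apply: majorant_sum => //; exact: ltW.
have [Cm Cm0 HCm] := moment_sum_succ HF HA HN lam_ge0 mlam Hint B0 c0_ge0 ar0 a2b wt2_ge0
  Brho2 hi0.
move=> e e0.
have e20 : 0 < e / 2 by rewrite divr_gt0.
(* Half of [e] pays for leaving [A0], the other half for a large noise. [A0] and [M] are fixed
   before [T], so the constants built from them serve all horizons. *)
have [M [A0 [M0 HC PA]]] := controlled_event_large HF HA ar0 a2b wt2_ge0 lamfin2
  (fun i => past_finite _ (-1) (lt_le_trans ar0 (andP (a2b i)).1)) e20.
pose J := \sum_i wt2 i.
have J0 : 0 <= J by exact: sumr_ge0.
pose S1 := Cm * ((M + J) ^+ 4 + 4).
have S10 : 0 <= S1 by rewrite mulr_ge0// addr_ge0// exprn_ge0// addr_ge0.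
pose inc := increment_const wt2 B c0 ahi ord0 (1 + (wt2 ord0)^-1).
(* The 32 is the product of the 4 in the quadratic term of the softmax bound and the 8 of
   [pow4_le]. *)
pose G := 1 + 32 * (inc ^+ 2 * S1).
have incS0 : 0 <= inc ^+ 2 * S1 by apply: mulr_ge0 => //; exact: sqr_ge0.
have G0 : 0 < G by rewrite /G ltr_pwDl// mulr_ge0.
have mA0 := past_set_measurable HF (controlled_past HC).
(* The 8 combines the factor 4 of [least_squares_excess] with the 2 in the Markov level [x]; the
   last 2 is the root of the 4 in [ln (2 * K) <= 4 * ln (1 + K)]. *)
exists (8 * Ks / e * G * 2); split.
  by do 2 apply: mulr_gt0 => //; apply: divr_gt0 => //; apply: mulr_gt0.
near=> T.
have T1 : 1 <= T by near: T; exact: nbhs_pinfty_ge.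
have T0 : 0 < T by exact: lt_le_trans T1.
have [cX b00 bB g0E] := HX T T0.
have [lnK0 lnK] := ln_double_le R (Kp T T0).
pose n := (Num.truncn T).+2.
have [Tn nT] : T <= -1 + n%:R /\ n.+1%:R <= 4 * T := unit_grid T1.
pose S := S1 * T.
have HS : (\sum_(i < n) \int[P]_(w in A0)
    (1 + potential al2 (N w) wt2 (-1 + i.+1%:R) ^+ 4)%:E <= S%:E)%E.
  apply: le_trans (HCm (-1) M A0 n HC M0) _.
  rewrite lee_fin /S /S1 -mulrA; apply: ler_wpM2l => //.
  rewrite mulrDl; apply: lerD => //; rewrite -[leLHS]mulr1; apply: ler_wpM2l => //.
  by rewrite exprn_ge0// addr_ge0.
(* With this choice [ln (2 * K T) / beta] equals [beta * T], which balances the two terms of the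
   softmax bound. *)
pose beta := Num.sqrt (ln (2 * K T)%:R / T).
have beta0 : 0 < beta by rewrite sqrtr_gt0 divr_gt0.
pose Psi := ln (2 * K T)%:R / beta + 4 * beta * (inc ^+ 2 * 8 * S).
have beta2 : ln (2 * K T)%:R = beta ^+ 2 * T.
  by rewrite sqr_sqrtr ?divr_ge0 ?(ltW lnK0) ?(ltW T0)// divfK// gt_eqF.
have PsiE : Psi = G * (beta * T).
  rewrite /Psi beta2 /G /S; field; by rewrite gt_eqF.
have Psi0 : 0 < Psi by rewrite PsiE; do 2 apply: mulr_gt0 => //.
have Hdev j := deviation_mean HF HA HN lam_ge0 mlam Hint B0 c0_ge0 ar0 a2b wt2_ge0 hi0
  wt200 at0 alj0 T HC (Kp T T0) cX j beta0 HS.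
pose Z := noise F N lambda0 ahi at_ (-1) T n (X T) kap.
have HZ : (\int[P]_(w in A0) Z w <= (Ks * Psi)%:E)%E.
  exact: (noise_mean HF HA lam_ge0 mlam HC cX kap_ge0 (ltW Psi0) Hkap Hdev).
have mZ : measurable_fun setT Z := measurable_noise HF HA lam_ge0 mlam ahi at_ (-1) T n cX kap_ge0.
have Z_ge0 v : (0 <= Z v)%E by exact: noise_ge0.
(* The mean of the noise over [A0] is at most [Ks * Psi], so it exceeds this level there with
   probability at most [e / 2]. *)
pose x := 2 * Ks * Psi / e.
have x0 : 0 < x by apply: divr_gt0 => //; do 2 apply: mulr_gt0 => //.
have mE : measurable (A0 `&` [set w | (x%:E < Z w)%E]).
  apply: measurableI => //; rewrite -[X in measurable X]setTI.
  exact: emeasurable_fun_o_infty.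
have PZ : (P (A0 `&` [set w | x%:E < Z w]) <= (e / 2)%:E)%E.
  have h1 := le_trans (markov_event P mA0 mZ Z_ge0 x0) HZ.
  rewrite -(lee_pmul2l (x := x%:E))//; apply: le_trans h1 _.
  rewrite -EFinM lee_fin /x le_eqVlt; apply/orP; left; apply/eqP; field.
  by rewrite gt_eqF.
have [Y [mY PY Ysub]] := Hargmin T T0.
(* [Y] is a null event that contains all outcomes where the minimising property fails. *)
exists (~` A0 `|` (A0 `&` [set w | (x%:E < Z w)%E]) `|` Y); split.
- by apply: measurableU => //; apply: measurableU => //; exact: measurableC.
- apply: le_trans (measureU2 _ _ _) _ => //.
    by apply: measurableU => //; exact: measurableC.
  rewrite [X in (_ + X)%E](_ : _ = 0%E); last exact: PY.
  rewrite adde0; apply: le_trans (measureU2 _ _ _) _ => //; first exact: measurableC.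
  by rewrite (_ : e%:E = (e / 2)%:E + (e / 2)%:E)%E ?leeD// -EFinD -splitr.
move=> w /= Hw; apply: contrapT => nE; move: Hw; apply/negP; rewrite -leNgt.
have Aw : A0 w by apply: contrapT => nA; apply: nE; left; left.
have Zw : (Z w <= x%:E)%E.
  by rewrite leNgt; apply/negP => lt; apply: nE; left; right.
have [Hh Hg Hmin] : argmin2 (class_H N C D A) (class_G (X T) B)
   (fun h g => contrast N T h g w) (htilde T w) (gtilde T w).
  by apply: contrapT => nm; apply: nE; right; apply: Ysub.
have [c' [d' [a' [Cc' Dd' Aa' hE]]]] := Hh.
have [b' [bB' b0' gE]] := Hg.
have BZ : (B%:E * Z w <= (B * x)%:E)%E by rewrite EFinM lee_wpmul2l// lee_fin.
have ahE : ahi - at_ = ar by rewrite /at_; ring.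
have coefle c d a j : C c -> D d -> A a -> basis_coef ahi at_ c d a j <= kap j.
  move=> Cc1 Dd1 Aa1; apply: basis_coef_le => //.
  - exact: Dpos.
  - by move=> l; rewrite Halo// Hahi.
  - exact: Hcb.
  - exact: Hdb.
have abnd a : A a -> forall l, ahi - at_ <= a 0 l <= ahi.
  by move=> Aa1 l; rewrite ahE (le_trans ara (Halo _ Aa1 l)) Hahi.
have upper := noise_upper HF HA HN lam_ge0 mlam B0 c0_ge0 ar0 a2b wt2_ge0 hi0 wt200 at0 alj0
  HC (ltrN10 R) Tn cX Aw (ltW (Cpos _ Cc')) (Dpos _ Dd') (abnd _ Aa') b0' bB'
  (fun j => coefle _ _ _ j Cc' Dd' Aa').
have lower := noise_lower HF HA HN lam_ge0 mlam B0 c0_ge0 ar0 a2b wt2_ge0 hi0 wt200 at0 alj0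
  HC (ltrN10 R) Tn cX Aw c0_ge0 d0_ge0 (abnd _ Aa) b00 bB (fun j => coefle _ _ _ j Cc Dd Aa).
have cfin : (conv (decay ar) (-1) (N w) < +oo)%E.
  by rewrite -al20; exact: (controlled_fin HC ord0 Aw).
(* A bound depending on the path, used for the finiteness of the integrals in
   [least_squares_excess]; the final rate does not contain it. *)
pose kb := cb + db * (fine (conv (decay ar) (-1) (N w)) + fine (N w `[-1, T[%classic)).
have hle c d a t : C c -> D d -> A a -> 0 <= t <= T -> hawkes N c d a t w <= kb.
  move=> Cc1 Dd1 Aa1 /andP[t0 tT].
  have t1T : -1 <= t <= T by rewrite tT andbT (le_trans (lerN10 R)).
  apply: le_trans (hawkes_le c ar0 (Dpos _ Dd1) _ cfin t1T) _.
    by move=> l; rewrite (le_trans ara (Halo _ Aa1 l)).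
  apply: lerD; first exact: Hcb.
  apply: ler_wpM2r; last exact: Hdb.
  by apply: addr_ge0; apply: fine_ge0 => //; exact: conv_decay_ge0.
have g'b t : 0 <= gtilde T w t w <= B by rewrite gE; exact: (linear_covariates_bound t w cX b0' bB').
have h'0 t : 0 <= htilde T w t w.
  rewrite hE; apply: le_trans (hawkes_ge N c' a' t w (Dpos _ Dd')).
  by apply: ltW; exact: Cpos.
have h0_ge0 t : 0 <= h0 t w.
  by apply: le_trans (hawkes_ge N c0 a0 t w d0_ge0).
have mf0 : measurable_fun setT (fun t => lambda0 t w) by exact: (predictable_path w mlam).
have mf1 : measurable_fun setT (fun t => htilde T w t w * gtilde T w t w).
  rewrite hE gE; apply: measurable_funM.
    exact: (predictable_path w (predictable_hawkes HF HA c' a' (Dpos _ Dd'))).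
  exact: (predictable_path w (predictable_linear b' cX)).
have := @least_squares_excess R (N w) T (B * x) (kb * B) (fun t => lambda0 t w)
  (fun t => htilde T w t w * gtilde T w t w) T0 mf0 mf1.
have f00 t : 0 <= lambda0 t w by exact: lam_ge0.
have f10 t : 0 <= htilde T w t w * gtilde T w t w.
  by apply: mulr_ge0 => //; have /andP[] := g'b t.
have f0k t : 0 <= t <= T -> lambda0 t w <= kb * B.
  by move=> tT; have /andP[u1 u2] := g0b t w; apply: ler_pM => //; exact: hle.
have f1k t : 0 <= t <= T -> htilde T w t w * gtilde T w t w <= kb * B.
  move=> tT; have /andP[u1 u2] := g'b t; apply: ler_pM => //.
  by rewrite hE; exact: hle.
move=> /(_ f00 f10 f0k f1k)/= Hex.
have /andP[z0 z1] : 0 <= T^-1 * \int[lebesgue_measure]_(t in `[0, T])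
    (lambda0 t w - htilde T w t w * gtilde T w t w) ^+ 2 <= 4 * (B * x) / T.
  apply: Hex.
  (* The true pair belongs to the classes and is therefore a competitor of the minimiser. *)
  - by apply: (Hmin h0 g0); [exists c0, d0, a0|exact: HG].
  - rewrite hE gE; apply: le_trans upper _; exact: leeD.
  - move: lower; rewrite -g0E => lower; apply: le_trans lower _; exact: leeD.
rewrite ger0_norm//; apply: le_trans z1 _.
have -> : 4 * (B * x) / T = 8 * Ks / e * G * B * beta.
  by rewrite /x PsiE; field; rewrite !gt_eqF.
rewrite -!mulrA ler_pM2l// ler_pM2l// ler_pM2l ?invr_gt0// ler_pM2l//.
rewrite [leRHS]mulrCA ler_pM2l//.
have -> : 2 * Num.sqrt (ln (1 + (K T)%:R) / T) = Num.sqrt (4 * (ln (1 + (K T)%:R) / T)).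
  rewrite [RHS]sqrtrM// (_ : 4 = 2 ^+ 2 :> R); last by ring.
  by rewrite sqrtr_sqr ger0_norm.
by rewrite ler_sqrt ?mulrA ?ler_pM2r ?invr_gt0// mulr_ge0// ?invr_ge0 ?(ltW T0)// (le_trans (ltW lnK0)).
Unshelve. all: by end_near. Qed.
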